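(* Let $q\ge 2$ and $C\ge 2$ be integers, let $\nu>0$, and let $\vec\lambda=(\lambda_0,\dots,\lambda_C)\in\mathbb{R}_+^{C+1}$ with $\lambda_0>0$. Put $\Lambda_n=\sum_{i=0}^n\lambda_i$ and assume that $\Lambda_{C-1}^2-\Lambda_C\Lambda_{C-2}>0$. Then the controlled unicast-multicast model with $C_V=1$, $C_E=C$, weight vectors $\vec\nu=(1,\nu)$ and $\vec\lambda$, on the infinite $(q+1)$-regular tree has multiple (i.e. more than one) Gibbs measures if and only if $$(q+1)^2\Lambda_C\Lambda_{C-2}<(q-1)^2\Lambda_{C-1}^2$$ (i.e. $(q,C,\vec\lambda)\in\mathcal{A}$) and $\nu\in(\nu_-,\nu_+)$, where $\nu_-=J(\alpha_-)$ and $\nu_+=J(\alpha_+)$, with $$J(\xi)=\xi\left(\frac{\Lambda_C+\xi\Lambda_{C-1}}{\Lambda_{C-1}+\xi\Lambda_{C-2}}\right)^q,\qquad \xi\in[0,\infty),$$ and $\alpha_-<\alpha_+$ being the distinct positive real roots of the quadratic $$Q(\alpha)=\alpha^2\Lambda_{C-1}\Lambda_{C-2}+\alpha\left[(1-q)\Lambda_{C-1}^2+(1+q)\Lambda_C\Lambda_{C-2}\right]+\Lambda_C\Lambda_{C-1}.$$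
   Context: $\mathbb{R}_+=[0,\infty)$. The set $\mathcal A$ consists of the triples $(q,C,\vec\lambda)$ with integers $q,C\ge2$ and $(q+1)^2\Lambda_C\Lambda_{C-2}<(q-1)^2\Lambda_{C-1}^2$; under this condition $Q$ has two distinct positive real roots. The controlled unicast-multicast model with parameters $C_V,C_E\le C$ and weight vectors $\vec\nu=(\nu_0,\dots,\nu_{C_V})$, $\vec\lambda=(\lambda_0,\dots,\lambda_{C_E})$: Let $G=(V,E)$ be the infinite $(q+1)$-regular tree. The augmented graph $\hat G=(\hat V,\hat E)$ has vertex set $\hat V=V\cup E$ and edge set $\hat E=E\cup\{xe: x\in V, e\in E, e \text{ is incident to } x\}$. For $U\subset\hat V$, $\hat\partial U$ is the set of elements of $\hat V\setminus U$ adjacent in $\hat G$ to some element of $U$, and $\Delta U=U\cup\hat\partial U$. Configurations on $U\subset\hat V$ are elements of $\hat S^U=\{0,\dots,C_V\}^{U\cap V}\times\{0,\dots,C_E\}^{U\cap E}$. A configuration $\tau\in \hat S^U$ is feasible if for each edge $xy\in E$ the sum of the values of $\tau$ over $\{x,y,xy\}\cap U$ is at most $C$. $\hat\sigma_U$ denotes the projection of a configuration to $U$. For finite $U\subset\hat V$, let $\hat m_U$ be the probability measure on $\hat S^U$ with $\hat m_U(\tau)\propto\prod_{v\in U\cap V}\nu_{\tau_v}\prod_{e\in U\cap E}\lambda_{\tau_e}$ for feasible $\tau$, and $\hat m_U(\tau)=0$ otherwise. For finite nonempty $U\subset\hat V$ put $$\hat\pi_U(\tau_{\hat\partial U};\hat\sigma_U=\tau_U)=\hat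 m_{\Delta U}(\hat\sigma_U=\tau_U\mid\hat\sigma_{\hat\partial U}=\tau_{\hat\partial U})$$ whenever $\hat m_{\Delta U}(\hat\sigma_{\hat\partial U}=\tau_{\hat\partial U})>0$. A Gibbs measure for the controlled unicast-multicast model is a probability measure $\hat\mu$ on $\hat S^{\hat V}$ (with the product $\sigma$-field) such that for every finite nonempty $U\subset\hat V$ and $\hat\mu$-a.e. $\tau$, one has $\hat m_{\Delta U}(\hat\sigma_{\hat\partial U}=\tau_{\hat\partial U})>0$ and $$\hat\mu(\hat\sigma_U=\tau_U\mid\hat\sigma_{\hat V\setminus U}=\tau_{\hat V\setminus U})=\hat\pi_U(\tau_{\hat\partial U};\hat\sigma_U=\tau_U).$$ *)

(* Defs.v *)
From HB Require Import structures.
From mathcomp Require Import all_boot all_order all_algebra finmap.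
From mathcomp Require Import all_classical all_reals all_analysis.

Set Implicit Arguments.
Unset Strict Implicit.
Unset Printing Implicit Defensive.

Import Order.TTheory GRing.Theory Num.Theory.

Local Open Scope classical_set_scope.
Local Open Scope ring_scope.

Record is_regular_tree (V : choiceType) (adj : rel V) (d : nat) : Prop :=
  IsRegularTree {
    tree_inhabited : inhabited V;
    tree_irreflexive : irreflexive adj;
    tree_symmetric : symmetric adj;
    tree_regular : forall x, ([set y | adj x y] #= `I_d)%card;
    tree_connected : forall x y, exists2 p, path adj x p & last x p = y;
    tree_acyclic : forall c : seq V, (2 < size c)%N -> ~ ucycle adj c }.

Section Augmented_graph.
Variables (V : choiceType) (adj : rel V).

Definition is_edge : pred {fset V} :=
  fun e => `[< exists x y, adj x y /\ e = [fset x; y]%fset >].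

Definition edge : Type := {e : {fset V} | is_edge e}.
HB.instance Definition _ := Choice.on edge.

Definition hatV : Type := (V + edge)%type.
HB.instance Definition _ := Choice.on hatV.

Definition hat_adj : rel hatV := fun z w =>
  match z, w with
  | inl x, inl y => adj x y
  | inl x, inr e => x \in val e
  | inr e, inl x => x \in val e
  | inr _, inr _ => false
  end.

(* The set {x, y, xy} attached to the edge xy. *)
Definition edge_block (e : edge) : pred hatV := fun z =>
  match z with inl x => x \in val e | inr f => f == e end.

Definition hat_boundary_set (U : {fset hatV}) : set hatV :=
  [set z | z \notin U /\ exists2 w, w \in U & hat_adj w z].

(* [fset_set] returns the empty set on infinite sets; it is harmless here, as
   hat_boundary_set U is finite when the graph is locally finite. *)
Definition hat_boundary (U : {fset hatV}) : {fset hatV} :=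
  fset_set (hat_boundary_set U).

Definition hat_closure (U : {fset hatV}) : {fset hatV} :=
  (U `|` hat_boundary U)%fset.

End Augmented_graph.

Section Model.
Variables (R : realType) (V : choiceType) (adj : rel V).
Variables (C CV CE : nat) (nu : 'I_CV.+1 -> R) (lam : 'I_CE.+1 -> R).

Local Notation hatV := (hatV adj).

Definition spin (z : hatV) : Type :=
  'I_(match z with inl _ => CV | inr _ => CE end).+1.

Definition config : Type := forall z : hatV, spin z.
HB.instance Definition _ := gen_eqMixin config.
HB.instance Definition _ := gen_choiceMixin config.
HB.instance Definition _ := isPointed.Build config (fun z => ord0).

Definition fconfig (U : {fset hatV}) : finType :=
  {dffun forall z : U, spin (val z)}.

Definition restr (U : {fset hatV}) (tau : config) : fconfig U :=
  [ffun z : U => tau (val z)].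

Definition feasible (U : {fset hatV}) (s : fconfig U) : Prop :=
  forall e : edge adj,
    (\sum_(z : U | edge_block e (val z)) (s z : nat) <= C)%N.

Definition spin_weight (z : hatV) : spin z -> R :=
  match z return spin z -> R with inl _ => nu | inr _ => lam end.

Definition weight (U : {fset hatV}) (s : fconfig U) : R :=
  if `[< feasible s >] then \prod_(z : U) spin_weight (s z) else 0.

Definition hat_m (U : {fset hatV}) (s : fconfig U) : R :=
  weight s / \sum_(t : fconfig U) weight t.

Definition hat_m_pr (U : {fset hatV}) (A : pred (fconfig U)) : R :=
  \sum_(s | A s) hat_m s.

(* The event that the projections to U of s and tau coincide; it is used for
   U included in W. *)
Definition agree (W U : {fset hatV}) (tau : config) : pred (fconfig W) :=
  fun s => [forall z : W, (val z \in U) ==> (s z == tau (val z))].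

Definition hat_m_boundary (U : {fset hatV}) (tau : config) : R :=
  hat_m_pr (@agree (hat_closure U) (hat_boundary U) tau).

Definition hat_pi (U : {fset hatV}) (tau : config) : R :=
  hat_m_pr [predI @agree (hat_closure U) U tau
                & @agree (hat_closure U) (hat_boundary U) tau]
  / hat_m_boundary U tau.

(* Generators of the sigma-field of the coordinates in D. *)
Definition coord_sets (D : set hatV) : set (set config) :=
  [set A | exists2 z, D z & exists B : set (spin z), A = [set tau | B (tau z)]].

Definition config_space := g_sigma_algebraType (coord_sets setT).

Definition outside_space (U : {fset hatV}) :=
  g_sigma_algebraType (coord_sets [set z | z \notin U]).

(* p is a version of the conditional probability of A given the projection to
   the complement of U. *)
Definition is_cond_prob (mu : probability config_space R) (U : {fset hatV})
    (A : set config_space) (p : config_space -> R) : Prop :=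
  [/\ measurable_fun setT (p : outside_space U -> R),
      mu.-integrable setT (EFin \o p) &
      forall B : set (outside_space U), measurable B ->
        (\int[mu]_(tau in (B : set config_space)) (p tau)%:E
         = mu (A `&` B))%E].

(* p s is a version of the conditional probability that the projection to U is
   s, so p (restr U tau) tau is the conditional probability of the values of tau
   on U given those of tau off U. *)
Definition is_Gibbs (mu : probability config_space R) : Prop :=
  forall U : {fset hatV}, U != fset0 ->
    exists p : fconfig U -> config_space -> R,
      (forall s, is_cond_prob mu U [set tau | restr U tau = s] (p s)) /\
      {ae mu, forall tau,
         0 < hat_m_boundary U tau /\ p (restr U tau) tau = hat_pi U tau}.

(* Measures are total functions on sets, so two of them are distinguished by
   their values on measurable sets only. *)
Definition multiple_Gibbs : Prop :=
  exists mu1 mu2 : probability config_space R,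
    [/\ is_Gibbs mu1, is_Gibbs mu2 &
        exists2 A : set config_space, measurable A & mu1 A != mu2 A].

End Model.

Section Thresholds.
Variables (R : realType) (q C : nat) (lam : 'I_C.+1 -> R).

Definition Lambda (n : nat) : R := \sum_(i < C.+1 | (i <= n)%N) lam i.

Definition in_calA : Prop :=
  [/\ (2 <= q)%N, (2 <= C)%N &
      (q%:R + 1) ^+ 2 * Lambda C * Lambda (C - 2)
      < (q%:R - 1) ^+ 2 * Lambda (C - 1) ^+ 2].

Definition J (xi : R) : R :=
  xi * ((Lambda C + xi * Lambda (C - 1))
        / (Lambda (C - 1) + xi * Lambda (C - 2))) ^+ q.

Definition Q : {poly R} :=
  (Lambda (C - 1) * Lambda (C - 2)) *: 'X^2
  + ((1 - q%:R) * Lambda (C - 1) ^+ 2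
     + (1 + q%:R) * Lambda C * Lambda (C - 2)) *: 'X
  + (Lambda C * Lambda (C - 1))%:P.

Definition unicast_weights (nu : R) : 'I_2 -> R :=
  fun i => if i == ord0 then 1 else nu.

End Thresholds.

(* Main.v *)
Require Import Defs.
From HB Require Import structures.
From mathcomp Require Import all_boot all_order all_algebra finmap.
From mathcomp Require Import all_classical all_reals all_analysis.
From mathcomp Require Import measurable_realfun zify ring lra.

(* The edges are summed out first: two adjacent vertices with spins [a], [b] then
   interact through [Lambda (C - a - b)], so the vertices carry an
   antiferromagnetic Ising-like model on the tree, whose messages obey
   [y = G y] with [G y = g (nu y^q)] and
   [g x = (Lambda_(C-1) + x Lambda_(C-2)) / (Lambda_C + x Lambda_(C-1))].
   Messages started anywhere in [0, 1] are squeezed between the iterates of the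
   decreasing map [G] at 0 and 1, whose limits form a 2-cycle of [G]; without a
   proper 2-cycle they converge to the fixed point and the finite marginals of a
   Gibbs measure are forced. A proper 2-cycle [l < u] conversely yields two
   Gibbs measures, with messages [l] and [u] alternating between generations.

   Let [xi = nu y^q] at the fixed point [y], so that [J xi = nu]. A proper 2-cycle
   exists iff [G' y < -1], that is [Q xi < 0]. If [G' y < -1], then [G \o G]
   expands near [y] and stays bounded. Conversely [G] is a power map followed by a
   homography; the former expands the cross-ratio of [l < y = y < u] and
   the latter preserves it, which for a 2-cycle says precisely [- G' y > 1]. *)


Set Implicit Arguments.
Unset Strict Implicit.
Unset Printing Implicit Defensive.

Import Order.TTheory GRing.Theory Num.Theory.
Import numFieldNormedType.Exports.

Local Open Scope classical_set_scope.
Local Open Scope ring_scope.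

(** * Cross-ratios and the recursion on the tree *)

(** A Gibbs measure is given through versions of conditional probabilities, known only almost
    everywhere. Both directions therefore pass through identities between probabilities of
    cylinders, multiplied out so as to cover null boundary conditions. The cylinders are those of
    the prefixes of a breadth-first numbering: each new vertex brings exactly one edge, to its
    parent, so weights are products indexed by the number and marginals come from summing out the
    last vertex.

    Given the spins just outside a large prefix, the law on a small one is a product weight with one
    message per boundary vertex. Messages act multiplicatively, so the squeezing must be in ratio
    and not only in length; the number of messages depends on the small prefix alone and stays fixed
    while the ratio tends to 1.

    [Q] is a quadratic, positive at 0 and at infinity, and [J] increases, so [Q xi < 0] says that
    [nu] lies strictly between the thresholds. Negativity of [Q] at one positive point already
    forces the inequality defining [in_calA]. *)

Section Power.
Variable R : realFieldType.
Implicit Types x z : R.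

Lemma mul_sub_expr_ge0 x (i j : nat) : 0 <= x ->
  0 <= (1 - x ^+ i) * (1 - x ^+ j).
Proof.
move=> x0; have [x1|x1] := leP x 1.
  by rewrite mulr_ge0 // subr_ge0 exprn_ile1.
by rewrite mulr_le0 // subr_le0 exprn_ege1 // ltW.
Qed.

(* Adding the sum to its reversal, each pair [z^i + z^(q-i)] is at most
   [1 + z^q]. *)
Lemma sum_expr_lt x (q : nat) : (2 <= q)%N -> 0 <= x -> x != 1 ->
  2 * \sum_(i < q) x ^+ i < q%:R * (1 + x ^+ q) + (1 - x ^+ q).
Proof.
move=> q2 x0 xn1.
have rev : \sum_(i < q) x ^+ i.+1 = \sum_(i < q) x ^+ (q - i)%N.
  rewrite (reindex_inj rev_ord_inj) /=; apply: eq_bigr => i _.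
  by rewrite subnSK.
have shift : \sum_(i < q) x ^+ i.+1 = \sum_(i < q) x ^+ i + x ^+ q - 1.
  have E : \sum_(i < q.+1) x ^+ i = 1 + \sum_(i < q) x ^+ i.+1.
    by rewrite big_ord_recl expr0.
  by move: E; rewrite big_ord_recr /= => ->; ring.
have -> : 2 * \sum_(i < q) x ^+ i =
    \sum_(i < q) (x ^+ i + x ^+ (q - i)%N) + (1 - x ^+ q).
  rewrite big_split /= -rev shift; move: (\sum_(i < q) x ^+ i) => S.
  by ring.
rewrite ltrD2r.
have -> : q%:R * (1 + x ^+ q) = \sum_(i < q) (1 + x ^+ q).
  by rewrite sumr_const card_ord mulr_natl.
have le1 (i : 'I_q) : x ^+ i + x ^+ (q - i)%N <= 1 + x ^+ q.
  have := mul_sub_expr_ge0 i (q - i)%N x0.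
  have -> : x ^+ q = x ^+ i * x ^+ (q - i)%N.
    by rewrite -exprD subnKC // ltnW.
  by move: (x ^+ i) (x ^+ (q - i)%N) => a b; lra.
(* Strictness comes from the index 1, available since [q >= 2]: its gap is [(1 - x) (1 - x^(q-1))],
   positive for [x != 1]. *)
rewrite -subr_gt0 -sumrB (bigD1 (Ordinal q2)) //=.
rewrite ltr_wpDr //; first by apply: sumr_ge0 => i _; rewrite subr_ge0.
have -> : x ^+ q = x ^+ 1 * x ^+ (q - 1)%N by rewrite -exprD subnKC // ltnW.
rewrite expr1 subn1.
have -> : 1 + x * x ^+ q.-1 - (x + x ^+ q.-1) = (1 - x) * (1 - x ^+ q.-1) by ring.
have q1 : q.-1 != 0%N by case: q q2 {rev shift le1} => [|[|]].
have [x1|x1] := ltP x 1.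
  by rewrite mulr_gt0 // subr_gt0 // exprn_ilt1.
by rewrite nmulr_rgt0 subr_lt0 ?exprn_egt1 // lt_neqAle eq_sym xn1.
Qed.

(* [t |-> t^q] expands the cross-ratio of [l < y = y < u]: dividing by
   everything, this says that [1/(t^q - 1) - 1/(q (t - 1))] takes a larger
   value at [u/y > 1] than at [l/y < 1], and the two are separated by the value
   [-(q-1)/(2q)] that it has in the limit at 1. *)
Lemma expr_cross_ratio (l y u : R) (q : nat) : (2 <= q)%N -> 0 <= l -> l < y -> y < u ->
  (u ^+ q - y ^+ q) * (y ^+ q - l ^+ q) * (u - l) <
  q%:R * y ^+ q.-1 * (u ^+ q - l ^+ q) * ((u - y) * (y - l)).
Proof.
move=> q2 l0 ly yu.
have y0 : 0 < y by lra.
have yn0 : y != 0 by rewrite gt_eqF.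
(* Both sides are homogeneous of degree [2q + 1] in [(l, y, u)], so one may scale to [y = 1]. *)
pose a := l / y; pose b := u / y.
have la : l = a * y by rewrite /a divfK.
have ub : u = b * y by rewrite /b divfK.
have a0 : 0 <= a by rewrite divr_ge0 // ltW.
have a1 : a < 1 by rewrite ltr_pdivrMr // mul1r.
have b1 : 1 < b by rewrite ltr_pdivlMr // mul1r.
clearbody a b; rewrite la ub !exprMn.
have yq : y ^+ q = y * y ^+ q.-1 by rewrite -exprS prednK // ltnW.
have Sa := @sum_expr_lt a q q2 a0 (negbT (lt_eqF a1)).
have Sb := @sum_expr_lt b q q2 (ltW (lt_trans ltr01 b1)) (negbT (gt_eqF b1)).
have Ea : 1 - a ^+ q = (1 - a) * \sum_(i < q) a ^+ i.
  by rewrite -[LHS]opprB subrX1 -mulNr opprB.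
have Eb : b ^+ q - 1 = (b - 1) * \sum_(i < q) b ^+ i by rewrite subrX1.
have aq1 : a ^+ q < 1 by rewrite exprn_ilt1 // -lt0n ltnW.
have bq1 : 1 < b ^+ q by rewrite exprn_egt1 // -lt0n ltnW.
rewrite -subr_gt0.
set x := a ^+ q in Sa Ea aq1 *; set z := b ^+ q in Sb Eb bq1 *.
set Pa := \sum_(i < q) a ^+ i in Sa Ea; set Pb := \sum_(i < q) b ^+ i in Sb Eb.
rewrite yq; set Y := y ^+ q.-1.
have -> : q%:R * Y * (z * (y * Y) - x * (y * Y)) * ((b * y - y) * (y - a * y)) -
    (z * (y * Y) - y * Y) * (y * Y - x * (y * Y)) * (b * y - a * y) =
  Y ^+ 2 * y ^+ 3 * (q%:R * (z - x) * ((b - 1) * (1 - a)) - (z - 1) * (1 - x) * (b - a)).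
  by ring.
have Y0 : 0 < Y by rewrite exprn_gt0.
rewrite mulr_gt0 ?mulr_gt0 ?exprn_gt0 //.
have -> : q%:R * (z - x) * ((b - 1) * (1 - a)) - (z - 1) * (1 - x) * (b - a) =
  (1 - a) * ((1 - x) * (b - 1) * q%:R - (1 - x) * (z - 1)) +
  (b - 1) * ((z - 1) * (1 - a) * q%:R - (1 - x) * (z - 1)) by ring.
have b10 : 0 < b - 1 by lra.
have a10 : 0 < 1 - a by lra.
have z10 : 0 < z - 1 by lra.
have x10 : 0 < 1 - x by lra.
have -> : (1 - a) * ((1 - x) * (b - 1) * q%:R - (1 - x) * (z - 1)) +
    (b - 1) * ((z - 1) * (1 - a) * q%:R - (1 - x) * (z - 1)) =
  (1 - a) * (b - 1) * ((1 - x) * (q%:R - Pb) + (z - 1) * (q%:R - Pa)).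
  by rewrite {1}Eb {3}Ea; ring.
rewrite mulr_gt0 ?mulr_gt0 //.
(* With weights [1 - x] and [z - 1] the two bounds add up to exactly twice the goal, the products
   [(1 - x)(1 - z)] and [(z - 1)(1 - x)] cancelling. *)
have := mulr_gt0 x10 (_ : 0 < q%:R * (1 + z) + (1 - z) - 2 * Pb).
have := mulr_gt0 z10 (_ : 0 < q%:R * (1 + x) + (1 - x) - 2 * Pa).
rewrite !subr_gt0 => /(_ Sa) + /(_ Sb).
by nra.
Qed.

End Power.

Section Recursion.
Variables (R : realType) (A B D nu : R) (q : nat).
Hypotheses (D_gt0 : 0 < D) (DB : D <= B) (BA : B <= A) (AD_lt : A * D < B ^+ 2).
Hypotheses (nu_gt0 : 0 < nu) (q_ge2 : (2 <= q)%N).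

Let B_gt0 : 0 < B. Proof. exact: lt_le_trans DB. Qed.
Let A_gt0 : 0 < A. Proof. exact: lt_le_trans BA. Qed.
Let q_gt0 : (0 < q)%N. Proof. exact: ltnW. Qed.

Definition ratio (x : R) : R := (B + x * D) / (A + x * B).
Definition tree_rec (y : R) : R := ratio (nu * y ^+ q).
(** At a fixed point [y], with [x = nu y^q], one has [- G' y = q x (B^2 - A D) / ((B + x D)(A + x
    B))]; hence [slope_form x] is negative exactly when [G' y < -1]. As a polynomial in [x] it is
    [Q], see [hornerQ]. *)
Definition slope_form (x : R) : R :=
  (B + x * D) * (A + x * B) - q%:R * x * (B ^+ 2 - A * D).

Local Notation G := tree_rec.

Lemma ratio_den_gt0 x : 0 <= x -> 0 < A + x * B.
Proof. by move=> x0; rewrite ltr_wpDr // mulr_ge0 // ltW. Qed.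

Lemma ratio_sub x z : 0 <= x -> 0 <= z ->
  ratio x - ratio z =
  (z - x) * ((B ^+ 2 - A * D) / ((A + x * B) * (A + z * B))).
Proof.
move=> /ratio_den_gt0/lt0r_neq0 x0 /ratio_den_gt0/lt0r_neq0 z0.
by rewrite /ratio; field; rewrite x0 z0.
Qed.

Lemma ratio_lt x z : 0 <= x -> x < z -> ratio z < ratio x.
Proof.
move=> x0 xz; have z0 : 0 <= z by apply: le_trans x0 (ltW xz).
rewrite -subr_gt0 ratio_sub // mulr_gt0 ?subr_gt0 // divr_gt0 ?subr_gt0 //.
by rewrite mulr_gt0 // ratio_den_gt0.
Qed.

Lemma ratio_gt0 x : 0 <= x -> 0 < ratio x.
Proof.
move=> x0; rewrite divr_gt0 ?ratio_den_gt0 //.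
by rewrite ltr_wpDr // mulr_ge0 // ltW.
Qed.

Lemma ratio_le1 x : 0 <= x -> ratio x <= 1.
Proof.
move=> x0; rewrite ler_pdivrMr ?ratio_den_gt0 // mul1r lerD //.
by rewrite ler_wpM2l.
Qed.

Lemma field_ge0 y : 0 <= y -> 0 <= nu * y ^+ q.
Proof. by move=> y0; rewrite mulr_ge0 ?exprn_ge0 // ltW. Qed.

Lemma tree_rec_gt0 y : 0 <= y -> 0 < G y.
Proof. by move=> /field_ge0/ratio_gt0. Qed.

Lemma tree_rec_le1 y : 0 <= y -> G y <= 1.
Proof. by move=> /field_ge0/ratio_le1. Qed.

Lemma tree_rec_lt y z : 0 <= y -> y < z -> G z < G y.
Proof.
move=> y0 yz; apply: ratio_lt; first exact: field_ge0.
by rewrite ltr_pM2l // ltr_pXn2r // nnegrE // (le_trans y0) // ltW.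
Qed.

Lemma tree_rec_le y z : 0 <= y -> y <= z -> G z <= G y.
Proof.
move=> y0; rewrite le_eqVlt => /predU1P[->//|yz].
exact/ltW/tree_rec_lt.
Qed.

Lemma ratio_continuous x : 0 <= x -> {for x, continuous ratio}.
Proof.
move=> x0; apply: cvgM.
  by apply: cvgD; [exact: cvg_cst|apply: cvgM; [exact: cvg_id|exact: cvg_cst]].
apply: cvgV; first by rewrite gt_eqF // ratio_den_gt0.
by apply: cvgD; [exact: cvg_cst|apply: cvgM; [exact: cvg_id|exact: cvg_cst]].
Qed.

Lemma tree_rec_continuous y : 0 <= y -> {for y, continuous G}.
Proof.
move=> y0; change {for y, continuous (ratio \o (fun y => nu * y ^+ q))}; apply: continuous_comp.
  by apply: cvgM; [exact: cvg_cst|exact: exprn_continuous].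
exact/ratio_continuous/field_ge0.
Qed.

Lemma tree_rec_fixpoint : exists2 y, 0 < y & G y = y.
Proof.
have cG : {within `[0, 1]%classic, continuous (fun y => G y - y)}.
  apply: continuous_in_subspaceT => y; rewrite inE /= in_itv /= => /andP[y0 _].
  by apply: cvgB; [exact: tree_rec_continuous|exact: cvg_id].
have [|y] := IVT ler01 cG (v := 0).
  rewrite ge_min le_max (subr_le0 1) tree_rec_le1 // orbT /=.
  by rewrite (subr_ge0 0) ltW // tree_rec_gt0.
rewrite in_itv /= => /andP[y0 _] /eqP; rewrite subr_eq0 => /eqP Gy.
by exists y => //; rewrite -Gy tree_rec_gt0.
Qed.

Lemma two_cycle_slope l u y : 0 <= l -> l < y -> y < u ->
  G l = u -> G u = l -> G y = y -> slope_form (nu * y ^+ q) < 0.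
Proof.
move=> l0 ly yu Gl Gu Gy.
have y0 : 0 < y by exact: le_lt_trans ly.
have u0 : 0 < u by exact: lt_trans yu.
have := expr_cross_ratio q_ge2 l0 ly yu.
pose x t := nu * t ^+ q; have x0 t : 0 <= t -> 0 <= x t by exact: field_ge0.
pose d t := A + x t * B.
have dn0 t : 0 <= t -> d t != 0 by move=> /x0/ratio_den_gt0/lt0r_neq0.
have d0 t : 0 <= t -> 0 < d t by move=> /x0/ratio_den_gt0.
pose E := B ^+ 2 - A * D.
have E0 : 0 < E by rewrite subr_gt0.
(* The 2-cycle enters here: [G] exchanges [l] and [u] and fixes [y], so each difference of messages
   is a difference of the values [nu t^q] times [E / (d d')]. *)
have ul : u - l = (x u - x l) * (E / (d l * d u)).
  have -> : u - l = G l - G u by rewrite Gl Gu.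
  by apply: ratio_sub; apply: x0 => //; apply: ltW.
have uy : u - y = (x y - x l) * (E / (d l * d y)).
  have -> : u - y = G l - G y by rewrite Gl Gy.
  by apply: ratio_sub; apply: x0 => //; apply: ltW.
have yl : y - l = (x u - x y) * (E / (d y * d u)).
  have -> : y - l = G y - G u by rewrite Gu Gy.
  by apply: ratio_sub; apply: x0 => //; apply: ltW.
have xq t : t ^+ q = x t / nu by rewrite /x mulrC mulKf // gt_eqF.
have xy : y * d y = B + x y * D.
  by rewrite -{1}Gy /G /ratio -/(x y) -/(d y) divfK // dn0 // ltW.
have yq : y ^+ q.-1 = x y / nu / y.
  by rewrite -xq -[in RHS](prednK q_gt0) exprS mulrAC mulfV ?mul1r // gt_eqF.
have dl := d0 _ l0; have dy := d0 _ (ltW y0); have du := d0 _ (ltW u0).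
have xly : 0 < x y - x l by rewrite subr_gt0 ltr_pM2l // ltr_pXn2r // nnegrE // ltW.
have xyu : 0 < x u - x y by rewrite subr_gt0 ltr_pM2l // ltr_pXn2r // nnegrE // ltW.
have xlu : 0 < x u - x l by move: xly xyu; lra.
rewrite ul uy yl !xq yq -subr_gt0.
(* After substitution the gap in the cross-ratio inequality is a positive factor times
   [- slope_form (x y)], once [y * d y] is replaced by [B + x y * D]. *)
have -> : q%:R * (x y / nu / y) * (x u / nu - x l / nu) *
      ((x y - x l) * (E / (d l * d y)) * ((x u - x y) * (E / (d y * d u)))) -
    (x u / nu - x y / nu) * (x y / nu - x l / nu) *
      ((x u - x l) * (E / (d l * d u))) =
  (x y - x l) * (x u - x y) * (x u - x l) * E / (nu ^+ 2 * d l * d u * d y * (y * d y))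
  * (q%:R * x y * E - y * d y * d y).
  by field; rewrite !gt_eqF.
rewrite pmulr_rgt0; last by rewrite divr_gt0 ?mulr_gt0 ?exprn_gt0.
by rewrite xy /slope_form -(xq y) -/(x y) -/E -/(d y) subr_gt0 subr_lt0.
Qed.

(* [(G t - y) / (y - t)] is a continuous function of [t], equal at [y] to
   [- G'(y)], which exceeds 1; so [G \o G] is expanding near [y]. *)
Lemma two_cycle_exists y : 0 < y -> G y = y -> slope_form (nu * y ^+ q) < 0 ->
  exists l u, [/\ 0 < l, l < u, G l = u & G u = l].
Proof.
move=> y0 Gy sy.
pose d t := A + nu * t ^+ q * B.
have d0 t : 0 <= t -> 0 < d t by move=> /field_ge0/ratio_den_gt0.
have dn0 t : 0 <= t -> d t != 0 by move=> /d0/lt0r_neq0.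
pose E := B ^+ 2 - A * D.
have E0 : 0 < E by rewrite subr_gt0.
(* [P t] is [(t^q - y^q) / (t - y)] written as a sum, so that [k t = (G t - y) / (y - t)] makes
   sense and is continuous at [t = y] as well. *)
pose P t := \sum_(i < q) t ^+ (q.-1 - i) * y ^+ i.
pose k t := P t * (nu * E / (d t * d y)).
have Gk t : 0 <= t -> G t - y = (y - t) * k t.
  move=> t0; rewrite -{1}Gy ratio_sub ?field_ge0 ?(ltW y0) // -mulrBr.
  by rewrite -[y ^+ q - _]opprB subrXX -/(d t) -/(d y) -/E -/(P t) /k; ring.
have cd t : 0 <= t -> {for t, continuous d}.
  move=> t0; apply: cvgD; first exact: cvg_cst.
  apply: cvgM; last exact: cvg_cst.
  by apply: cvgM; [exact: cvg_cst|exact: exprn_continuous].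
have cP t : {for t, continuous P}.
  have -> : P = \sum_(i < q) (fun t => t ^+ (q.-1 - i) * y ^+ i).
    by apply/funext => s; rewrite fct_sumE.
  apply: (big_ind (fun f : R -> R => {for t, continuous f})).
  - exact: cvg_cst.
  - by move=> f g cf cg; apply: cvgD.
  - move=> i _; apply: cvgM; [exact: exprn_continuous|exact: cvg_cst].
have ck t : 0 <= t -> {for t, continuous k}.
  move=> t0; apply: cvgM; first exact: cP.
  apply: cvgM; first exact: cvg_cst.
  apply: cvgV; first by rewrite mulf_neq0 ?dn0 // ltW.
  by apply: cvgM; [exact: cd|exact: cvg_cst].
have k1 : 1 < k y.
  have xy : y * d y = B + nu * y ^+ q * D by rewrite -{1}Gy divfK // dn0 // ltW.
  have PE : P y = q%:R * y ^+ q.-1.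
    rewrite /P (eq_bigr (fun=> y ^+ q.-1)) ?sumr_const ?card_ord ?mulr_natl // => i _.
    by rewrite -exprD subnK // -ltnS prednK.
  rewrite /k PE mulrA ltr_pdivlMr ?mul1r; last by rewrite mulr_gt0 ?d0 // ltW.
  rewrite -(ltr_pM2l y0) mulrA xy.
  have -> : y * (q%:R * y ^+ q.-1 * (nu * E)) = q%:R * (nu * y ^+ q) * E.
    by have <- : y * y ^+ q.-1 = y ^+ q; [rewrite -exprS prednK|ring].
  by move: sy; rewrite /slope_form subr_lt0.
have ckk : {for y, continuous (fun t => k t * k (G t))}.
  apply: cvgM; first by apply: ck; apply: ltW.
  change {for y, continuous (k \o G)}; apply: continuous_comp; first by apply: tree_rec_continuous; exact: ltW.
  by rewrite Gy; apply: ck; exact: ltW.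
(* [k t * k (G t)] is the factor by which [G \o G] stretches the distance from [t] to [y]; it
   exceeds 1 at [y], hence also slightly to the right of it. *)
have [t [yt t2 kt]] : exists t, [/\ y < t, t < y + 1 & 1 < k t * k (G t)].
  have : 1 < k y * k (G y) by rewrite Gy; move: k1; nra.
  move=> /(cvgr_gt _ ckk).
  move=> /nbhs_ballP[e /= e0 he].
  exists (y + Num.min (e / 2) (1 / 2)).
  have m0 : 0 < Num.min (e / 2) (1 / 2) by rewrite lt_min !divr_gt0.
  have m1 : Num.min (e / 2) (1 / 2) <= 1 / 2 by rewrite ge_min lexx orbT.
  have m2 : Num.min (e / 2) (1 / 2) <= e / 2 by rewrite ge_min lexx.
  split; [lra|lra|apply: he].
  rewrite /ball /= opprD addrA subrr sub0r normrN gtr0_norm //; lra.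
have t0 : 0 < t by exact: lt_trans yt.
have GGt : t < G (G t).
  have := Gk _ (ltW (tree_rec_gt0 (ltW t0))).
  have -> : y - G t = (t - y) * k t by rewrite -opprB Gk ?(ltW t0) //; ring.
  move/eqP; rewrite subr_eq => /eqP ->.
  by rewrite -mulrA; move: kt yt; set z := _ * k _ => *; nra.
(* [G \o G] is bounded by 1, so it lies below the diagonal at [b > 1], while it lies above it at
   [t]; in between it has a fixed point [u > y], and [G u < y] makes the cycle proper. *)
pose b := t + 2.
have tb : t <= b by rewrite /b; lra.
have cG : {within `[t, b]%classic, continuous (fun y => G (G y) - y)}.
  apply: continuous_in_subspaceT => s; rewrite inE /= in_itv /= => /andP[ts _].
  have s0 : 0 <= s by exact: le_trans (ltW t0) ts.
  apply: cvgB; last exact: cvg_id.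
  change {for s, continuous (G \o G)}; apply: continuous_comp; first exact: tree_rec_continuous.
  by apply: tree_rec_continuous; exact/ltW/tree_rec_gt0.
have [|u] := IVT tb cG (v := 0).
  rewrite ge_min le_max (subr_le0 b) (subr_ge0 t) (ltW GGt) /= andbT.
  apply/orP; right; apply: (@le_trans _ _ 1); last by rewrite /b; lra.
  apply: tree_rec_le1; apply/ltW/tree_rec_gt0; rewrite /b; lra.
rewrite in_itv /= => /andP[tu _] /eqP; rewrite subr_eq0 => /eqP Gu.
have u0 : 0 < u by exact: lt_le_trans tu.
exists (G u), u; split => //; first exact/tree_rec_gt0/ltW.
have : G u < G y by apply: tree_rec_lt (ltW y0) _; exact: lt_le_trans tu.
by rewrite Gy => /lt_trans; apply; exact: lt_le_trans tu.
Qed.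

(** The interval of messages that can reach a vertex when those sent [r] generations below are
    arbitrary in [[0, 1]]; the ends swap at each step because [G] is decreasing. *)
Fixpoint box (r : nat) : R * R :=
  if r is r'.+1 then let b := box r' in (G b.2, G b.1) else (0, 1).

Lemma box_bounds r : [/\ 0 <= (box r).1, (box r).1 <= (box r).2 & (box r).2 <= 1].
Proof.
elim: r => [|r [l0 lu u1]] /=; first by rewrite lexx ler01.
have u0 := le_trans l0 lu.
split; [exact/ltW/tree_rec_gt0|exact: tree_rec_le|exact: tree_rec_le1].
Qed.

Lemma box_mono r : (box r).1 <= (box r.+1).1 /\ (box r.+1).2 <= (box r).2.
Proof.
elim: r => [|r [IH1 IH2]].
  by split; [exact/ltW/tree_rec_gt0|exact: tree_rec_le1].
have [l0 lu u1] := box_bounds r; have [l0' lu' _] := box_bounds r.+1.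
split; apply: tree_rec_le => //.
exact: le_trans lu'.
Qed.

Lemma box_fixpoint y r : 0 <= y -> G y = y -> (box r).1 <= y <= (box r).2.
Proof.
move=> y0 Gy; elim: r => [|r /andP[ly yu]] /=.
  by rewrite y0 -Gy tree_rec_le1.
have [l0 _ _] := box_bounds r.
by rewrite -{1}Gy -{2}Gy !tree_rec_le.
Qed.

Lemma box_shrinks y (e : R) : 0 < y -> G y = y -> 0 <= slope_form (nu * y ^+ q) ->
  0 < e -> exists r, (box r).2 <= (box r).1 + e.
Proof.
move=> y0 Gy sy e0.
have /cvg_ex[L hL] : cvgn (fun r => (box r).1).
  apply: nondecreasing_is_cvgn.
    by apply/nondecreasing_seqP => r; have [] := box_mono r.
  exists 1 => _ [r _ <-]; have [_ lu u1] := box_bounds r; exact: le_trans u1.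
have /cvg_ex[U hU] : cvgn (fun r => (box r).2).
  apply: nonincreasing_is_cvgn.
    by apply/nonincreasing_seqP => r; have [] := box_mono r.
  exists 0 => _ [r _ <-]; have [l0 lu _] := box_bounds r; exact: le_trans lu.
have box1 : (fun r => (box r).1) @ \oo --> L by [].
have box2 : (fun r => (box r).2) @ \oo --> U by [].
have Ly : L <= y.
  by apply: (cvgr_to_le box1); near=> r; have /andP[] := box_fixpoint r (ltW y0) Gy.
have yU : y <= U.
  by apply: (cvgr_to_ge box2); near=> r; have /andP[] := box_fixpoint r (ltW y0) Gy.
have L0 : 0 <= L.
  by apply: (cvgr_to_ge box1); near=> r; have [] := box_bounds r.
have U0 : 0 <= U by exact: le_trans (ltW y0) yU.
have GU : G U = L.
  apply: (@cvg_unique _ _ ((fun r => (box r.+1).1) @ \oo)) => //.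
    by apply: continuous_cvg => //; exact: tree_rec_continuous.
  by have := box1; rewrite -(cvg_shiftS (fun r => (box r).1)).
have GL : G L = U.
  apply: (@cvg_unique _ _ ((fun r => (box r.+1).2) @ \oo)) => //.
    by apply: continuous_cvg => //; exact: tree_rec_continuous.
  by have := box2; rewrite -(cvg_shiftS (fun r => (box r).2)).
have LU : L = U.
  move: Ly; rewrite le_eqVlt => /predU1P[Ly|Ly]; first by rewrite -GL Ly Gy.
  move: yU; rewrite le_eqVlt => /predU1P[yU|yU]; first by rewrite -GU -yU Gy.
  by have := two_cycle_slope L0 Ly yU GL GU Gy; rewrite ltNge sy.
have e2 : 0 < e / 2 by rewrite divr_gt0.
have near1 : \forall r \near \oo, L - e / 2 < (box r).1.
  by apply: (cvgr_gt _ box1); rewrite ltrBlDr ltrDl.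
have near2 : \forall r \near \oo, (box r).2 < L + e / 2.
  by apply: (cvgr_lt _ box2); rewrite -LU ltrDl.
have [r _ /(_ r (leqnn r))[h1 h2]] : \forall r \near \oo,
    L - e / 2 < (box r).1 /\ (box r).2 < L + e / 2.
  by near=> r; split; near: r.
by exists r; move: h1 h2; lra.
Unshelve. all: end_near.
Qed.

(** Weights are products of messages, so closeness is needed in ratio. From the first step on the
    left ends stay above [(box 1).1 > 0], which turns a box of length at most
    [(rho - 1) * (box 1).1] into one of ratio at most [rho]. *)
Lemma box_ratio y (rho : R) : 0 < y -> G y = y -> 0 <= slope_form (nu * y ^+ q) ->
  1 < rho -> exists r, 0 < (box r).1 /\ (box r).2 <= rho * (box r).1.
Proof.
move=> y0 Gy sy rho1.
have l1 : 0 < (box 1).1 by exact: tree_rec_gt0.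
have rho0 : 0 < rho - 1 by rewrite subr_gt0.
have [r hr] := box_shrinks y0 Gy sy (mulr_gt0 rho0 l1).
have lr k : (box 1).1 <= (box k.+1).1.
  by elim: k => [//|k IH]; apply: le_trans IH _; have [] := box_mono k.+1.
have [m1 m2] := box_mono r; have := lr r.
exists r.+1; split; first exact: lt_le_trans (lr r).
move: hr m1 m2 (lr r) rho1; set l := (box r.+1).1; set u := (box r.+1).2.
by set l' := (box 1).1; nra.
Qed.

End Recursion.

(** * The partial sums, the quadratic [Q] and the thresholds *)

Section Lambda.
Variables (R : realType) (C : nat) (lam : 'I_C.+1 -> R).
Hypothesis (lam_ge0 : forall i, 0 <= lam i) (lam0_gt0 : 0 < lam ord0).

Lemma Lambda_gt0 n : 0 < Lambda lam n.
Proof.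
rewrite /Lambda (bigD1 ord0) //= ltr_wpDr //.
by apply: sumr_ge0 => i _; exact: lam_ge0.
Qed.

Lemma Lambda_le m n : (m <= n)%N -> Lambda lam m <= Lambda lam n.
Proof.
move=> mn; rewrite /Lambda big_mkcond [leRHS]big_mkcond; apply: ler_sum => i _.
by case: ifP => [/leq_trans/(_ mn)->//|_]; case: ifP.
Qed.

End Lambda.

Section Thresholds.
Variables (R : realType) (q C : nat) (lam : 'I_C.+1 -> R) (nu : R).
Hypotheses (q_ge2 : (2 <= q)%N) (C_ge2 : (2 <= C)%N) (nu_gt0 : 0 < nu).
Hypothesis (lam_ge0 : forall i, 0 <= lam i) (lam0_gt0 : 0 < lam ord0).

Local Notation A := (Lambda lam C).
Local Notation B := (Lambda lam (C - 1)).
Local Notation D := (Lambda lam (C - 2)).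
Hypothesis AD_lt : A * D < B ^+ 2.

Let A0 : 0 < A. Proof. exact: Lambda_gt0. Qed.
Let B0 : 0 < B. Proof. exact: Lambda_gt0. Qed.
Let D0 : 0 < D. Proof. exact: Lambda_gt0. Qed.
Let DB : D <= B. Proof. by apply: Lambda_le => //; rewrite leq_sub2l. Qed.
Let BA : B <= A. Proof. by apply: Lambda_le => //; rewrite leq_subr. Qed.

Lemma hornerQ x : (Q q lam).[x] = slope_form A B D q x.
Proof.
by rewrite /Q /slope_form !hornerD !hornerZ hornerXn hornerX hornerC; ring.
Qed.

Lemma J_ratio x : J q lam x = x / ratio A B D x ^+ q.
Proof. by rewrite /J /ratio -exprVn invf_div. Qed.

(** By [J_ratio], [J x] is [x] divided by a power of the decreasing function [ratio]. *)
Lemma J_lt x z : 0 <= x -> x < z -> J q lam x < J q lam z.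
Proof.
move=> x0 xz; have z0 : 0 < z by exact: le_lt_trans xz.
have rx := ratio_gt0 D0 DB BA x0; have rz := ratio_gt0 D0 DB BA (ltW z0).
rewrite !J_ratio ltr_pdivrMr ?exprn_gt0 // mulrAC ltr_pdivlMr ?exprn_gt0 //.
apply: (@le_lt_trans _ _ (x * ratio A B D x ^+ q)).
  by rewrite ler_wpM2l // lerXn2r ?nnegrE ?(ltW rx) ?(ltW rz) // ltW // ratio_lt.
by rewrite ltr_pM2r // exprn_gt0.
Qed.

Lemma J_lt_inv x z : 0 <= z -> J q lam x < J q lam z -> x < z.
Proof.
move=> z0; rewrite !ltNge; apply: contra.
by rewrite le_eqVlt => /predU1P[->//|/(J_lt z0)/ltW].
Qed.

Lemma J_fixpoint y : 0 < y -> tree_rec A B D nu q y = y -> J q lam (nu * y ^+ q) = nu.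
Proof.
move=> y0 Gy; rewrite J_ratio; move: Gy; rewrite /tree_rec => ->.
by rewrite mulfK // expf_neq0 // gt_eqF.
Qed.

(** [slope_form] is [B D z^2 + m z + A B], with positive leading and constant coefficients: a
    negative value at the positive point [x] forces two positive roots around [x], and conversely it
    is negative between them. The increasing map [J] carries the order of [alpha_m], [x], [alpha_p]
    to that of the thresholds and [nu = J x]. *)
Lemma slope_form_threshold y : 0 < y -> tree_rec A B D nu q y = y ->
  slope_form A B D q (nu * y ^+ q) < 0 <->
  in_calA q lam /\
  exists alpha_m alpha_p : R,
    [/\ 0 < alpha_m, alpha_m < alpha_p,
        root (Q q lam) alpha_m, root (Q q lam) alpha_p &
        J q lam alpha_m < nu < J q lam alpha_p].
Proof.
move=> y0 Gy; have := J_fixpoint y0 Gy; set x := nu * y ^+ q => Jx.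
have x0 : 0 < x by rewrite mulr_gt0 // exprn_gt0.
pose m : R := (1 - q%:R) * B ^+ 2 + (1 + q%:R) * A * D.
have SF z : slope_form A B D q z = B * D * z ^+ 2 + m * z + A * B.
  by rewrite /slope_form /m; ring.
split=> [|[_ [am [ap [am0 amp]]]]]; last first.
  rewrite !rootE !hornerQ !SF => /eqP rm /eqP rp /andP[h1 h2].
  have amx : am < x by apply: J_lt_inv (ltW x0) _; rewrite Jx.
  have xap : x < ap by apply: J_lt_inv; [lra|rewrite Jx].
  (* Vieta's formulas, the roots being distinct; they give
     [slope_form x = - B D (x - am)(ap - x)]. *)
  have mE : m = - (B * D) * (am + ap).
    have /eqP : (ap - am) * (m + B * D * (am + ap)) = 0 by move: rm rp; lra.
    by rewrite mulf_eq0 subr_eq0 gt_eqF //= addr_eq0 mulNr => /eqP.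
  have ABE : A * B = B * D * (am * ap) by move: rm; rewrite mE; lra.
  have : 0 < B * D * ((x - am) * (ap - x)) by rewrite !mulr_gt0 // subr_gt0.
  by rewrite mE ABE; lra.
move=> sx; have BD0 : 0 < B * D by rewrite mulr_gt0.
have AB0 : 0 < A * B by rewrite mulr_gt0.
have m0 : m < 0.
  rewrite -(pmulr_llt0 _ x0) mulrC; move: sx; rewrite SF.
  have : 0 < B * D * x ^+ 2 by rewrite mulr_gt0 // exprn_gt0.
  by lra.
pose disc := m ^+ 2 - 4 * (A * B) * (B * D).
(* Completing the square: [4 B D * slope_form x = (2 B D x + m)^2 - disc]. *)
have disc_gt : (2 * (B * D) * x + m) ^+ 2 < disc.
  have : 4 * (B * D) * slope_form A B D q x < 0 by rewrite nmulr_llt0 // mulr_gt0.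
  by rewrite SF /disc; lra.
have disc0 : 0 <= disc by apply: le_trans (ltW disc_gt); exact: sqr_ge0.
pose s := Num.sqrt disc; have s2 : s ^+ 2 = disc by rewrite sqr_sqrtr.
have s0 : 0 <= s by exact: sqrtr_ge0.
have sm : s < - m.
  rewrite -(@ltr_pXn2r _ 2) ?nnegrE ?oppr_ge0 ?(ltW m0) ?s0 // s2 sqrrN /disc.
  by rewrite ltrBlDr ltrDl -mulrA !mulr_gt0.
have /ltr_normlP[xs1 xs2] : `|2 * (B * D) * x + m| < s.
  by rewrite -(@ltr_pXn2r _ 2) ?nnegrE // s2 real_normK ?num_real.
split.
  split => //.
  (* With [r^2 = A D], a positive discriminant and [m < 0] read [2 B r < - m], and [- m - 2 B r]
     factors as [((q-1) B - (q+1) r)(B + r)]. The first factor is the square root form of the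
     inequality in [in_calA]. *)
  pose r := Num.sqrt (A * D).
  have r2 : r ^+ 2 = A * D by rewrite sqr_sqrtr // mulr_ge0 // ltW.
  have r0 : 0 <= r by exact: sqrtr_ge0.
  have q1 : (1 : R) < q%:R by rewrite ltr1n.
  have Br : 2 * (B * r) < - m.
    rewrite -(@ltr_pXn2r _ 2) ?nnegrE ?oppr_ge0 ?(ltW m0) // ?mulr_ge0 // ?(ltW B0) //.
    rewrite !exprMn r2 sqrrN -subr_gt0.
    apply: (@le_lt_trans _ _ _ _ _ (sqr_ge0 (2 * (B * D) * x + m))).
    by apply: lt_le_trans disc_gt _; rewrite /disc; lra.
  have : 0 < ((q%:R - 1) * B - (q%:R + 1) * r) * (B + r).
    have -> : ((q%:R - 1) * B - (q%:R + 1) * r) * (B + r) =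
      (q%:R - 1) * B ^+ 2 - (q%:R + 1) * r ^+ 2 - 2 * (B * r) by ring.
    by move: Br; rewrite r2 /m; lra.
  have Br0 : 0 < B + r by rewrite ltr_wpDr.
  rewrite (pmulr_lgt0 _ Br0) subr_gt0 => qBr.
  rewrite -mulrA -r2 -!exprMn ltr_pXn2r // nnegrE mulr_ge0 ?(ltW B0) //; lra.
have BD2 : 0 < 2 * (B * D) by rewrite mulr_gt0.
have rootP z : (2 * (B * D) * z + m) ^+ 2 = disc -> root (Q q lam) z.
  move=> zE; rewrite rootE hornerQ SF -(mulrI_eq0 _ (mulfI (lt0r_neq0 BD2))).
  by apply/eqP; move: zE; rewrite /disc; lra.
exists ((- m - s) / (2 * (B * D))), ((- m + s) / (2 * (B * D))).
have am0 : 0 < (- m - s) / (2 * (B * D)) by rewrite divr_gt0 // subr_gt0.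
have amx : (- m - s) / (2 * (B * D)) < x by rewrite ltr_pdivrMr //; move: xs2 xs1; lra.
have xap : x < (- m + s) / (2 * (B * D)) by rewrite ltr_pdivlMr //; move: xs2 xs1; lra.
split => //; first exact: lt_trans xap.
- by apply: rootP; rewrite mulrC divfK ?gt_eqF // addrAC addNr add0r sqrrN.
- by apply: rootP; rewrite mulrC divfK ?gt_eqF // addrAC addNr add0r.
- have := J_lt (ltW am0) amx; have := J_lt (ltW x0) xap.
  by rewrite Jx => -> ->.
Qed.

End Thresholds.

(** * Breadth-first numbering of the regular tree *)

(** Course-of-values recursion, stated as an equation: a vertex of the numbering is computed from
    its parent and grandparent, which are earlier but not immediate predecessors. *)
Lemma prefix_recursion (T : Type) (step : seq T -> T) :
  exists f : nat -> T, forall n, f n = step (mkseq f n).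
Proof.
pose pre := fix pre n := if n is k.+1 then rcons (pre k) (step (pre k)) else [::].
pose f n := step (pre n); exists f => n; congr step.
by elim: n => //= n IH; rewrite -[in RHS]addn1 /mkseq iotaD map_cat cats1 -/(mkseq f n) -IH.
Qed.

Section Numbering.
Local Open Scope nat_scope.
Variable q : nat.
Hypothesis q_gt0 : 0 < q.

(* Parent of a vertex in the breadth-first numbering of the [q.+1]-regular tree:
   the children of 0 are 1, ..., q+1 (the truncated subtraction gives the child
   1 its parent 0), those of i > 0 are q i + 2, ..., q i + q + 1. *)
Definition parent (n : nat) : nat := (n - 2) %/ q.

Definition tree_adj : rel nat := fun i j =>
  ((0 < j) && (i == parent j)) || ((0 < i) && (j == parent i)).

Lemma parent_lt n : 0 < n -> parent n < n.
Proof.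
move=> n0; apply: (@leq_ltn_trans (n - 2)); first exact: leq_div.
lia.
Qed.

Lemma parent_child i k : k < q -> parent (q * i + 2 + k) = i.
Proof.
move=> kq; rewrite /parent (_ : _ - 2 = i * q + k); last by lia.
by rewrite divnMDl // divn_small // addn0.
Qed.

(** In breadth-first order the vertices with parent below [i] form an initial segment, so the
    closure of a prefix is again a prefix. *)
Lemma parent_ltE n i : 0 < i -> (parent n < i) = (n < q * i + 2).
Proof.
move=> i0; rewrite /parent ltn_divLR //; lia.
Qed.

Lemma tree_adj_sym : symmetric tree_adj.
Proof. by move=> i j; rewrite /tree_adj orbC. Qed.

Variables (V : choiceType) (adj : rel V).
Hypothesis htree : is_regular_tree adj q.+1.

Lemma neighbours x : exists s, [/\ uniq s, size s = q.+1 & forall y, (y \in s) = adj x y].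
Proof.
have hx := tree_regular htree x.
have fx : finite_set [set y | adj x y] by apply/finite_setP; exists q.+1.
exists (fset_set [set y | adj x y]); split; first exact: fset_uniq.
- exact: card_fset_set.
- move=> y; rewrite in_fset_set //; apply/idP/idP => [|h]; first by rewrite inE.
  by rewrite inE.
Qed.

(** The vertices are listed parent by parent, each contributing its neighbours other than its own
    parent. Two numbers with the same image would close a cycle, so acyclicity gives injectivity;
    connectedness gives surjectivity. *)
Lemma tree_numbering : exists phi : nat -> V,
  [/\ injective phi, forall x, exists n, phi n = x &
      forall i j, adj (phi i) (phi j) = tree_adj i j].
Proof.
have adj_irr := tree_irreflexive htree; have adj_sym := tree_symmetric htree.
have [x0] := tree_inhabited htree.
pose nb x := projT1 (cid (neighbours x)).
have nb_uniq x : uniq (nb x) by rewrite /nb; case: cid => s [].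
have nb_size x : size (nb x) = q.+1 by rewrite /nb; case: cid => s [].
have nbE x y : (y \in nb x) = adj x y by rewrite /nb; case: cid => s [].
(* Vertex 0 is [x0], the numbers [1, ..., q+1] are its neighbours, and a later number is a neighbour
   of its parent with the grandparent removed from the list. *)
pose step (s : seq V) := if size s == 0 then x0
  else if size s <= q.+1 then nth x0 (nb x0) (size s).-1
  else nth x0 (rem (nth x0 s (parent (parent (size s)))) (nb (nth x0 s (parent (size s)))))
    ((size s - 2) %% q).
have [phi phiE] := prefix_recursion step.
pose sons i := if i == 0 then nb x0 else rem (phi (parent i)) (nb (phi i)).
(* The position of [n] among its siblings. *)
pose rank n := if n <= q.+1 then n.-1 else (n - 2) %% q.
have phi0 : phi 0 = x0 by rewrite phiE.
have phiS n : 0 < n -> phi n = nth x0 (sons (parent n)) (rank n).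
  move=> n0; rewrite phiE /step size_mkseq /sons /rank gtn_eqF //.
  have [nq|nq] := leqP n q.+1.
    by rewrite /parent divn_small //; lia.
  have p0 : 0 < parent n by rewrite /parent divn_gt0 //; lia.
  have pn := parent_lt n0; rewrite gtn_eqF // !nth_mkseq //.
  by apply: ltn_trans pn; exact: parent_lt.
have sons_uniq i : uniq (sons i).
  by rewrite /sons; case: ifP => _; [exact: nb_uniq|apply: rem_uniq; exact: nb_uniq].
have sons_adj i y : y \in sons i -> adj (phi i) y.
  rewrite /sons; case: eqP => [->|_]; first by rewrite nbE phi0.
  by move=> /mem_rem; rewrite nbE.
have sons_parent i y : 0 < i -> y \in sons i -> y != phi (parent i).
  move=> i0; rewrite /sons gtn_eqF // (mem_rem_uniq _ (nb_uniq _)) inE.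
  by case/andP.
have rank_lt n : 0 < n -> rank n < q + (parent n == 0).
  move=> n0; rewrite /rank /parent; have [nq|nq] := leqP n q.+1.
    by rewrite divn_small ?eqxx; lia.
  by apply: leq_trans (ltn_pmod _ q_gt0) _; rewrite leq_addr.
have rank_inj m n : 0 < m -> 0 < n -> parent m = parent n -> rank m = rank n -> m = n.
  move=> m0 n0; rewrite /parent /rank => pmn.
  have := divn_eq (m - 2) q; have := divn_eq (n - 2) q.
  have sm k : k <= q.+1 -> (k - 2) %/ q = 0 by move=> kq; rewrite divn_small //; lia.
  have lg k : q.+1 < k -> 0 < (k - 2) %/ q by move=> kq; rewrite divn_gt0 //; lia.
  case: (leqP m q.+1) => mq; case: (leqP n q.+1) => nq; first by lia.
  - by have := lg _ nq; rewrite -pmn sm.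
  - by have := lg _ mq; rewrite pmn sm.
  - by rewrite pmn => -> E /eqP; lia.
(* Adjacency and injectivity are proved together: the length of the list of sons relies on the
   adjacency already known, and the cycle excluded below must have distinct vertices. *)
have main n : (forall i, 0 < i < n -> adj (phi (parent i)) (phi i)) /\
    (forall i j, i < n -> j < n -> phi i = phi j -> i = j).
  elim: n => [|n [IHa IHi]]; first by split=> [i|i j]; rewrite ?ltn0 ?andbF.
  have sz : 0 < n -> size (sons (parent n)) = q + (parent n == 0).
    move=> n0; rewrite /sons; case: (posnP (parent n)) => [_|p0]; first by rewrite nb_size addn1.
    rewrite size_rem ?nb_size ?addn0 // nbE adj_sym.
    by apply: IHa; rewrite p0 parent_lt.
  have mem : 0 < n -> phi n \in sons (parent n).
    by move=> n0; rewrite phiS // mem_nth // sz // rank_lt.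
  have adjn : 0 < n -> adj (phi (parent n)) (phi n) by move=> /mem/sons_adj.
  split=> [i /andP[i0]|].
    rewrite ltnS leq_eqVlt => /predU1P[E|ilt]; first by rewrite E adjn // -E.
    by apply: IHa; rewrite i0.
  suff H m : m < n -> phi m <> phi n.
    move=> i j; rewrite ltnS leq_eqVlt => /predU1P[->|iN];
      rewrite ltnS leq_eqVlt => /predU1P[->|jn] E; first by [].
    - by have := H j jn (esym E).
    - by have := H i iN E.
    - exact: IHi.
  move=> mn Emn; have n0 : 0 < n by exact: leq_ltn_trans mn.
  have pn := parent_lt n0.
  have mp : m != parent n.
    by apply/eqP => mp; have := adjn n0; rewrite -Emn mp adj_irr.
  have mNadj : ~~ tree_adj (parent n) m.
    apply/negP => /orP[/andP[m0 /eqP pm]|/andP[p0 /eqP mpp]].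
      have E : rank m = rank n.
        apply/eqP; rewrite -(nth_uniq x0 _ _ (sons_uniq (parent n))) ?sz ?rank_lt //.
          by rewrite {1}pm -!phiS // Emn.
        by rewrite pm rank_lt.
      by move: mn; rewrite (rank_inj m n) // ltnn.
    by have := sons_parent _ _ p0 (mem n0); rewrite -Emn mpp eqxx.
  (* A path from [parent n] to [m] through numbers below [n], closed by the edge between
     [phi m = phi n] and [phi (parent n)], is a cycle; [mp] and [mNadj] ensure that it has at least
     three vertices. *)
  pose e := [rel i j : 'I_n | tree_adj i j].
  have e_adj (i j : 'I_n) : e i j -> adj (phi i) (phi j).
    move=> /orP[/andP[j0 /eqP->]|/andP[i0 /eqP->]]; first by apply: IHa; rewrite j0 /=.
    by rewrite adj_sym; apply: IHa; rewrite i0 /=.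
  have e_sym : connect_sym e by apply: sym_connect_sym => i j; exact: tree_adj_sym.
  have conn0 (i : 'I_n) : connect e i (Ordinal n0).
    case: i => i; elim/ltn_ind: i => i IH iN.
    have [i0|i0] := posnP i.
      by rewrite (_ : Ordinal iN = Ordinal n0) //; apply: val_inj.
    have piN : parent i < n by apply: ltn_trans iN; exact: parent_lt.
    apply: connect_trans (IH _ (parent_lt i0) piN); apply: connect1.
    by rewrite /e /= /tree_adj i0 eqxx orbT.
  have : connect e (Ordinal pn) (Ordinal mn).
    by apply: connect_trans (conn0 _) _; rewrite e_sym.
  move=> /connectP[s0 ps0]; case/shortenP: ps0 => s ps us _ ls.
  pose psi (i : 'I_n) := phi i; pose c := [seq psi i | i <- Ordinal pn :: s].
  have cs : 2 < size c.
    rewrite size_map; case: s ps ls {us c} => [_ /(congr1 val) /= h|a [|b s] //].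
      by move: mp; rewrite h eqxx.
    rewrite /= andbT => h /(congr1 val) /= h'.
    by move: mNadj h; rewrite h' /e /= => /negPf->.
  apply: (tree_acyclic htree cs); rewrite /ucycle; apply/andP; split.
    rewrite /c /= rcons_path; apply/andP; split.
      by apply: (@homo_path _ _ psi) ps => i j; exact: e_adj.
    rewrite last_map -ls /psi /= Emn adj_sym.
    exact: adjn.
  by rewrite map_inj_in_uniq // => i j _ _ /IHi h; apply: val_inj; apply: h.
have phi_inj : injective phi.
  move=> i j; have [_] := main (maxn i j).+1.
  by apply; rewrite ltnS ?leq_maxl ?leq_maxr.
have phi_adj i : 0 < i -> adj (phi (parent i)) (phi i).
  by move=> i0; have [+ _] := main i.+1; apply; rewrite i0 /=.
have sons_onto i y : y \in sons i -> exists j, [/\ 0 < j, parent j = i & phi j = y].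
  move=> yi; have kq : index y (sons i) < size (sons i) by rewrite index_mem.
  have [i0|i0] := posnP i.
    move: yi kq; rewrite i0 /sons eqxx nb_size => yi kq.
    exists (index y (nb x0)).+1; split => //; first by rewrite /parent divn_small //; lia.
    rewrite phiS // (_ : parent _ = 0); last by rewrite /parent divn_small //; lia.
    by rewrite /sons eqxx /rank ltnS -ltnS kq /= nth_index.
  have si : size (sons i) = q.
    by rewrite /sons gtn_eqF // size_rem ?nb_size // nbE adj_sym phi_adj.
  rewrite si in kq.
  exists (q * i + 2 + index y (sons i)); rewrite parent_child //; split=> //; first by lia.
  rewrite phiS; last by lia.
  rewrite parent_child // /rank ifF; last by apply/negbTE; rewrite -ltnNge; nia.
  rewrite (_ : _ - 2 = i * q + index y (sons i)); last by lia.
  by rewrite modnMDl modn_small // nth_index.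
have nb_onto i y : adj (phi i) y -> exists2 j, tree_adj i j & phi j = y.
  move=> iy; have [ys|ys] := boolP (y \in sons i).
    by have [j [j0 ji jy]] := sons_onto _ _ ys; exists j => //; rewrite /tree_adj j0 ji eqxx.
  have [i0|i0] := posnP i; first by move: ys; rewrite i0 /sons eqxx nbE -phi0 -i0 iy.
  exists (parent i); first by rewrite /tree_adj i0 eqxx orbT.
  move: ys; rewrite /sons gtn_eqF // (mem_rem_uniq _ (nb_uniq _)) inE nbE iy andbT negbK.
  by move=> /eqP.
exists phi; split=> // [x|i j]; last first.
  apply/idP/idP => [/nb_onto[k ik /phi_inj <-] //|].
  by move=> /orP[/andP[j0 /eqP->]|/andP[i0 /eqP->]]; [exact: phi_adj|rewrite adj_sym phi_adj].
have [s ps <-] := tree_connected htree x0 x.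
rewrite -phi0 in ps *; elim: s 0 ps => [|y s IH] i /=; first by exists i.
by move=> /andP[/nb_onto[j _ <-]]; exact: IH.
Qed.

End Numbering.

(** * Finite-volume weights *)

Section Glue.
Variables (R : realType) (V : choiceType) (adj : rel V) (CV CE : nat).
Local Notation site := (hatV adj).
Local Notation cfg := (config adj CV CE).
Local Notation fcfg := (fconfig CV CE).
Implicit Types (U W : {fset site}) (tau omega : cfg) (z : site).

Definition glue U (u : fcfg U) tau : cfg := fun z =>
  match decP (@idP (z \in U)) with
  | left h => u (FSetSub h)
  | right _ => tau z
  end.

Definition agree_on W tau omega := forall z, z \in W -> tau z = omega z.

Definition agree_off U tau omega := forall z, z \notin U -> tau z = omega z.

Definition depends_on (T : Type) W (f : cfg -> T) :=
  forall tau omega, agree_on W tau omega -> f tau = f omega.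

(** Configurations of different finite sets have different types. Gluing them onto a background
    [tau] keeps every partial sum a function on [cfg], so that sums over disjoint sets compose, see
    [ssumU]. *)
Definition ssum U (f : cfg -> R) tau : R := \sum_(u : fcfg U) f (glue u tau).

Lemma agree_on_sym W tau omega : agree_on W tau omega -> agree_on W omega tau.
Proof. by move=> h z zW; rewrite h. Qed.

Lemma agree_onS U W tau omega : (U `<=` W)%fset ->
  agree_on W tau omega -> agree_on U tau omega.
Proof. by move=> /fsubsetP UW h z /UW/h. Qed.

Lemma depends_onS (T : Type) U W (f : cfg -> T) : (U `<=` W)%fset ->
  depends_on U f -> depends_on W f.
Proof. by move=> UW h tau omega /(agree_onS UW)/h. Qed.

Lemma agree_offU U W tau tau1 omega :
  agree_off W tau tau1 -> agree_off U tau1 omega -> agree_off (U `|` W)%fset tau omega.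
Proof. by move=> h1 h2 z; rewrite in_fsetU negb_or => /andP[zU zW]; rewrite h1 ?h2. Qed.

Lemma glue_in U (u : fcfg U) tau (z : U) : glue u tau (val z) = u z.
Proof.
case: z => z zU; rewrite /glue /=; case: decP => [h|[]//].
by rewrite (bool_irrelevance h zU).
Qed.

Lemma glue_out U (u : fcfg U) tau : agree_off U (glue u tau) tau.
Proof. by move=> z; rewrite /glue; case: decP => // h /negP. Qed.

Lemma restr_glue U (u : fcfg U) tau : restr U (glue u tau) = u.
Proof. by apply/ffunP => z; rewrite ffunE glue_in. Qed.

Lemma glue_restr U tau omega : agree_off U omega tau -> glue (restr U omega) tau = omega.
Proof.
move=> h; apply: functional_extensionality_dep => z.
by rewrite /glue; case: decP => [zU|/negP/h//]; rewrite ffunE.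
Qed.

Lemma restr_eqP U tau omega : restr U tau = restr U omega <-> agree_on U tau omega.
Proof.
split=> [E z zU|h]; last by apply/ffunP => z; rewrite !ffunE h ?(valP z).
by have /ffunP/(_ [` zU]%fset) := E; rewrite !ffunE.
Qed.

Lemma glue_agree U (u : fcfg U) tau omega : agree_on U (glue u tau) (glue u omega).
Proof. by apply/restr_eqP; rewrite !restr_glue. Qed.

Lemma glue_restr_agree U omega tau : agree_on U (glue (restr U omega) tau) omega.
Proof. by apply/restr_eqP; rewrite restr_glue. Qed.

Lemma agree_on_glue U W (u : fcfg U) tau : [disjoint U & W]%fset ->
  agree_on W (glue u tau) tau.
Proof. by move=> /fdisjointP_sym UW z /UW /glue_out->. Qed.

Lemma ssum_ext U f g tau :
  (forall omega, agree_off U omega tau -> f omega = g omega) -> ssum U f tau = ssum U g tau.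
Proof. by move=> h; apply: eq_bigr => u _; apply/h/glue_out. Qed.

Lemma ssum_depends U W f : depends_on (U `|` W)%fset f -> depends_on W (ssum U f).
Proof.
move=> h tau omega hW; apply: eq_bigr => u _; apply: h => z.
rewrite in_fsetU; have [zU _|zU /= zW] := boolP (z \in U).
  exact: glue_agree.
by rewrite !glue_out // hW.
Qed.

Lemma ssum0 f tau : ssum fset0 f tau = f tau.
Proof.
rewrite /ssum (big_pred1 (restr fset0 tau)) ?glue_restr // => u /=.
by apply/esym/eqP/ffunP => -[z zU]; have := zU; rewrite in_fset0.
Qed.

Lemma ssumMl U c f tau : ssum U (fun omega => c * f omega) tau = c * ssum U f tau.
Proof. by rewrite /ssum mulr_sumr. Qed.

Lemma ssum_le U f g tau : (forall omega, agree_off U omega tau -> f omega <= g omega) ->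
  ssum U f tau <= ssum U g tau.
Proof. by move=> h; apply: ler_sum => u _; apply/h/glue_out. Qed.

Lemma ssum_ge0 U f tau : (forall omega, 0 <= f omega) -> 0 <= ssum U f tau.
Proof. by move=> h; apply: sumr_ge0 => u _. Qed.

Lemma ssum_eq0 U f tau : (forall omega, 0 <= f omega) ->
  ssum U f tau = 0 -> f tau = 0.
Proof.
move=> f0 /eqP; rewrite psumr_eq0 // => /allP/(_ (restr U tau)).
by rewrite mem_index_enum glue_restr // => /(_ isT)/eqP.
Qed.

Lemma ssumU U W f tau : [disjoint U & W]%fset ->
  ssum (U `|` W)%fset f tau = ssum U (ssum W f) tau.
Proof.
move=> dUW; rewrite /ssum pair_big /=.
pose h (p : fcfg U * fcfg W) := restr (U `|` W)%fset (glue p.2 (glue p.1 tau)).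
pose h' (w : fcfg (U `|` W)%fset) := (restr U (glue w tau), restr W (glue w tau)).
have gh p : glue (h p) tau = glue p.2 (glue p.1 tau).
  apply: glue_restr => z; rewrite in_fsetU negb_or => /andP[zU zW].
  by rewrite !glue_out.
rewrite (reindex h) /=; first by apply: eq_bigr => p _; rewrite gh.
exists h' => [[u w] _|w _].
  rewrite /h' gh /= restr_glue; congr (_, _); rewrite -[RHS](restr_glue u tau).
  by apply/restr_eqP/agree_on_glue; rewrite fdisjoint_sym.
apply/ffunP => z; rewrite /h ffunE -[RHS](glue_in _ tau) /=.
have [zW|zW] := boolP (val z \in W).
  by rewrite -[LHS]/(glue _ _ (val [` zW]%fset)) glue_in ffunE.
rewrite glue_out //; have zU : val z \in U.
  by have := valP z; rewrite in_fsetU (negPf zW) orbF.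
by rewrite -[LHS]/(glue _ _ (val [` zU]%fset)) glue_in ffunE.
Qed.

End Glue.

Section Weights.
Variables (R : realType) (V : choiceType) (adj : rel V) (C CV CE : nat).
Variables (nu : 'I_CV.+1 -> R) (lam : 'I_CE.+1 -> R).
Local Notation site := (hatV adj).
Local Notation cfg := (config adj CV CE).
Local Notation fcfg := (fconfig CV CE).
Implicit Types (U W : {fset site}) (tau omega : cfg) (z : site) (e : edge adj).
Hypothesis adj_sym : symmetric adj.
Hypothesis boundary_finite : forall U, finite_set (hat_boundary_set U).
Hypotheses (nu_ge0 : forall i, 0 <= nu i) (lam_ge0 : forall i, 0 <= lam i).
Hypotheses (nu0_gt0 : 0 < nu ord0) (lam0_gt0 : 0 < lam ord0).

Lemma in_boundary U z :
  (z \in hat_boundary U) = (z \in hat_boundary_set U).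
Proof. by rewrite in_fset_set. Qed.

Lemma boundary_disjoint U : [disjoint U & hat_boundary U]%fset.
Proof.
by apply/fdisjointP_sym => z; rewrite in_boundary inE => -[].
Qed.

Lemma closure_boundary U W : (hat_closure U `<=` W)%fset ->
  (hat_boundary U `<=` W `\` U)%fset.
Proof.
move=> /fsubsetP UW; apply/fsubsetP => z zU; rewrite in_fsetD.
rewrite UW ?in_fsetU ?zU ?orbT // andbT.
by move/fdisjointP_sym: (boundary_disjoint U); apply.
Qed.

(** A block [{x, y, xy}] is a clique of the augmented graph; hence a constraint that sees a site of
    [U] involves only sites of the closure of [U]. *)
Lemma block_adj e z z' : edge_block e z -> edge_block e z' -> z != z' -> hat_adj z z'.
Proof.
have [x [y [xy E]]] := asboolP _ (valP e).
case: z z' => [a|f] [b|g] //=; last by move=> /eqP-> /eqP->; rewrite eqxx.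
- rewrite E !inE => /orP[]/eqP-> /orP[]/eqP->; rewrite ?eqxx //.
  by rewrite adj_sym.
- by move=> ae /eqP->.
- by move=> /eqP-> be.
Qed.

Lemma block_closure U e z z' : z \in U -> edge_block e z -> edge_block e z' ->
  z' \in hat_closure U.
Proof.
move=> zU ez ez'; rewrite in_fsetU in_boundary.
have [//|z'U] /= := boolP (z' \in U); rewrite inE; split=> //.
exists z => //; apply: block_adj ez ez' _.
by apply: contraNneq z'U => <-.
Qed.

Definition load W e tau : nat := (\sum_(z <- W | edge_block e z) tau z)%N.

Definition feas W tau := forall e, (load W e tau <= C)%N.

Definition wt W tau : R := weight C nu lam (restr W tau).

Definition site_wt W tau : R := \prod_(z <- W) spin_weight nu lam (tau z).

Lemma load_eq U W e tau omega :
    (forall z, edge_block e z -> (z \in U) = (z \in W)) ->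
    (forall z, edge_block e z -> z \in U -> tau z = omega z) ->
  load U e tau = load W e omega.
Proof.
move=> UW h; transitivity (load U e omega).
  rewrite /load big_seq_cond [RHS]big_seq_cond.
  by apply: eq_bigr => z /andP[zU ez]; rewrite h.
rewrite /load -[LHS]big_filter -[RHS]big_filter; apply: perm_big.
apply: uniq_perm; rewrite ?filter_uniq ?fset_uniq // => z.
by rewrite !mem_filter; case: (boolP (edge_block e z)) => //= /UW.
Qed.

Lemma feasibleE W tau : feasible C (restr W tau) <-> feas W tau.
Proof.
suff E e : (\sum_(z : W | edge_block e (val z)) restr W tau z)%N = load W e tau.
  by split=> h e; have := h e; rewrite E.
rewrite /load big_seq_fsetE /=; apply: eq_bigr => z _.
by rewrite ffunE.
Qed.

Lemma wtE W tau : wt W tau = if `[< feas W tau >] then site_wt W tau else 0.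
Proof.
rewrite /wt /weight (asbool_equiv_eq (feasibleE W tau)); case: ifP => // _.
rewrite /site_wt big_seq_fsetE /=; apply: eq_bigr => z _.
by rewrite ffunE.
Qed.

Lemma site_wtD U W tau : (U `<=` W)%fset ->
  site_wt W tau = site_wt U tau * site_wt (W `\` U)%fset tau.
Proof.
move=> UW; rewrite /site_wt -big_cat; apply: perm_big; apply: uniq_perm.
- exact: fset_uniq.
- rewrite cat_uniq !fset_uniq andbT /=; apply/hasPn => z.
  by rewrite in_fsetD => /andP[].
move=> z; rewrite mem_cat in_fsetD.
by have [/(fsubsetP UW)|] := boolP (z \in U).
Qed.

Lemma site_wt_eq W tau omega : agree_on W tau omega -> site_wt W tau = site_wt W omega.
Proof.
move=> h; rewrite /site_wt big_seq [RHS]big_seq.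
by apply: eq_bigr => z /h->.
Qed.

Lemma spin_weight_ge0 z (s : spin CV CE z) : 0 <= spin_weight nu lam s.
Proof. by case: z s => [x|e] s /=. Qed.

Lemma wt_ge0 W tau : 0 <= wt W tau.
Proof.
rewrite wtE; case: ifP => // _; apply: prodr_ge0 => z _; exact: spin_weight_ge0.
Qed.

Lemma wt_depends W : depends_on W (wt W).
Proof. by move=> tau omega /restr_eqP E; rewrite /wt E. Qed.

(* A block meeting [U] lies in the closure of [U], so the factors of [wt W] that
   involve [U] are those of the weight of the closure. *)
Lemma wt_exchange U W tau omega : (hat_closure U `<=` W)%fset ->
  agree_off U tau omega ->
  wt W tau * wt (hat_closure U) omega = wt W omega * wt (hat_closure U) tau.
Proof.
move=> DW off; set D := hat_closure U in DW *.
have UD : (U `<=` D)%fset by exact: fsubsetUl.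
have UW : (U `<=` W)%fset by exact: fsubset_trans DW.
have onD X : agree_on (X `\` U)%fset tau omega.
  by move=> z; rewrite in_fsetD => /andP[/off].
pose touch e := exists2 z, z \in U & edge_block e z.
have E1 e s : touch e -> load W e s = load D e s.
  move=> [z zU ez]; apply: load_eq => // z' ez'.
  by have zD := block_closure zU ez ez'; rewrite zD (fsubsetP DW).
have E2 e X : ~ touch e -> load X e tau = load X e omega.
  move=> te; apply: load_eq => // z ez _; apply: off; apply/negP => zU.
  by apply: te; exists z.
(* For a block touching [U] the loads in [W] and in [D] coincide, so the two constraints trade
   places; for any other block [s] and [t] have the same load. *)
have sym s t : agree_off U s t -> (forall e X, ~ touch e -> load X e s = load X e t) ->
    feas W s /\ feas D t -> feas W t /\ feas D s.
  move=> st E [fs ft]; split=> e; have [te|te] := pselect (touch e).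
  - by rewrite E1.
  - by rewrite -E.
  - by rewrite -E1.
  - by rewrite E.
have equiv : `[< feas W tau >] && `[< feas D omega >] =
    `[< feas W omega >] && `[< feas D tau >].
  by apply/andP/andP => -[/asboolP f1 /asboolP f2];
    split; apply/asboolP; have [] := sym _ _ _ _ (conj f1 f2) => //;
    [move=> z /off|move=> e X /E2|move=> z /off|move=> e X /E2].
rewrite !wtE; move: equiv.
have P : site_wt W tau * site_wt D omega = site_wt W omega * site_wt D tau.
  rewrite !(site_wtD _ UW) !(site_wtD _ UD).
  by rewrite (site_wt_eq (onD W)) (site_wt_eq (onD D)); ring.
by do 4!case: ifP => _ //=; rewrite ?(mul0r, mulr0) // => ->.
Qed.

(** Up to the partition function of the closure, the probability of the boundary values of [tau],
    see [hat_m_boundaryE]; it is also the normalisation of [hat_pi]. *)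
Definition norm_wt U tau : R := ssum U (wt (hat_closure U)) tau.

Lemma norm_wtE U tau : norm_wt U tau = ssum U (wt (hat_closure U)) tau.
Proof. by []. Qed.

Lemma norm_wt_ge0 U tau : 0 <= norm_wt U tau.
Proof. by apply: ssum_ge0 => omega; exact: wt_ge0. Qed.

Lemma norm_wt_depends U : depends_on (hat_boundary U) (norm_wt U).
Proof. by apply: ssum_depends; exact: wt_depends. Qed.

Lemma norm_wt_eq0 U tau : norm_wt U tau = 0 -> wt (hat_closure U) tau = 0.
Proof. by apply: ssum_eq0 => omega; exact: wt_ge0. Qed.

Lemma partition_gt0 W : 0 < \sum_(t : fcfg W) weight C nu lam t.
Proof.
pose z0 : cfg := fun=> ord0.
have w0 : 0 < wt W z0.
  rewrite wtE ifT; last by apply/asboolP => e; rewrite /load big1.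
  by apply: prodr_gt0 => -[x|e] _ /=.
have E (t : fcfg W) : weight C nu lam t = wt W (glue t z0) by rewrite /wt restr_glue.
rewrite (bigD1 (restr W z0)) //= ltr_wpDr //.
by apply: sumr_ge0 => t _; rewrite E wt_ge0.
Qed.

Lemma agreeP W U tau (s : fcfg W) : (U `<=` W)%fset ->
  reflect (agree_on U (glue s tau) tau) (agree U tau s).
Proof.
move=> UW; apply: (iffP forallP) => h z.
  move=> zU; have zW := fsubsetP UW _ zU.
  have /implyP/(_ zU)/eqP := h [` zW]%fset.
  by rewrite -(glue_in s tau) => ->.
by apply/implyP => zU; rewrite -(h _ zU) glue_in.
Qed.

Lemma hat_m_boundaryE U tau : hat_m_boundary C nu lam U tau =
  norm_wt U tau / \sum_(t : fcfg (hat_closure U)) weight C nu lam t.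
Proof.
rewrite /hat_m_boundary /hat_m_pr /hat_m -mulr_suml; congr (_ / _).
rewrite /norm_wt /ssum; set D := hat_closure U.
have UD : (U `<=` D)%fset by exact: fsubsetUl.
have BD : (hat_boundary U `<=` D)%fset by exact: fsubsetUr.
pose h (u : fcfg U) := restr D (glue u tau).
pose h' (s : fcfg D) := restr U (glue s tau).
have hD u : glue (h u) tau = glue u tau.
  apply: glue_restr => z zD; rewrite glue_out //.
  by apply: contra zD; exact: (fsubsetP UD).
rewrite (reindex_onto h h') /=; last first.
  move=> s /(agreeP _ _ BD) sB; rewrite /h /h' -[RHS](restr_glue s tau).
  congr restr; apply: glue_restr => z zU.
  have [zB|zB] := boolP (z \in hat_boundary U); first exact: sB.
  by rewrite glue_out // in_fsetU negb_or zU.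
apply: eq_bigl => u.
rewrite /h' hD restr_glue eqxx andbT; apply/agreeP => //.
by rewrite hD; exact/agree_on_glue/boundary_disjoint.
Qed.

Lemma hat_m_boundary_gt0 U tau :
  (0 < hat_m_boundary C nu lam U tau) = (norm_wt U tau != 0).
Proof.
rewrite hat_m_boundaryE pmulr_lgt0 ?invr_gt0 ?partition_gt0 //.
by rewrite lt_neqAle norm_wt_ge0 andbT eq_sym.
Qed.

Lemma hat_piE U tau :
  hat_pi C nu lam U tau = wt (hat_closure U) tau / norm_wt U tau.
Proof.
rewrite /hat_pi hat_m_boundaryE; set D := hat_closure U; set Z := \sum_(t : _) _.
have Z0 : Z != 0 by rewrite gt_eqF // partition_gt0.
suff -> : hat_m_pr C nu lam [predI @agree _ _ _ _ D U tau & @agree _ _ _ _ D (hat_boundary U) tau]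
    = wt D tau / Z.
  by rewrite invf_div mulrA divfK.
rewrite /hat_m_pr (big_pred1 (restr D tau)) // => s /=.
apply/andP/eqP => [[/agreeP h1 /agreeP h2]|->].
  rewrite -[LHS](restr_glue s tau); apply/restr_eqP => z; rewrite in_fsetU => /orP[].
    by apply: h1; exact: fsubsetUl.
  by apply: h2; exact: fsubsetUr.
by split; apply/agreeP; rewrite ?fsubsetUl ?fsubsetUr // glue_restr.
Qed.

End Weights.

(** * Cylinders and Gibbs measures *)

Section Cylinders.
Variables (R : realType) (V : choiceType) (adj : rel V) (CV CE : nat).
Local Notation site := (hatV adj).
Local Notation cfg := (config adj CV CE).
Local Notation fcfg := (fconfig CV CE).
Local Notation space D := (g_sigma_algebraType (@coord_sets V adj CV CE D)).
Implicit Types (U W : {fset site}) (tau omega : cfg) (z : site) (D : set site).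

Definition Cyl W tau : set cfg := [set omega | agree_on W omega tau].

Lemma Cyl_eq W tau omega : agree_on W tau omega -> Cyl W tau = Cyl W omega.
Proof.
move=> h; apply/seteqP; split=> t ht z zW; first by rewrite ht // h.
by rewrite ht // h.
Qed.

Lemma CylI U W tau : Cyl U tau `&` Cyl W tau = Cyl (U `|` W)%fset tau.
Proof.
apply/seteqP; split=> [omega [hU hW] z|omega h].
  by rewrite in_fsetU => /orP[/hU|/hW].
by split=> z zX; apply: h; rewrite in_fsetU zX ?orbT.
Qed.

Lemma measurable_coord D z (B : set (spin CV CE z)) : D z ->
  measurable ([set tau | B (tau z)] : set (space D)).
Proof. by move=> Dz; apply: sub_sigma_algebra; exists z => //; exists B. Qed.

Lemma measurable_Cyl D W tau : [set` W] `<=` D -> measurable (Cyl W tau : set (space D)).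
Proof.
move=> WD; have -> : Cyl W tau = \bigcap_(z in [set` W]) [set omega | omega z = tau z].
  by apply/seteqP; split=> omega h z zW; apply: h.
apply: fin_bigcap_measurable; first exact: finite_fset.
by move=> z zW; apply: (@measurable_coord D z (fun s => s = tau z)); exact: WD.
Qed.

(* The finitely many cylinders are listed as a sequence, so that countable
   additivity applies. *)
Lemma depends_bigcup W (X : set cfg) : depends_on W X ->
  exists F : nat -> set cfg, [/\ trivIset setT F, X = \bigcup_k F k &
    forall k, F k = set0 \/ exists2 tau, X tau & F k = Cyl W tau].
Proof.
move=> dX; exists (fun k => [set tau | X tau /\ enum_rank (restr W tau) = k :> nat]).
split.
- by apply/trivIsetP => i j _ _ /eqP ij; apply/seteqP; split=> // t [[_ ti] [_ tj]];
    apply: ij; rewrite -ti.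
- apply/seteqP; split=> [t Xt|t [k _ []//]].
  by exists (enum_rank (restr W t)).
move=> k; have [->|] := eqVneq [set tau | X tau /\ enum_rank (restr W tau) = k :> nat] set0.
  by left.
move=> /set0P[t [Xt tk]]; right; exists t => //; apply/seteqP; split=> s.
  move=> [Xs sk]; apply/restr_eqP/enum_rank_inj/val_inj.
  by rewrite /= tk.
move=> ts; split; first by rewrite (dX s t).
by rewrite -tk; congr (nat_of_ord (enum_rank _)); apply/restr_eqP.
Qed.

Lemma depends_measurable D W (X : set cfg) : [set` W] `<=` D ->
  depends_on W X -> measurable (X : set (space D)).
Proof.
move=> WD /depends_bigcup[F [_ -> FX]]; apply: bigcup_measurable => k _.
by have [->|[t _ ->]] := FX k; [exact: measurable0|exact: measurable_Cyl].
Qed.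

Lemma depends_measurable_fun D W (f : cfg -> R) : [set` W] `<=` D ->
  depends_on W f -> measurable_fun setT (f : space D -> R).
Proof.
move=> WD df _ Y mY; rewrite setTI; apply: (depends_measurable WD).
by move=> s t /df st; rewrite /preimage /= st.
Qed.

Lemma measurable_space_sub D (X : set cfg) :
  measurable (X : set (space D)) -> measurable (X : set (config_space adj CV CE)).
Proof.
apply: sub_sigma_algebra2 => _ [z _ [B ->]].
by exists z => //; exists B.
Qed.

(** The events depending on finitely many sites of [D] form a pi-system; with [space_generated] this
    lets Dynkin's theorem extend identities from cylinders to the whole sigma-field. *)
Lemma space_setI_closed D :
  setI_closed [set X : set (space D) | exists2 W, [set` W] `<=` D & depends_on W X].
Proof.
move=> X Y [U UD dX] [W WD dY]; exists (U `|` W)%fset.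
  by move=> z /=; rewrite in_fsetU => /orP[/UD|/WD].
move=> s t st; rewrite /setI /=; congr (_ /\ _).
  by apply: dX; apply: agree_onS st; exact: fsubsetUl.
by apply: dY; apply: agree_onS st; exact: fsubsetUr.
Qed.

Lemma space_generated D : @measurable _ (space D) =
  <<s [set X : set (space D) | exists2 W, [set` W] `<=` D & depends_on W X] >>.
Proof.
apply/seteqP; split.
  apply: sub_sigma_algebra2 => _ [z Dz [B ->]]; exists [fset z]%fset.
    by move=> x /=; rewrite in_fset1 => /eqP->.
  by move=> s t st /=; rewrite st // in_fset1.
apply: smallest_sub; first exact: sigma_algebra_measurable.
by move=> X [W WD dX]; exact: depends_measurable WD dX.
Qed.

Variable mu : probability (config_space adj CV CE) R.

Definition pr (A : set cfg) : R := fine (mu A).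

Lemma prE (A : set cfg) : measurable (A : set (config_space adj CV CE)) -> (pr A)%:E = mu A.
Proof. by move=> mA; rewrite fineK // fin_num_measure. Qed.

Lemma pr_ge0 A : 0 <= pr A.
Proof. exact: fine_ge0. Qed.

Lemma pr_le A B : measurable (A : set (config_space adj CV CE)) ->
  measurable (B : set (config_space adj CV CE)) -> A `<=` B -> pr A <= pr B.
Proof.
by move=> mA mB AB; rewrite -lee_fin !prE // le_measure // inE.
Qed.

Lemma measurable_CylT W tau : measurable (Cyl W tau : set (config_space adj CV CE)).
Proof. exact: measurable_Cyl. Qed.

Lemma pr_partition U A tau : measurable (A : set (config_space adj CV CE)) ->
  pr A = \sum_(u : fcfg U) pr (A `&` Cyl U (glue u tau)).
Proof.
move=> mA; apply: EFin_inj; rewrite prE //.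
have mF (u : fcfg U) : measurable (A `&` Cyl U (glue u tau) : set (config_space adj CV CE)).
  by apply: measurableI => //; exact: measurable_CylT.
have {1}-> : A = \bigcup_(u in [set: fcfg U]) (A `&` Cyl U (glue u tau)).
  apply/seteqP; split=> [t At|t [u _ []//]].
  exists (restr U t) => //; split=> //.
  exact/agree_on_sym/glue_restr_agree.
rewrite (measure_fin_bigcup mu) //; last 2 first.
- exact: finite_finset.
- apply/trivIsetP => u v _ _ uv; apply/seteqP; split=> // t [[_ tu] [_ tv]].
  move/eqP: uv; apply; rewrite -(restr_glue u tau) -(restr_glue v tau).
  by apply/restr_eqP => z zU; rewrite -tu // tv.
have -> : [set: fcfg U] = [set` index_enum (fcfg U)].
  by apply/seteqP; split=> u //= _; rewrite mem_index_enum.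
rewrite -fsbig_seq ?index_enum_uniq // -sumEFin; apply: eq_bigr => u _.
by rewrite prE.
Qed.

Lemma pr_Cyl_ssum U W tau : [disjoint U & W]%fset ->
  pr (Cyl W tau) = ssum U (fun omega => pr (Cyl (U `|` W)%fset omega)) tau.
Proof.
move=> dUW; rewrite (pr_partition U tau); last exact: measurable_CylT.
apply: eq_bigr => u _; congr pr.
by rewrite (Cyl_eq (agree_on_sym (agree_on_glue u tau dUW))) setIC CylI.
Qed.

End Cylinders.

(** * Gibbs measures characterised by identities on finite cylinders *)

Section DLR.
Variables (R : realType) (V : choiceType) (adj : rel V) (C CV CE : nat).
Variables (nu : 'I_CV.+1 -> R) (lam : 'I_CE.+1 -> R).
Local Notation site := (hatV adj).
Local Notation cfg := (config adj CV CE).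
Local Notation fcfg := (fconfig CV CE).
Local Notation wt := (wt C nu lam).
Local Notation norm_wt := (norm_wt C nu lam).
Implicit Types (U W : {fset site}) (tau omega : cfg) (z : site) (e : edge adj).
Hypothesis adj_sym : symmetric adj.
Hypothesis boundary_finite : forall U, finite_set (hat_boundary_set U).
Hypotheses (nu_ge0 : forall i, 0 <= nu i) (lam_ge0 : forall i, 0 <= lam i).
Hypotheses (nu0_gt0 : 0 < nu ord0) (lam0_gt0 : 0 < lam ord0).
Variable mu : probability (config_space adj CV CE) R.
Local Notation pr := (pr mu).
Local Notation mset := (fun X : set cfg => measurable (X : set (config_space adj CV CE))).

Lemma norm_wt_Cyl U W tau omega : (hat_closure U `<=` W)%fset ->
  Cyl (W `\` U)%fset tau omega -> norm_wt U omega = norm_wt U tau.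
Proof.
move=> DW h; apply: norm_wt_depends; apply: agree_onS h.
exact: closure_boundary.
Qed.

Lemma Cyl_restrI U W tau (u : fcfg U) : (U `<=` W)%fset ->
  Cyl (W `\` U)%fset tau `&` [set omega | restr U omega = u] = Cyl W (glue u tau).
Proof.
move=> UW; apply/seteqP; split=> [t [tW tu] z zW|t tW].
  have [zU|zU] := boolP (z \in U).
    by rewrite -tu; apply/agree_on_sym: zU; exact: glue_restr_agree.
  by rewrite glue_out // tW // in_fsetD zU.
split=> [z|]; first by rewrite in_fsetD => /andP[zU /tW]; rewrite glue_out.
rewrite /= -[RHS](restr_glue u tau); apply/restr_eqP; apply: agree_onS tW.
exact: UW.
Qed.

Lemma Cyl_glue U (u : fcfg U) tau : Cyl U (glue u tau) = [set omega | restr U omega = u].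
Proof.
apply/seteqP; split=> t; last by move=> <-; exact/agree_on_sym/glue_restr_agree.
by move=> /restr_eqP; rewrite restr_glue.
Qed.

(* The definition of a Gibbs measure prescribes [p u] only where the
   configuration restricts to [u] on [U]. Where it takes another value, its
   integral vanishes, whence an inequality; summing over [u] turns it into an
   equality in [Gibbs_closure]. *)
Lemma Gibbs_le U W tau (u : fcfg U) : is_Gibbs C nu lam mu -> U != fset0 ->
  (hat_closure U `<=` W)%fset -> norm_wt U tau != 0 ->
  pr (Cyl W (glue u tau)) <=
  wt (hat_closure U) (glue u tau) / norm_wt U tau * pr (Cyl (W `\` U)%fset tau).
Proof.
move=> /(_ U) + U0 DW D0 => /(_ U0)[p [pcond pae]].
have UW : (U `<=` W)%fset by apply: fsubset_trans DW; exact: fsubsetUl.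
have [mp ip pint] := pcond u.
pose c := wt (hat_closure U) (glue u tau) / norm_wt U tau.
pose B := Cyl (W `\` U)%fset tau.
pose A := [set omega : cfg | restr U omega = u].
have mA : mset A by rewrite /A -(Cyl_glue u tau); exact: measurable_CylT.
have mB : measurable (B : set (outside_space CV CE U)).
  by apply: measurable_Cyl => z; rewrite /= in_fsetD => /andP[].
have E s : (B `&` A) s -> hat_pi C nu lam U s = c.
  move=> /[dup] [[sB sA]]; rewrite Cyl_restrI // => sW.
  rewrite hat_piE // (norm_wt_Cyl DW sB) /c; congr (_ / _).
  by apply: wt_depends; apply: agree_onS DW sW.
pose B' := B `&` [set s | p u s != c].
have mB' : measurable (B' : set (outside_space CV CE U)).
  apply: measurableI => //; rewrite -[X in measurable X]setTI.
  apply: (mp measurableT [set x | x != c]).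
  rewrite (_ : [set x | x != c] = ~` [set c]); last by apply/seteqP; split=> x /= /eqP.
  by apply: measurableC; exact: measurable_set1.
have mBc := measurable_space_sub mB; have mBc' := measurable_space_sub mB'.
have mpc : measurable_fun setT (p u : config_space adj CV CE -> R).
  move=> _ Y mY; have := mp measurableT Y mY; rewrite !setTI.
  exact: measurable_space_sub.
have mpE (X : set (config_space adj CV CE)) :
    measurable X -> measurable_fun X (fun s => (p u s)%:E).
  by move=> mX; apply/measurable_EFinP; exact: measurable_funS mpc.
(* On [B] and [A] together [hat_pi] equals [c], so the Gibbs property makes [p u] equal to [c] there
   almost everywhere. Since [B'] is an event outside [U], the integral of [p u] over it is the
   measure of this null set. *)
have null : mu (A `&` B') = 0%E.
  have [N [mN N0 hN]] := pae.
  apply/eqP; rewrite -measure_le0 -N0 le_measure ?inE //.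
    exact: measurableI.
  move=> s [sA [sB sc]]; apply: hN => -[_ /eqP].
  by rewrite sA (E s) //; apply/negP.
have int' : (\int[mu]_(s in (B' : set (config_space adj CV CE))) (p u s)%:E = 0)%E.
  by rewrite pint.
have mBB : mset (B `\` B') by exact: measurableD.
have BE : B = (B `\` B') `|` B' by rewrite setUC setDUK // => s [].
rewrite -lee_fin EFinM !prE; try exact: measurable_CylT.
rewrite -(Cyl_restrI _ _ UW) -/A -/B setIC -pint // BE.
rewrite integral_setU //=; last 2 first.
- by rewrite -BE; exact: mpE.
- by apply/disj_setPS => s [[_ sB] /sB].
rewrite int' adde0 (eq_integral (fun=> c%:E)); last first.
  move=> s; rewrite inE => -[sB nsB]; congr _%:E.
  by apply/eqP; apply: contra_notT nsB.
rewrite integral_cst // -BE lee_wpmul2l //.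
  by rewrite lee_fin divr_ge0 // ?wt_ge0 // norm_wt_ge0.
by rewrite le_measure ?inE // => s [].
Qed.

(** Almost every configuration has a boundary condition of positive probability, whereas [norm_wt U]
    vanishes on the whole cylinder. *)
Lemma Gibbs_norm_wt0 U W tau : is_Gibbs C nu lam mu -> U != fset0 ->
  (hat_closure U `<=` W)%fset -> norm_wt U tau = 0 -> pr (Cyl (W `\` U)%fset tau) = 0.
Proof.
move=> /(_ U) + U0 DW D0 => /(_ U0)[p [pcond [N [mN N0 hN]]]].
rewrite /pr; suff -> : mu (Cyl (W `\` U)%fset tau) = 0%E by [].
apply/eqP; rewrite -measure_le0 -N0 le_measure ?inE //.
  exact: measurable_CylT.
move=> s sB; apply: hN => -[+ _].
by rewrite hat_m_boundary_gt0 // (norm_wt_Cyl DW sB) D0 eqxx.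
Qed.

(** Summed over [u], both sides of [Gibbs_le] give the probability of the cylinder over [W] without
    [U], so no term can be strict. The equation is multiplied out to hold also where
    [norm_wt U tau = 0]. *)
Lemma Gibbs_closure U W tau : is_Gibbs C nu lam mu -> U != fset0 ->
  (hat_closure U `<=` W)%fset ->
  norm_wt U tau * pr (Cyl W tau) = wt (hat_closure U) tau * pr (Cyl (W `\` U)%fset tau).
Proof.
move=> G U0 DW; have [D0|D0] := eqVneq (norm_wt U tau) 0.
  by rewrite D0 mul0r norm_wt_eq0 ?mul0r.
have UW : (U `<=` W)%fset by apply: fsubset_trans DW; exact: fsubsetUl.
pose a (u : fcfg U) := pr (Cyl W (glue u tau)).
pose b (u : fcfg U) :=
  wt (hat_closure U) (glue u tau) / norm_wt U tau * pr (Cyl (W `\` U)%fset tau).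
have ab u : a u <= b u by exact: Gibbs_le.
have sab : \sum_u a u = \sum_u b u.
  rewrite /b -!mulr_suml -/(ssum _ _ _) divff // mul1r.
  rewrite (pr_partition mu U tau); last exact: measurable_CylT.
  by apply: eq_bigr => u _; rewrite Cyl_glue Cyl_restrI.
have : \sum_u (b u - a u) = 0 by rewrite sumrB sab subrr.
move=> /eqP; rewrite psumr_eq0 => [|u _]; last by rewrite subr_ge0.
move=> /allP/(_ (restr U tau)); rewrite mem_index_enum => /(_ isT).
rewrite subr_eq0 /a /b glue_restr // => /eqP <-.
by rewrite mulrA [norm_wt U tau * _]mulrC divfK.
Qed.

(** The kernel [f] depends on the boundary of [U] only, hence is constant on cylinders over [P n]
    without [U]. The hypothesis is the conditioning identity on these; countable unions and Dynkin's
    theorem extend it to all events outside [U]. *)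
Lemma DLR_Gibbs (P : nat -> {fset site}) :
  (forall U, \forall n \near \oo, (U `<=` P n)%fset) ->
  (forall U, \forall n \near \oo, forall tau,
      norm_wt U tau * pr (Cyl (P n) tau) =
        wt (hat_closure U) tau * pr (Cyl (P n `\` U)%fset tau) /\
      (norm_wt U tau = 0 -> pr (Cyl (P n `\` U)%fset tau) = 0)) ->
  is_Gibbs C nu lam mu.
Proof.
move=> Pcover PDLR U _.
pose D := hat_closure U; pose dU := [set z : site | z \notin U].
(* Division by zero gives [f s tau = 0] where [norm_wt U tau = 0]; by the second half of the
   hypothesis this happens on a null event, which is also the exceptional set at the end. *)
pose f (s : fcfg U) (tau : cfg) := wt D (glue s tau) / norm_wt U tau.
have BU : [set` hat_boundary U] `<=` dU.
  move=> z /= zB; rewrite /dU /=; have /fdisjointP_sym := boundary_disjoint boundary_finite U.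
  by apply.
have df s : depends_on (hat_boundary U) (f s).
  move=> t t' tt'; rewrite /f (norm_wt_depends C nu lam tt').
  congr (_ / _); apply: wt_depends => z; rewrite in_fsetU.
  have [zU _|zU /= zB] := boolP (z \in U); first exact: glue_agree.
  by rewrite !glue_out // tt'.
have f_ge0 s t : 0 <= f s t by rewrite divr_ge0 // ?wt_ge0 ?norm_wt_ge0.
have f_le1 s t : f s t <= 1.
  have [D0|D0] := eqVneq (norm_wt U t) 0; first by rewrite /f D0 invr0 mulr0.
  rewrite ler_pdivrMr ?lt_neqAle ?norm_wt_ge0 ?andbT 1?eq_sym // mul1r.
  rewrite norm_wtE /ssum (bigD1 s) //= lerDl.
  by apply: sumr_ge0 => u _; exact: wt_ge0.
have mf s : measurable_fun setT (f s : outside_space CV CE U -> R).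
  exact: depends_measurable_fun (df s).
have mfT s : measurable_fun setT (f s : config_space adj CV CE -> R).
  exact: depends_measurable_fun (df s).
have mfE s (X : set (config_space adj CV CE)) :
    measurable X -> measurable_fun X (fun t => (f s t)%:E).
  by move=> mX; apply/measurable_EFinP; apply: measurable_funS (mfT s).
have mA s : mset [set t : cfg | restr U t = s].
  by rewrite -(Cyl_glue s (fun=> ord0)); exact: measurable_CylT.
have large W : exists n, [/\ (W `<=` P n)%fset, (D `<=` P n)%fset & forall tau,
    norm_wt U tau * pr (Cyl (P n) tau) = wt D tau * pr (Cyl (P n `\` U)%fset tau) /\
    (norm_wt U tau = 0 -> pr (Cyl (P n `\` U)%fset tau) = 0)].
  near \oo => n; exists n; split; [near: n|near: n|near: n].
  - exact: Pcover.
  - exact: Pcover.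
  - exact: PDLR.
have integral_bigcupI s (F : nat -> set cfg) :
    (forall k, mset (F k)) -> trivIset setT F ->
    (forall k, (\int[mu]_(t in (F k : set (config_space adj CV CE))) (f s t)%:E =
      mu ([set t | restr U t = s] `&` F k))%E) ->
    (\int[mu]_(t in (\bigcup_k F k : set (config_space adj CV CE))) (f s t)%:E =
      mu ([set t | restr U t = s] `&` \bigcup_k F k))%E.
  move=> mF tF hF; rewrite ge0_integral_bigcup //=; last 2 first.
  - by apply: mfE; exact: bigcup_measurable.
  - by move=> t _; rewrite lee_fin.
  have mAF k : mset ([set t | restr U t = s] `&` F k) by exact: measurableI.
  rewrite setI_bigcupr measure_semi_bigcup //; last 2 first.
  - exact: trivIset_setIl.
  - exact: bigcup_measurable.
  by apply: eq_eseriesr => k _; exact: hF.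
have cyl s n tau : (D `<=` P n)%fset -> (forall tau,
    norm_wt U tau * pr (Cyl (P n) tau) = wt D tau * pr (Cyl (P n `\` U)%fset tau) /\
    (norm_wt U tau = 0 -> pr (Cyl (P n `\` U)%fset tau) = 0)) ->
    (\int[mu]_(t in (Cyl (P n `\` U)%fset tau : set (config_space adj CV CE))) (f s t)%:E =
      mu ([set t | restr U t = s] `&` Cyl (P n `\` U)%fset tau))%E.
  move=> Dn hn.
  have Un : (U `<=` P n)%fset by apply: fsubset_trans Dn; exact: fsubsetUl.
  have mC := measurable_CylT (P n `\` U)%fset tau.
  rewrite (eq_integral (fun=> (f s tau)%:E)); last first.
    move=> t; rewrite inE => ht; congr _%:E; apply: df; apply: agree_onS ht.
    exact: closure_boundary.
  rewrite integral_cst // setIC Cyl_restrI //.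
  transitivity ((f s tau)%:E * (pr (Cyl (P n `\` U)%fset tau))%:E)%E; first by rewrite prE.
  rewrite -prE; last exact: measurable_CylT.
  rewrite -EFinM; congr _%:E.
  have [h1 h2] := hn (glue s tau).
  have ga : agree_on (P n `\` U)%fset (glue s tau) tau.
    by move=> z; rewrite in_fsetD => /andP[zU _]; rewrite glue_out.
  have gD : norm_wt U (glue s tau) = norm_wt U tau by apply: (norm_wt_Cyl Dn ga).
  rewrite gD (Cyl_eq ga) in h1 h2.
  rewrite /f; have [D0|D0] := eqVneq (norm_wt U tau) 0.
    rewrite h2 // mulr0; apply/esym/eqP; rewrite eq_le pr_ge0 andbT -(h2 D0).
    apply: pr_le; try exact: measurable_CylT.
    by rewrite -Cyl_restrI // => t [].
  by apply: (mulfI D0); rewrite h1 mulrA [norm_wt U tau * _]mulrC divfK.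
exists f; split=> [s|].
  split; first exact: mf.
    apply: measurable_bounded_integrable => //.
      exact: le_lt_trans (probability_le1 mu measurableT) (ltry _).
    exists 1; split=> // M M1 t _ /=.
    by rewrite ger0_norm // (le_trans _ (ltW M1)).
  move=> B mB.
  pose G := [set X : set (outside_space CV CE U) |
    exists2 W, [set` W] `<=` dU & depends_on W X].
  pose Q := [set X : set (outside_space CV CE U) |
    (\int[mu]_(t in (X : set (config_space adj CV CE))) (f s t)%:E =
      mu ([set t | restr U t = s] `&` X))%E].
  have GP : G `<=` Q.
    move=> X [W WU dX] /=; have [n [Wn Dn hn]] := large W.
    have dXn : depends_on (P n `\` U)%fset X.
      apply: depends_onS dX; apply/fsubsetP => z zW; rewrite in_fsetD (fsubsetP Wn) // andbT.
      exact: WU.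
    have [F [tF -> FX]] := depends_bigcup dXn.
    apply: integral_bigcupI => // k.
      by have [->|[t _ ->]] := FX k; [exact: measurable0|exact: measurable_CylT].
    have [->|[t _ ->]] := FX k; last exact: cyl.
    by rewrite integral_set0 setI0 measure0.
  have PT : Q setT.
    by apply: GP; exists fset0 => // z; rewrite /= inE.
  suff : Q B by [].
  apply: (@dynkin_induction _ (outside_space CV CE U) G Q) => //.
  - exact: space_generated.
  - exact: space_setI_closed.
  - move=> S /measurable_space_sub mS hS.
    have mSc : mset (~` S) by exact: measurableC.
    have fin : mu ([set t | restr U t = s] `&` S) \is a fin_num.
      by rewrite fin_num_measure //; exact: measurableI.
    rewrite /Q /= -[LHS](addeK _ fin) -[RHS](addeK _ fin).
    congr (_ - _)%E; rewrite addeC [RHS]addeC -{1}hS -integral_setU //=; last 2 first.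
    + by apply: mfE; exact: measurableU.
    + by apply/disj_setPS => t [].
    rewrite setUv PT -measureU; last 3 first.
    + exact: measurableI.
    + exact: measurableI.
    + by apply/seteqP; split=> // t [[_ h1] [_ h2]].
    by rewrite -setIUr setUv.
  - move=> F mF; apply: integral_bigcupI => k; exact: measurable_space_sub (mF k).
  by rewrite -space_generated.
exists [set tau | norm_wt U tau = 0]; split.
- apply: (@depends_measurable _ _ _ _ _ (hat_boundary U)) => // t t' tt'.
  by rewrite /= (norm_wt_depends C nu lam tt').
- have [n [_ Dn hn]] := large fset0.
  have : depends_on (P n `\` U)%fset [set tau | norm_wt U tau = 0].
    by move=> t t' tt'; rewrite /= (norm_wt_Cyl Dn tt').
  move=> /depends_bigcup[F [tF E FX]].
  have mF k : mset (F k).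
    by have [->|[t _ ->]] := FX k; [exact: measurable0|exact: measurable_CylT].
  rewrite E measure_semi_bigcup ?eseries0 //; last exact: bigcup_measurable.
  move=> k _ _.
  have [->|[t t0 ->]] := FX k; first exact: measure0.
  transitivity ((pr (Cyl (P n `\` U)%fset t))%:E); first by rewrite prE //; exact: measurable_CylT.
  by rewrite (proj2 (hn t) t0).
move=> t /= ht; apply/eqP; apply: contra_notT ht => D0; split.
  by rewrite hat_m_boundary_gt0.
by rewrite hat_piE // /f glue_restr.
Unshelve. all: end_near.
Qed.

End DLR.

(** * Extension of consistent families *)

Section Image.
Context d d' (T : measurableType d) (T' : measurableType d') (R : realType).

Lemma image_probability (P : probability T R) (f : T -> T') :
  measurable_fun setT f ->
  exists Q : probability T' R, forall A, Q A = P (f @^-1` A).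
Proof.
move=> mf; pose X : {mfun T >-> T'} := HB.pack f (isMeasurableFun.Build _ _ _ _ f mf).
by exists (distribution P X).
Qed.

End Image.

Section Rank.
Variables (R : realType) (T : finType) (f : T -> R).
Hypothesis f_ge0 : forall v, 0 <= f v.

(** Partial sums along the enumeration of [T]: the intervals from [rank_sum (enum_rank v)], of
    length [f v], tile [[0, \sum_v f v)]. *)
Definition rank_sum (k : nat) : R := \sum_(v | (enum_rank v < k)%N) f v.

Lemma rank_sum_le k : rank_sum k <= \sum_v f v.
Proof.
rewrite /rank_sum big_mkcond /=; apply: ler_sum => v _.
by case: ifP.
Qed.

Lemma rank_sumS k v : (enum_rank v < k)%N -> rank_sum (enum_rank v) + f v <= rank_sum k.
Proof.
move=> vk; rewrite /rank_sum [leRHS](bigD1 v) //= [leLHS]addrC lerD2l.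
rewrite big_mkcond [leRHS]big_mkcond; apply: ler_sum => w _ /=.
have [wv|_] := boolP (enum_rank w < enum_rank v)%N; last by case: ifP.
rewrite (ltn_trans wv vk) /=; case: eqP => //= E.
by move: wv; rewrite E ltnn.
Qed.

Lemma rank_sum_total v : rank_sum (enum_rank v) + f v <= \sum_w f w.
Proof. exact: le_trans (rank_sumS (ltn_ord _)) (rank_sum_le _). Qed.

Lemma rank_sum_ge0 k : 0 <= rank_sum k.
Proof. exact: sumr_ge0. Qed.

Lemma rank_sum_exists x : 0 <= x < \sum_v f v ->
  exists v, rank_sum (enum_rank v) <= x < rank_sum (enum_rank v) + f v.
Proof.
move=> /andP[x0 xf].
have all : rank_sum #|T| = \sum_v f v by apply: eq_bigl => v; rewrite ltn_ord.
suff H k : (k <= #|T|)%N -> x < rank_sum k ->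
    exists v, rank_sum (enum_rank v) <= x < rank_sum (enum_rank v) + f v.
  by apply: (H #|T|); rewrite ?all.
elim: k => [_|k IH kT].
  by rewrite /rank_sum big_pred0 // ltNge x0.
have [xk _|xk] := ltP x (rank_sum k); first exact: IH (ltnW kT) xk.
have E : rank_sum k.+1 = rank_sum k + f (enum_val (Ordinal kT)).
  rewrite /rank_sum (bigD1 (enum_val (Ordinal kT))) /= ?enum_valK // addrC; congr (_ + _).
  apply: eq_bigl => v; rewrite ltnS leq_eqVlt -(inj_eq enum_rank_inj) enum_valK -val_eqE /=.
  by case: ltngtP.
by rewrite E => xk1; exists (enum_val (Ordinal kT)); rewrite enum_valK xk.
Qed.

Lemma rank_sum_unique x v w :
  rank_sum (enum_rank v) <= x < rank_sum (enum_rank v) + f v ->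
  rank_sum (enum_rank w) <= x < rank_sum (enum_rank w) + f w -> v = w.
Proof.
move=> /andP[v1 v2] /andP[w1 w2].
suff E : enum_rank v = enum_rank w by exact: enum_rank_inj.
apply: val_inj => /=.
have [/(rank_sumS)h|/(rank_sumS)h|//] := ltngtP (enum_rank v : nat) (enum_rank w).
  by have := lt_le_trans v2 (le_trans h w1); rewrite ltxx.
by have := lt_le_trans w2 (le_trans h v1); rewrite ltxx.
Qed.

End Rank.

Section Extension.
Variables (R : realType) (V : choiceType) (adj : rel V) (CV CE : nat).
Local Notation site := (hatV adj).
Local Notation cfg := (config adj CV CE).
Local Notation fcfg := (fconfig CV CE).
Variables (P : nat -> {fset site}) (m : nat -> cfg -> R).
Local Notation N n := (P n.+1 `\` P n)%fset.
Hypotheses (P0 : P 0%N = fset0) (Pmono : forall n, (P n `<=` P n.+1)%fset).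
Hypothesis Pcover : forall z, exists n, z \in P n.
Hypotheses (m_depends : forall n, depends_on (P n) (m n)) (m_ge0 : forall n tau, 0 <= m n tau).
Hypotheses (m0 : forall tau, m 0 tau = 1) (mS : forall n tau, m n tau = ssum (N n) (m n.+1) tau).

Lemma P_le i j : (i <= j)%N -> (P i `<=` P j)%fset.
Proof.
move=> /subnK<-; elim: (j - i)%N => [|k IH]; first exact: fsubset_refl.
by apply: fsubset_trans IH _; exact: Pmono.
Qed.

Let f n tau (v : fcfg (N n)) := m n.+1 (glue v tau).
Arguments f : clear implicits.

Let f_ge0 n tau v : 0 <= f n tau v. Proof. exact: m_ge0. Qed.

(* The cells [left_end n tau, left_end n tau + m n tau) partition [0, 1) and are
   refined at each step, so a uniform point of [0, 1) selects a configuration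
   whose prefixes have the prescribed probabilities. *)
Fixpoint left_end n tau : R :=
  if n is k.+1 then left_end k tau + rank_sum (f k tau) (enum_rank (restr (N k) tau))
  else 0.

Definition in_cell n tau (x : R) := left_end n tau <= x < left_end n tau + m n tau.

Lemma fE n tau omega : agree_on (P n) tau omega -> f n tau =1 f n omega.
Proof.
move=> h v; apply: m_depends => z zP.
have [zN|zN] := boolP (z \in N n); first exact: glue_agree.
rewrite !glue_out // h //; move: zN; rewrite in_fsetD zP andbT.
by rewrite negbK.
Qed.

Lemma rank_sum_eq n tau omega k : agree_on (P n) tau omega ->
  rank_sum (f n tau) k = rank_sum (f n omega) k.
Proof. by move=> h; apply: eq_bigr => v _; exact: fE. Qed.

Lemma left_end_depends n : depends_on (P n) (left_end n).
Proof.
elim: n => [//|n IH] tau omega h /=.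
have hn : agree_on (P n) tau omega by apply: agree_onS h.
rewrite (IH _ _ hn) (rank_sum_eq _ hn); congr (_ + rank_sum _ (enum_rank _)).
by apply/restr_eqP; apply: agree_onS h; exact: fsubsetDl.
Qed.

Lemma in_cell_depends n tau omega x : agree_on (P n) tau omega ->
  in_cell n tau x = in_cell n omega x.
Proof. by move=> h; rewrite /in_cell (left_end_depends h) (m_depends h). Qed.

Lemma in_cell_glue n tau x : in_cell n tau x ->
  exists v : fcfg (N n), in_cell n.+1 (glue v tau) x.
Proof.
rewrite /in_cell mS => /andP[x1 x2].
have [|v /andP[v1 v2]] := @rank_sum_exists _ _ (f n tau) (x - left_end n tau).
  by rewrite subr_ge0 x1 ltrBlDl.
have a : agree_on (P n) (glue v tau) tau.
  by apply: agree_on_glue; rewrite fdisjoint_sym; apply/fdisjointP => z zP;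
    rewrite in_fsetD zP.
exists v => /=; rewrite (left_end_depends a) (rank_sum_eq _ a) restr_glue.
by move: v1 v2; rewrite /f; lra.
Qed.

Lemma in_cellS n tau x : in_cell n.+1 tau x ->
  in_cell n tau x /\
  rank_sum (f n tau) (enum_rank (restr (N n) tau)) <= x - left_end n tau <
  rank_sum (f n tau) (enum_rank (restr (N n) tau)) + f n tau (restr (N n) tau).
Proof.
rewrite /in_cell /= => /andP[x1 x2].
have E : f n tau (restr (N n) tau) = m n.+1 tau by rewrite /f glue_restr.
have := rank_sum_total (@f_ge0 n tau) (restr (N n) tau).
have := rank_sum_ge0 (@f_ge0 n tau) (enum_rank (restr (N n) tau)).
rewrite E -[\sum_w _]/(ssum (N n) (m n.+1) tau) -mS => h0 h1.
by split; apply/andP; split; lra.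
Qed.

Lemma left_end_bounds n tau : 0 <= left_end n tau /\ left_end n tau + m n tau <= 1.
Proof.
elim: n => [|n [IH0 IH1]] /=; first by rewrite m0 add0r.
have E : f n tau (restr (N n) tau) = m n.+1 tau by rewrite /f glue_restr.
have := rank_sum_total (@f_ge0 n tau) (restr (N n) tau).
have := rank_sum_ge0 (@f_ge0 n tau) (enum_rank (restr (N n) tau)).
rewrite E -[\sum_w _]/(ssum (N n) (m n.+1) tau) -mS; move: IH0 IH1.
by set a := left_end _ _; set b := rank_sum _ _ => ? ? ? ?; split; lra.
Qed.

Lemma in_cell_agree n tau omega x :
  in_cell n tau x -> in_cell n omega x -> agree_on (P n) tau omega.
Proof.
elim: n tau omega => [|n IH] tau omega; first by move=> _ _ z; rewrite P0.
move=> /in_cellS[c1 r1] /in_cellS[c2 r2]; have a := IH _ _ c1 c2.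
have : restr (N n) tau = restr (N n) omega.
  apply: (rank_sum_unique (@f_ge0 n tau) r1).
  by rewrite (rank_sum_eq _ a) (left_end_depends a) (fE a).
move=> /restr_eqP aN z zP; have [|zn] := boolP (z \in P n); first exact: a.
by apply: aN; rewrite in_fsetD zn.
Qed.

(** Each cell containing [x] is refined by one at the next stage that contains [x]. The chosen
    configurations never change on earlier sites, so each spin of the limit can be read at any stage
    containing its site. *)
Lemma in_cell_limit x : 0 <= x < 1 -> exists tau, forall n, in_cell n tau x.
Proof.
move=> x01.
have ex n (tau : cfg) : {v : fcfg (N n) | in_cell n tau x -> in_cell n.+1 (glue v tau) x}.
  apply: cid; have [/in_cell_glue[v hv]|h] := pselect (in_cell n tau x); first by exists v.
  by exists (restr (N n) tau).
pose t := fix t n : cfg := if n is k.+1 then glue (sval (ex k (t k))) (t k) else fun=> ord0.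
have tc n : in_cell n (t n) x.
  elim: n => [|n IH]; first by rewrite /in_cell m0 /= add0r.
  exact: (svalP (ex n (t n))).
have tS n z : z \in P n -> t n.+1 z = t n z.
  by move=> zP /=; rewrite glue_out // in_fsetD zP.
have tle i j z : (i <= j)%N -> z \in P i -> t j z = t i z.
  move=> ij zi; rewrite -(subnK ij); elim: (j - i)%N => [//|k IH].
  rewrite addSn tS ?IH //; apply: fsubsetP zi; apply: P_le; exact: leq_addl.
pose k z := projT1 (cid (Pcover z)); have kP z : z \in P (k z) by rewrite /k; case: cid.
exists (fun z => t (k z) z) => n; rewrite (@in_cell_depends n _ (t n)) // => z zn.
by have [h|/ltnW h] := leqP (k z) n; [rewrite (tle _ _ _ h)|rewrite (tle _ _ _ h)].
Qed.

Lemma cell_set n tau : [set x | in_cell n tau x] = `[left_end n tau, left_end n tau + m n tau[%classic.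
Proof. by apply/seteqP; split=> x; rewrite /= in_itv. Qed.

Lemma in_cell01 n tau x : in_cell n tau x -> 0 <= x < 1.
Proof.
elim: n => [|n IH /in_cellS[/IH //]].
by rewrite /in_cell m0 /= add0r.
Qed.

(** Kolmogorov extension by transport of the uniform law on [[0, 1]]: the preimage of a cylinder is,
    up to a null set, its cell, an interval of length [m n tau]. *)
Theorem consistent_extension : exists mu : probability (config_space adj CV CE) R,
  forall n tau, mu (Cyl (P n) tau) = (m n tau)%:E.
Proof.
have ex x : {tau : cfg | 0 <= x < 1 -> forall n, in_cell n tau x}.
  apply: cid; have [/in_cell_limit[tau h]|h] := pselect (0 <= x < 1); first by exists tau.
  by exists (fun=> ord0).
(* Outside [[0, 1)] any constant value would do, this part being null; it must still be followed
   through the measurability of [X]. *)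
pose X x : config_space adj CV CE := if 0 <= x < 1 then sval (ex x) else fun=> ord0.
have XE n tau x : 0 <= x < 1 -> Cyl (P n) tau (X x) <-> in_cell n tau x.
  move=> x01; rewrite /X ifT //; have h := svalP (ex x) x01; split=> [a|c].
    by rewrite -(in_cell_depends _ a).
  by apply: in_cell_agree c; exact: h.
have pre n tau : X @^-1` (Cyl (P n) tau) `&` `[0, 1[ = [set x | in_cell n tau x].
  apply/seteqP; split=> x /=; first by rewrite in_itv /= => -[h x01]; apply/XE.
  move=> c; have x01 := in_cell01 c; rewrite in_itv /=; split=> //.
  exact/XE.
have mcell n tau : measurable [set x | in_cell n tau x].
  by rewrite cell_set; exact: measurable_itv.
have mpre n tau : measurable (X @^-1` (Cyl (P n) tau)).
  have -> : X @^-1` (Cyl (P n) tau) = [set x | in_cell n tau x] `|`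
      ((X @^-1` (Cyl (P n) tau)) `\` `[0, 1[).
    by rewrite -pre; exact/esym/setUIDK.
  apply: measurableU; first exact: mcell.
  have [h|h] := pselect (Cyl (P n) tau (fun=> ord0)).
    rewrite (_ : _ `\` _ = ~` `[0, 1[%classic); first by apply: measurableC; exact: measurable_itv.
    apply/seteqP; split=> x; first by move=> [].
    by move=> x01; split=> //=; rewrite /X ifF //; apply/negP; move: x01; rewrite /= in_itv.
  rewrite (_ : _ `\` _ = set0) //; apply/seteqP; split=> x //= -[+ x01].
  by rewrite /X ifF //; apply/negP; move: x01; rewrite /= in_itv.
have mX : measurable_fun setT X.
  apply: (@measurability _ _ _ (config_space adj CV CE) setT X (coord_sets setT)) => //.
  move=> _ [_ [z _ [B ->]] <-]; rewrite setTI; have [n zn] := Pcover z.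
  have : depends_on (P n) [set tau : cfg | B (tau z)] by move=> s t st; rewrite /= st.
  move=> /depends_bigcup[F [_ -> FX]]; rewrite preimage_bigcup.
  apply: bigcup_measurable => k _.
  by have [->|[t _ ->]] := FX k; [rewrite preimage_set0|].
have [mu muE] := image_probability (uniform_prob (@ltr01 R)) mX.
have uE a b : 0 <= a -> a <= b -> b <= 1 ->
    (uniform_prob (@ltr01 R) `[a, b[ = (b - a)%:E)%E.
  move=> a0 ab b1; rewrite /uniform_prob (eq_integral (fun=> 1%:E)); last first.
    move=> x; rewrite inE /= in_itv /= /uniform_pdf => /andP[ax xb].
    by rewrite (le_trans a0 ax) (ltW (lt_le_trans xb b1)) /= subr0 invr1.
  rewrite integral_cst; last exact: measurable_itv.
  rewrite mul1e; apply: (etrans (lebesgue_measure_itv `[a, b[)); rewrite /= lte_fin.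
  by move: ab; rewrite le_eqVlt => /predU1P[->|->]; rewrite ?ltxx ?subrr // EFinB.
have u01 : uniform_prob (@ltr01 R) (~` `[0, 1[) = 0%E.
  rewrite probability_setC; last exact: measurable_itv.
  transitivity (1 - (1 - 0 : R)%:E)%E; last by rewrite subr0 subee.
  by congr (1 - _)%E; apply: uE; rewrite ?ler01 ?lexx.
exists mu => n tau; rewrite muE.
rewrite -(setUIDK (X @^-1` Cyl (P n) tau) `[0, 1[) measureU; last 3 first.
- by rewrite pre; exact: mcell.
- by apply: measurableD; [exact: mpre|exact: measurable_itv].
- by apply/seteqP; split=> x // [[_ h] [_ /(_ h)]].
rewrite [X in (_ + X)%E](_ : _ = 0%E) ?adde0; last first.
  apply/eqP; rewrite -measure_le0 -u01; apply: le_measure; rewrite ?inE.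
  - by apply: measurableD; [exact: mpre|exact: measurable_itv].
  - by apply: measurableC; exact: measurable_itv.
  - by move=> x [].
have [l0 l1] := left_end_bounds n tau.
rewrite pre cell_set; transitivity ((left_end n tau + m n tau - left_end n tau)%:E).
  by apply: uE => //; rewrite lerDl.
by rewrite addrAC subrr add0r.
Qed.

End Extension.

(** * The prefixes of the numbered tree *)

Section Ssum1.
Variables (R : realType) (V : choiceType) (adj : rel V) (CV CE : nat).
Local Notation site := (hatV adj).
Local Notation cfg := (config adj CV CE).

Lemma ssum1 (z : site) (f : cfg -> R) (g : spin CV CE z -> R) (tau : cfg) :
  (forall omega, agree_off [fset z]%fset omega tau -> f omega = g (omega z)) ->
  ssum [fset z]%fset f tau = \sum_(a : spin CV CE z) g a.
Proof.
move=> fg; rewrite /ssum.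
pose h (u : fconfig CV CE [fset z]%fset) : spin CV CE z := glue u tau z.
pose upd (a : spin CV CE z) : cfg := @dfwith _ (fun z => spin CV CE z) tau z a.
rewrite (reindex h) /=; first by apply: eq_bigr => u _; rewrite fg //; exact: glue_out.
exists (fun a => restr [fset z]%fset (upd a)) => [u _|a _].
  rewrite -[RHS](restr_glue u tau); apply/restr_eqP => x; rewrite in_fset1 => /eqP->.
  by rewrite /upd dfwithin.
rewrite /h glue_restr ?/upd ?dfwithin // => x; rewrite in_fset1 eq_sym => xz.
by rewrite dfwithout.
Qed.

End Ssum1.

Section Sites.
Variables (q : nat) (V : choiceType) (adj : rel V) (phi : nat -> V).
Hypothesis q_gt0 : (0 < q)%N.
Hypotheses (phi_inj : injective phi) (phi_onto : forall x, exists n, phi n = x).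
Hypothesis phi_adj : forall i j, adj (phi i) (phi j) = tree_adj q i j.
Local Notation parent := (parent q).
Local Notation site := (hatV adj).
Implicit Types (z : site) (e : edge adj).

Definition vsite (i : nat) : site := inl (phi i).

Lemma parent_edge j : is_edge adj [fset phi j.+1; phi (parent j.+1)]%fset.
Proof.
apply/asboolP; exists (phi j.+1), (phi (parent j.+1)); split=> //.
by rewrite phi_adj /tree_adj eqxx orbT.
Qed.

(* The edge joining the vertex [j.+1] to its parent. *)
Definition pedge (j : nat) : edge adj :=
  exist (fun s : {fset V} => is_edge adj s) [fset phi j.+1; phi (parent j.+1)]%fset (parent_edge j).

Definition esite (j : nat) : site := inr (pedge j).

Lemma in_pedge i j : (phi i \in val (pedge j)) = (i == j.+1) || (i == parent j.+1).
Proof. by rewrite /= !inE !(inj_eq phi_inj). Qed.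

Lemma pedge_inj : injective pedge.
Proof.
move=> i j ij; have h1 := in_pedge i.+1 j; have h2 := in_pedge j.+1 i.
rewrite -ij in_pedge eqxx /= in h1; rewrite ij in_pedge eqxx /= in h2.
have p1 := parent_lt q_gt0 (ltn0Sn i); have p2 := parent_lt q_gt0 (ltn0Sn j).
by move: (esym h1) (esym h2) => /orP[/eqP|/eqP] ? /orP[/eqP|/eqP] ?; lia.
Qed.

Lemma pedge_onto e : exists j, pedge j = e.
Proof.
have [x [y [xy E]]] := asboolP _ (valP e).
have [i ix] := phi_onto x; have [j jy] := phi_onto y.
move: xy E; rewrite -ix -jy phi_adj => /orP[] /andP[].
  case: j {jy} => // j _ /eqP -> E; exists j; apply: val_inj.
  by rewrite E /= fsetUC.
by case: i {ix} => // i _ /eqP -> E; exists i; apply: val_inj; rewrite E.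
Qed.

Lemma siteP z : (exists i, z = vsite i) \/ (exists j, z = esite j).
Proof.
case: z => [x|e]; first by left; have [i <-] := phi_onto x; exists i.
by right; have [j <-] := pedge_onto e; exists j.
Qed.

Lemma vsite_neq_esite i j : vsite i != esite j.
Proof.
apply/negP => /eqP E.
by have := congr1 (fun z : site => if z is inl _ then true else false) E.
Qed.

Lemma esite_neq_vsite i j : esite j != vsite i.
Proof. by rewrite eq_sym vsite_neq_esite. Qed.

Lemma vsite_esite_disjoint i j : [disjoint [fset vsite i] & [fset esite j]]%fset.
Proof. by rewrite fdisjoint1X in_fset1 vsite_neq_esite. Qed.

(** The first [n] vertices and the edges between them: [esite j] comes with the vertex [j.+1],
    whence [n.-1] edges. *)
Definition psites (n : nat) : seq site :=
  [seq vsite i | i <- iota 0 n] ++ [seq esite j | j <- iota 0 n.-1].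

Lemma prefix_subproof n : {W : {fset site} | W =i psites n}.
Proof. by exists [fset z in psites n]%fset => z; rewrite in_fset. Qed.

(* Kept opaque: unification would otherwise unfold it to an enumeration. *)
Definition prefix (n : nat) : {fset site} := sval (prefix_subproof n).

Lemma in_prefix z n : (z \in prefix n) = (z \in psites n).
Proof. exact: (svalP (prefix_subproof n)). Qed.

Lemma vsite_inj : injective vsite. Proof. by move=> i j [/phi_inj]. Qed.

Lemma esite_inj : injective esite.
Proof.
move=> i j E; apply: pedge_inj.
exact: (congr1 (fun z => if z is inr e then e else pedge i) E).
Qed.

Lemma vsite_prefix i n : (vsite i \in prefix n) = (i < n)%N.
Proof.
rewrite in_prefix mem_cat (mem_map vsite_inj) mem_iota /= orbC.
by rewrite (_ : (_ \in _) = false) //; apply/negP => /mapP[].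
Qed.

Lemma esite_prefix j n : (esite j \in prefix n) = (j.+1 < n)%N.
Proof.
rewrite in_prefix mem_cat (mem_map esite_inj) mem_iota /=.
rewrite (_ : (_ \in _) = false) /=; last by apply/negP => /mapP[].
by case: n.
Qed.

Lemma psites_uniq n : uniq (psites n).
Proof.
rewrite cat_uniq !map_inj_uniq ?iota_uniq //=; [|exact: esite_inj|exact: vsite_inj].
by rewrite andbT; apply/hasPn => z /mapP[j _ ->]; apply/negP => /mapP[].
Qed.

Lemma psites_perm n : perm_eq (prefix n) (psites n).
Proof.
by apply: uniq_perm; [exact: fset_uniq|exact: psites_uniq|move=> z; rewrite -in_prefix].
Qed.

Lemma prefix_le m n : (m <= n)%N -> (prefix m `<=` prefix n)%fset.
Proof.
move=> mn; apply/fsubsetP => z; have [[i ->]|[j ->]] := siteP z.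
  by rewrite !vsite_prefix => /leq_trans; apply.
by rewrite !esite_prefix => /leq_trans; apply.
Qed.

Lemma prefix0 : prefix 0 = fset0.
Proof.
apply/fsetP => z; have [[i ->]|[j ->]] := siteP z.
  by rewrite vsite_prefix ltn0 in_fset0.
by rewrite esite_prefix ltn0 in_fset0.
Qed.

Lemma prefix1 : prefix 1 = [fset vsite 0]%fset.
Proof.
apply/fsetP => z; rewrite in_fset1; have [[i ->]|[j ->]] := siteP z.
  by rewrite vsite_prefix (inj_eq vsite_inj); case: i.
by rewrite esite_prefix (negPf (esite_neq_vsite _ _)).
Qed.

Lemma prefixSD n : (prefix n.+2 `\` prefix n.+1 = [fset vsite n.+1] `|` [fset esite n])%fset.
Proof.
apply/fsetP => z.
have E1 : (z \in [fset vsite n.+1]%fset) = (z == vsite n.+1) by exact: in_fset1.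
have E2 : (z \in [fset esite n]%fset) = (z == esite n) by exact: in_fset1.
have R : (z \in [fset vsite n.+1] `|` [fset esite n])%fset = (z == vsite n.+1) || (z == esite n).
  by rewrite in_fsetU; congr (_ || _).
apply: (etrans (in_fsetD _ _ _)); apply: (etrans _ (esym R)) => {R E1 E2}.
have [[i ->]|[j ->]] := siteP z.
  rewrite !vsite_prefix (inj_eq vsite_inj) -leqNgt (negPf (vsite_neq_esite _ _)) orbF.
  by rewrite eqn_leq andbC ltnS.
rewrite !esite_prefix (negPf (esite_neq_vsite _ _)) (inj_eq esite_inj).
by rewrite -leqNgt !ltnS eqn_leq andbC.
Qed.

Lemma prefix_sup (U : {fset site}) : \forall n \near \oo, (U `<=` prefix n)%fset.
Proof.
have ex z : exists n, z \in prefix n.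
  have [[i ->]|[j ->]] := siteP z; first by exists i.+1; rewrite vsite_prefix.
  by exists j.+2; rewrite esite_prefix.
pose k z := projT1 (cid (ex z)); have kP z : z \in prefix (k z) by rewrite /k; case: cid.
exists (\max_(z <- U) k z)%N => // n /= nk; apply/fsubsetP => z zU.
apply: (fsubsetP (prefix_le _)) (kP z); apply: leq_trans nk.
exact: leq_bigmax_seq.
Qed.

Lemma hat_adj_prefix n z w : (0 < n)%N -> z \in prefix n -> hat_adj z w ->
  w \in prefix (q * n + 2).
Proof.
move=> n0; have nq : (n <= q * n + 2)%N by nia.
have pl j : (parent j < n)%N = (j < q * n + 2)%N by exact: parent_ltE.
have pl' j : (0 < j)%N -> (parent j < j)%N by exact: parent_lt.
have [[i ->]|[i ->]] := siteP z; have [[j ->]|[j ->]] := siteP w;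
  rewrite ?vsite_prefix ?esite_prefix => hi //; rewrite [hat_adj _ _]/=.
- rewrite phi_adj => /orP[/andP[j0 /eqP ij]|/andP[i0 /eqP ji]].
    by rewrite -pl -ij.
  by apply: leq_trans nq; rewrite ji; apply: ltn_trans hi; exact: pl'.
- rewrite in_pedge => /orP[/eqP ij|/eqP ij]; last by rewrite -pl -ij.
  by apply: leq_trans nq; rewrite -ij.
- rewrite in_pedge => /orP[/eqP->|/eqP->]; apply: leq_trans nq => //.
  by apply: ltn_trans hi; exact: pl'.
Qed.

Lemma tree_boundary_finite (U : {fset site}) : finite_set (hat_boundary_set U).
Proof.
have [n _ /(_ n.+1 (leqnSn n)) Un] := prefix_sup U.
apply: (@sub_finite_set _ _ [set` prefix (q * n.+1 + 2)]); last exact: finite_fset.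
move=> z [_ [w wU wz]] /=; apply: hat_adj_prefix wz => //.
exact: (fsubsetP Un).
Qed.

Lemma closure_prefix n : (0 < n)%N -> hat_closure (prefix n) = prefix (q * n + 2).
Proof.
move=> n0; have nq : (n <= q * n + 2)%N by nia.
have pl j : (parent j < n)%N = (j < q * n + 2)%N by exact: parent_ltE.
apply/fsetP => z; rewrite in_fsetU in_fset_set; last exact: tree_boundary_finite.
apply/orP/idP => [[|]|].
- exact/fsubsetP/prefix_le.
- rewrite inE => -[_ [w wn]]; exact: hat_adj_prefix.
move=> zM; have [zn|zn] := boolP (z \in prefix n); first by left.
right; rewrite inE; split=> //.
have [[i zE]|[j zE]] := siteP z; move: zM zn; rewrite zE.
  rewrite !vsite_prefix -pl -leqNgt => hi ni; exists (vsite (parent i)).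
    by rewrite vsite_prefix.
  by rewrite /= phi_adj /tree_adj eqxx (leq_trans n0 ni).
rewrite !esite_prefix -pl => hj _; exists (vsite (parent j.+1)).
  by rewrite vsite_prefix.
by rewrite /= in_pedge eqxx orbT.
Qed.

End Sites.

(** * Boundary weights and the summation of one vertex *)

Section TreeWeights.
Variables (R : realType) (q C : nat) (V : choiceType) (adj : rel V) (phi : nat -> V).
Hypotheses (q_gt0 : (0 < q)%N) (C_ge2 : (2 <= C)%N).
Hypotheses (phi_inj : injective phi) (phi_onto : forall x, exists n, phi n = x).
Hypothesis phi_adj : forall i j, adj (phi i) (phi j) = tree_adj q i j.
Variables (nu : R) (lam : 'I_C.+1 -> R).
Hypotheses (nu_gt0 : 0 < nu) (lam_ge0 : forall i, 0 <= lam i) (lam0_gt0 : 0 < lam ord0).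
Local Notation A := (Lambda lam C).
Local Notation B := (Lambda lam (C - 1)).
Local Notation D := (Lambda lam (C - 2)).
Local Notation parent := (parent q).
Local Notation site := (hatV adj).
Local Notation cfg := (config adj 1 C).
Local Notation wt := (wt C (unicast_weights nu) lam).
Local Notation vsite := (@vsite V adj phi).
Local Notation esite := (esite phi_adj).
Local Notation prefix := (prefix phi_adj).
Implicit Types (tau omega : cfg).

Definition vspin tau (i : nat) : 'I_2 := tau (vsite i).
Definition espin tau (j : nat) : 'I_C.+1 := tau (esite j).

Definition edge_ok tau (j : nat) : bool :=
  (vspin tau j.+1 + vspin tau (parent j.+1) + espin tau j <= C)%N.

(** What the vertex [i] brings along with its parent edge, the capacity constraint of that edge
    included; only earlier vertices are involved besides. *)
Definition factor tau (i : nat) : R :=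
  if i is j.+1 then nu ^+ vspin tau i * lam (espin tau j) * (edge_ok tau j)%:R
  else nu ^+ vspin tau 0.

(* The vertices [c] with [n <= c < q * n + 2] are those outside the prefix of
   length [n] whose parent is inside; [c] sends the message [1] or [y c] to its
   parent, according to the spin of the latter. *)
Definition bweight (n : nat) (y : nat -> R) tau : R :=
  (\prod_(0 <= i < n) factor tau i) *
  \prod_(n <= c < q * n + 2) y c ^+ vspin tau (parent c).

Lemma unicast_weightsE (a : 'I_2) : unicast_weights nu a = nu ^+ a.
Proof. by rewrite /unicast_weights; case: a => [[|[|a]] ha]. Qed.

Lemma load_prefix n tau j : (j.+1 < n)%N -> load (prefix n) (pedge phi_adj j) tau =
  (vspin tau j.+1 + vspin tau (parent j.+1) + espin tau j)%N.
Proof.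
move=> jn; rewrite /load -big_filter.
have pj := parent_lt q_gt0 (ltn0Sn j).
rewrite (perm_big [:: vsite j.+1; vsite (parent j.+1); esite j]) /=.
  by rewrite !big_cons big_nil addn0 addnA.
apply: uniq_perm; first exact/filter_uniq/fset_uniq.
  rewrite /= !inE !(inj_eq (@vsite_inj V adj phi phi_inj)) /= andbT orbF.
  by rewrite eq_sym ltn_eqF.
move=> z; have zE : (z \in (prefix n : seq site)) = (z \in prefix n) by [].
rewrite mem_filter zE; have [[i ->]|[i ->]] := siteP phi_onto phi_adj z.
  rewrite vsite_prefix // -[edge_block _ _]/(phi i \in val (pedge phi_adj j)).
  rewrite in_pedge // !inE !(inj_eq (@vsite_inj V adj phi phi_inj)) orbF.
  apply/andb_idr => /orP[/eqP->//|/eqP->]; exact: ltn_trans jn.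
rewrite esite_prefix //= !inE (inj_eq (esite_inj q_gt0 phi_inj (phi_adj:=phi_adj))) /=.
rewrite (inj_eq (pedge_inj q_gt0 phi_inj (phi_adj:=phi_adj))).
by case: eqP => //= ->.
Qed.

(** An edge outside the prefix has at most its parent end inside, whose spin is at most 1, below
    [C]; its constraint then holds by itself. *)
Lemma feas_prefix n tau :
  feas C (prefix n) tau <-> forall j, (j.+1 < n)%N -> edge_ok tau j.
Proof.
split=> [h j jn|h e].
  by rewrite /edge_ok -(load_prefix tau jn).
have [j <-] := pedge_onto phi_onto phi_adj e.
have [jn|jn] := ltnP j.+1 n; first by rewrite load_prefix //; exact: h.
apply: (@leq_trans (\sum_(z <- [:: vsite (parent j.+1)]) tau z)%N).
  rewrite /load -big_filter.
  set s := [seq z <- _ | _].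
  have us : uniq s by exact/filter_uniq/fset_uniq.
  have hs z : z \in s -> z = vsite (parent j.+1).
    have zE : (z \in (prefix n : seq site)) = (z \in prefix n) by [].
    rewrite /s mem_filter zE; have [[i ->]|[i ->]] := siteP phi_onto phi_adj z.
      rewrite vsite_prefix // -[X in X && _]/(phi i \in val (pedge phi_adj j)).
      rewrite in_pedge // => /andP[/orP[/eqP->|/eqP->//]].
      by rewrite ltnNge jn.
    rewrite esite_prefix //= (inj_eq (pedge_inj q_gt0 phi_inj (phi_adj:=phi_adj))).
    by move=> /andP[/eqP->]; rewrite ltnNge jn.
  case: s us hs => [|z [|z' s]] //=; first by rewrite big_nil.
    by move=> _ /(_ z); rewrite inE eqxx => /(_ isT) ->; rewrite !big_cons.
  move=> /andP[+ _] hs; have z1 := hs z (mem_head _ _).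
  have z2 : z' = vsite (parent j.+1) by apply: hs; rewrite !inE eqxx orbT.
  by rewrite inE z1 z2 eqxx.
rewrite big_seq1; apply: leq_trans C_ge2; apply: ltnW.
exact: (ltn_ord (vspin tau (parent j.+1))).
Qed.

Lemma wt_prefix n tau : wt (prefix n) tau = \prod_(0 <= i < n) factor tau i.
Proof.
rewrite wtE /site_wt (perm_big _ (psites_perm q_gt0 phi_inj phi_adj n)).
rewrite big_cat !big_map /=.
case: n => [|n] /=.
  by rewrite !big_nil mulr1 ifT //; apply/asboolP/feas_prefix.
rewrite big_nat_recl // big_cons -(subn0 n) -[iota 0 _]/(index_iota 0 n) subn0.
have -> : iota 1 n = [seq i.+1 | i <- index_iota 0 n].
  by rewrite /index_iota subn0 -[1%N]/(1 + 0)%N iotaDl.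
rewrite big_map unicast_weightsE /= !big_split /= mulrA.
have -> : \prod_(j <- index_iota 0 n) unicast_weights nu (tau (vsite j.+1)) =
    \prod_(0 <= j < n) nu ^+ vspin tau j.+1.
  by apply: eq_bigr => j _; rewrite unicast_weightsE.
case: asboolP => [/feas_prefix h|h].
  have -> : \prod_(0 <= j < n) (edge_ok tau j)%:R = 1 :> R.
    by rewrite big_nat big1 // => j /andP[_ jn]; rewrite h.
  by rewrite mulr1 /vspin /espin; ring.
have [j /andP[jn jo]] : exists j, (j < n)%N && ~~ edge_ok tau j.
  apply/not_existsP => H; apply: h; apply/feas_prefix => j jn.
  by have := H j; rewrite -ltnS jn /= => /negP; rewrite negbK.
have -> : \prod_(0 <= j < n) (edge_ok tau j)%:R = 0 :> R.
  by rewrite (bigD1_seq j) ?mem_index_iota ?iota_uniq //= (negPf jo) mul0r.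
by rewrite !mulr0.
Qed.

Lemma factor_depends i : depends_on (prefix i.+1) (fun tau => factor tau i).
Proof.
case: i => [|j] tau omega h.
  by rewrite /factor /vspin h // vsite_prefix.
have p := parent_lt q_gt0 (ltn0Sn j).
rewrite /factor /edge_ok /vspin /espin !h ?vsite_prefix ?esite_prefix //.
exact: ltn_trans (ltnSn _).
Qed.

Lemma factor_ge0 tau i : 0 <= factor tau i.
Proof.
case: i => [|j]; first by rewrite exprn_ge0 // ltW.
by rewrite !mulr_ge0 ?exprn_ge0 ?ler0n // ltW.
Qed.

Lemma prod_factor_depends n :
  depends_on (prefix n) (fun tau => \prod_(0 <= i < n) factor tau i).
Proof.
move=> tau omega h; apply: eq_big_nat => i /andP[_ ni]; apply: factor_depends.
by apply: agree_onS h; exact: prefix_le.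
Qed.

Lemma boundary_parent n c : (0 < n)%N -> (c < q * n + 2)%N -> (parent c < n)%N.
Proof. by move=> n0; rewrite parent_ltE. Qed.

Lemma boundary_prod_eq n m k (y : nat -> R) tau omega : (0 < n)%N -> (k <= q * n + 2)%N ->
  agree_on (prefix n) tau omega ->
  \prod_(m <= c < k) y c ^+ vspin tau (parent c) =
  \prod_(m <= c < k) y c ^+ vspin omega (parent c).
Proof.
move=> n0 kn h; apply: eq_big_nat => c /andP[_ ck].
by rewrite /vspin h // vsite_prefix // boundary_parent // (leq_trans ck).
Qed.

Lemma bweight_depends n y : (0 < n)%N -> depends_on (prefix n) (bweight n y).
Proof.
move=> n0 tau omega h; rewrite /bweight (prod_factor_depends h).
by rewrite (boundary_prod_eq _ _ n0 (leqnn _) h).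
Qed.

Lemma bweight_ge0 n y tau : (forall c, 0 <= y c) -> 0 <= bweight n y tau.
Proof.
move=> y0; rewrite mulr_ge0 //; first by apply: prodr_ge0 => i _; exact: factor_ge0.
by apply: prodr_ge0 => c _; rewrite exprn_ge0.
Qed.

Lemma Lambda_sum (s : nat) : (s <= C)%N ->
  \sum_(b : 'I_C.+1) lam b * (s + b <= C)%N%:R = Lambda lam (C - s).
Proof.
move=> sC; rewrite /Lambda [RHS]big_mkcond; apply: eq_bigr => b _.
have -> : (b <= C - s)%N = (s + b <= C)%N by lia.
by case: ifP; rewrite ?mulr1 ?mulr0.
Qed.

(** For [n > 0], the weight of spin 1 at [n] relative to spin 0 once the branches of its [q]
    children are summed out. *)
Definition branch_field (y : nat -> R) (n : nat) : R :=
  nu * \prod_(q * n + 2 <= c < q * n.+1 + 2) y c.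

(** With [x] the branch field, summing over the spins of [n] and of its parent edge gives [A + x B]
    or [B + x D] as the parent has spin 0 or 1, that is [A + x B] times the message [y n] raised to
    that spin. *)
Lemma bweight_peel n y tau : (0 < n)%N -> 0 <= branch_field y n -> A + branch_field y n * B != 0 ->
  y n = ratio A B D (branch_field y n) ->
  ssum (prefix n.+1 `\` prefix n)%fset (bweight n.+1 y) tau =
  (A + branch_field y n * B) * bweight n y tau.
Proof.
case: n => // n _; set x := branch_field y n.+1 => x0 den yn.
rewrite (prefixSD q_gt0 phi_inj phi_onto phi_adj).
(* The boundary of the larger prefix is the old one without [n.+1], followed by the [q] children of
   [n.+1]. *)
have nq : (n.+2 <= q * n.+1 + 2)%N by nia.
have nq' : (q * n.+1 + 2 <= q * n.+2 + 2)%N by nia.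
pose rest := (\prod_(0 <= i < n.+1) factor tau i) *
  \prod_(n.+2 <= c < q * n.+1 + 2) y c ^+ vspin tau (parent c).
pose p := vspin tau (parent n.+1).
pose Y := \prod_(q * n.+1 + 2 <= c < q * n.+2 + 2) y c.
pose g (a : 'I_2) (b : 'I_C.+1) : R :=
  rest * (nu ^+ a * lam b * (a + p + b <= C)%N%:R * Y ^+ a).
have bE omega : agree_off ([fset vsite n.+1] `|` [fset esite n])%fset omega tau ->
    bweight n.+2 y omega = g (vspin omega n.+1) (espin omega n).
  move=> off.
  have on : agree_on (prefix n.+1) omega tau.
    move=> z zP; apply: off; rewrite -(prefixSD q_gt0 phi_inj phi_onto phi_adj).
    by rewrite in_fsetD zP.
  rewrite /bweight big_nat_recr //= (prod_factor_depends on).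
  rewrite (big_cat_nat nq nq') /= (boundary_prod_eq _ _ (ltn0Sn n) (leqnn _) on).
  have -> : \prod_(q * n.+1 + 2 <= c < q * n.+2 + 2) y c ^+ vspin omega (parent c) =
      Y ^+ vspin omega n.+1.
    rewrite -prodrXl; apply: eq_big_nat => c /andP[c1 c2].
    have -> : c = (q * n.+1 + 2 + (c - (q * n.+1 + 2)))%N by lia.
    by rewrite parent_child //; lia.
  rewrite /g /rest /edge_ok.
  have -> : vspin omega (parent n.+1) = p.
    by rewrite /vspin on // vsite_prefix //; exact: parent_lt.
  by ring.
rewrite ssumU; last exact: vsite_esite_disjoint.
have s1 omega : agree_off [fset vsite n.+1]%fset omega tau ->
    ssum [fset esite n]%fset (bweight n.+2 y) omega = \sum_(b : 'I_C.+1) g (vspin omega n.+1) b.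
  move=> off; apply: (@ssum1 _ _ _ _ _ (esite n)) => t offt.
  rewrite bE.
    by rewrite {1}/vspin offt // in_fset1.
  exact: agree_offU offt off.
have -> : ssum [fset vsite n.+1]%fset (ssum [fset esite n]%fset (bweight n.+2 y)) tau =
    \sum_(a : 'I_2) \sum_(b : 'I_C.+1) g a b.
  by apply: (@ssum1 _ _ _ _ _ (vsite n.+1)); exact: s1.
have sb (a : 'I_2) : \sum_(b : 'I_C.+1) g a b = rest * (x ^+ a * Lambda lam (C - (a + p))).
  rewrite /g -mulr_sumr; congr (_ * _).
  rewrite -Lambda_sum; last by have := ltn_ord a; have := ltn_ord p; lia.
  rewrite mulr_sumr; apply: eq_bigr => b _.
  by rewrite /x /branch_field -/Y exprMn; ring.
rewrite (eq_bigr _ (fun a _ => sb a)) big_ord_recl big_ord1 /= expr0 expr1 mul1r add0n.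
have -> : bweight n.+1 y tau = rest * y n.+1 ^+ p.
  by rewrite /bweight (@big_ltn _ _ _ n.+1) // /rest /p; ring.
rewrite yn /ratio -mulrDr; have := ltn_ord p.
case: (p : nat) => [|[|]] // _; first by rewrite expr0 mulr1 subn0 mulrC.
by rewrite expr1; field.
Qed.

Lemma bweight_root y tau : ssum (prefix 1) (bweight 1 y) tau =
  1 + nu * \prod_(1 <= c < q + 2) y c.
Proof.
rewrite (prefix1 q_gt0 phi_inj phi_onto).
pose g (a : 'I_2) : R := nu ^+ a * (\prod_(1 <= c < q + 2) y c) ^+ a.
rewrite (@ssum1 _ _ _ _ _ (vsite 0) _ g) => [|omega _].
  by rewrite big_ord_recl big_ord1 /g /= !expr0 mulr1 !expr1.
rewrite /bweight big_nat1 /g /= -prodrXl muln1; congr (_ * _).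
apply: eq_big_nat => c /andP[c1 c2].
have : (parent c < 1)%N by rewrite parent_ltE // muln1.
by rewrite ltnS leqn0 => /eqP ->.
Qed.

End TreeWeights.

(** * Gibbs measures from messages *)

Section Existence.
Variables (R : realType) (q C : nat) (V : choiceType) (adj : rel V) (phi : nat -> V).
Hypotheses (q_gt0 : (0 < q)%N) (C_ge2 : (2 <= C)%N) (adj_sym : symmetric adj).
Hypotheses (phi_inj : injective phi) (phi_onto : forall x, exists n, phi n = x).
Hypothesis phi_adj : forall i j, adj (phi i) (phi j) = tree_adj q i j.
Variables (nu : R) (lam : 'I_C.+1 -> R).
Hypotheses (nu_gt0 : 0 < nu) (lam_ge0 : forall i, 0 <= lam i) (lam0_gt0 : 0 < lam ord0).
Local Notation A := (Lambda lam C).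
Local Notation B := (Lambda lam (C - 1)).
Local Notation D := (Lambda lam (C - 2)).
Local Notation parent := (parent q).
Local Notation site := (hatV adj).
Local Notation cfg := (config adj 1 C).
Local Notation wt := (wt C (unicast_weights nu) lam).
Local Notation norm_wt := (norm_wt C (unicast_weights nu) lam).
Local Notation prefix := (prefix phi_adj).
Local Notation bweight := (bweight phi_adj nu lam).
Local Notation branch_field := (branch_field q nu).
Implicit Types (tau omega : cfg) (U : {fset site}).

Lemma unicast_weights_ge0 (a : 'I_2) : 0 <= unicast_weights nu a.
Proof. by rewrite unicast_weightsE exprn_ge0 // ltW. Qed.

Lemma unicast_weights0_gt0 : 0 < unicast_weights nu ord0.
Proof. by rewrite unicast_weightsE. Qed.

Let bfin := tree_boundary_finite q_gt0 phi_inj phi_onto phi_adj.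
Let nu_ge0 := unicast_weights_ge0.
Let nu0_gt0 := unicast_weights0_gt0.

Lemma bweightE n (y : nat -> R) tau : bweight n y tau =
  wt (prefix n) tau * \prod_(n <= c < q * n + 2) y c ^+ vspin phi tau (parent c).
Proof. by rewrite (wt_prefix q_gt0 C_ge2 phi_inj phi_onto). Qed.

Lemma wt_sub0 U W tau : (U `<=` W)%fset -> wt U tau = 0 -> wt W tau = 0.
Proof.
move=> UW; rewrite !wtE; case: asboolP => [_ U0|nU _].
  by case: ifP => // _; rewrite (site_wtD _ _ _ UW) U0 mul0r.
case: asboolP => // fW; exfalso; apply: nU => e; apply: leq_trans (fW e).
rewrite /load -big_filter -[X in (_ <= X)%N]big_filter.
apply: (@leq_trans (\sum_(z <- [seq z <- [seq z <- W | z \in U] | edge_block e z]) tau z)%N).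
  rewrite (perm_big [seq z <- [seq z <- W | z \in U] | edge_block e z]) //.
  apply: uniq_perm; rewrite ?filter_uniq ?fset_uniq // => z.
  rewrite !mem_filter; congr (_ && _).
  by apply/idP/andP => [zU|[]//]; split=> //; exact: (fsubsetP UW).
rewrite -filter_predI big_filter big_filter [leqLHS]big_mkcond [leqRHS]big_mkcond /=.
by apply: leq_sum => z _; case: (edge_block e z); case: (z \in U).
Qed.

Lemma branch_field_gt0 (y : nat -> R) n : (forall c, 0 < y c) -> 0 < branch_field y n.
Proof. by move=> y0; rewrite mulr_gt0 // prodr_gt0. Qed.

(** When the messages solve the recursion, [bweight_peel] makes the normalised boundary weights
    consistent, so they extend to a measure. The DLR identities reduce to [wt_exchange], as the
    messages read only spins far from [U]. *)
Lemma Gibbs_of_messages (y : nat -> R) : (forall c, 0 < y c) ->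
  (forall n, (0 < n)%N -> y n = ratio A B D (branch_field y n)) ->
  exists mu : probability (config_space adj 1 C) R,
    is_Gibbs C (unicast_weights nu) lam mu /\
    forall tau, mu (Cyl (prefix 1) tau) =
      (bweight 1 y tau / (1 + nu * \prod_(1 <= c < q + 2) y c))%:E.
Proof.
move=> y0 yE; pose K n := A + branch_field y n * B.
have K0 n : 0 < K n.
  apply: addr_gt0; first exact: Lambda_gt0.
  by apply: mulr_gt0; [exact: branch_field_gt0|exact: Lambda_gt0].
pose z1 := 1 + nu * \prod_(1 <= c < q + 2) y c.
have z10 : 0 < z1 by rewrite addr_gt0 // mulr_gt0 // prodr_gt0.
(* The sum over the root times the constants released by peeling the vertices [1, ..., n - 1]. *)
pose Z n := z1 * \prod_(1 <= i < n) K i.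
have Z0 n : 0 < Z n by rewrite mulr_gt0 // prodr_gt0.
have Z1 : Z 1%N = z1 by rewrite /Z (@big_geq _ _ _ 1) // mulr1.
pose m n tau := if n is 0 then 1 else bweight n y tau / Z n.
have bw0 n tau : 0 <= bweight n y tau by apply: bweight_ge0 => // c; exact: ltW.
have m0 n tau : 0 <= m n tau.
  by case: n => // n; rewrite divr_ge0 // ltW.
have dm n : depends_on (prefix n) (m n).
  case: n => [//|n] s t st; congr (_ / _).
  by apply: bweight_depends st; rewrite ?q_gt0.
have mS n tau : m n tau = ssum (prefix n.+1 `\` prefix n)%fset (m n.+1) tau.
  transitivity (ssum (prefix n.+1 `\` prefix n)%fset (bweight n.+1 y) tau / Z n.+1); last first.
    by rewrite /ssum mulr_suml.
  case: n => [|n].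
    rewrite (prefix0 q_gt0 phi_inj phi_onto phi_adj) fsetD0.
    rewrite (bweight_root q_gt0 phi_inj phi_onto).
    by rewrite Z1 divff // gt_eqF.
  rewrite (bweight_peel q_gt0 C_ge2 phi_inj phi_onto) //.
  - rewrite -/(K n.+1) /m /Z [in RHS]big_nat_recr //=.
    have := Z0 n.+1; rewrite /Z; set p := \prod_(1 <= i < _) _ => /lt0r_neq0.
    rewrite mulf_eq0 negb_or => /andP[? ?]; have := K0 n.+1 => /lt0r_neq0 ?.
    by field; apply/and3P.
  - exact/ltW/branch_field_gt0.
  - by rewrite gt_eqF // -/(K n.+1).
  - exact: yE.
have cover (z : site) : exists n, z \in prefix n.
  have [n _ /(_ n (leqnn n)) /fsubsetP h] :=
    prefix_sup q_gt0 phi_inj phi_onto phi_adj [fset z]%fset.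
  by exists n; apply: h; rewrite in_fset1.
have [mu muE] := consistent_extension (prefix0 q_gt0 phi_inj phi_onto phi_adj)
  (fun n => prefix_le q_gt0 phi_inj phi_onto phi_adj (leqnSn n)) cover dm m0 (fun=> erefl) mS.
exists mu; split; last first.
  by move=> tau; rewrite muE /m Z1.
have prm n tau : pr mu (Cyl (prefix n) tau) = m n tau.
  by rewrite /pr muE.
apply: (DLR_Gibbs bfin nu_ge0 lam_ge0 nu0_gt0 lam0_gt0 (P := prefix)).
  by move=> U; exact: prefix_sup.
move=> U; have [k _ hk] := prefix_sup q_gt0 phi_inj phi_onto phi_adj U.
have [l _ hl] := prefix_sup q_gt0 phi_inj phi_onto phi_adj (hat_closure U).
(* Beyond [q * k.+1 + 2], boundary vertices have parents numbered above [k], hence outside [U], and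
   the product of messages is the same for all fillings of [U]; beyond [l] the prefix contains the
   closure of [U]. *)
exists (maxn (q * k.+1 + 2) l) => // n /=; rewrite geq_max => /andP[kn ln] tau.
have n0 : (0 < n)%N by apply: leq_trans kn; rewrite addn2.
have Un : (U `<=` prefix n)%fset by apply: fsubset_trans (hl _ ln); exact: fsubsetUl.
have mE omega : m n omega = bweight n y omega / Z n by case: n n0 {kn ln Un}.
have UP : (U `|` (prefix n `\` U) = prefix n)%fset.
  apply/fsetP => z; rewrite in_fsetU in_fsetD.
  by have [/(fsubsetP Un)->|] := boolP (z \in U).
have sumU : pr mu (Cyl (prefix n `\` U)%fset tau) = ssum U (m n) tau.
  rewrite (pr_Cyl_ssum _ tau (U := U)); last first.
    by apply/fdisjointP => z zU; rewrite in_fsetD zU.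
  by apply: eq_bigr => u _; rewrite UP prm.
have exch omega : agree_off U omega tau ->
    wt (hat_closure U) omega * m n tau = wt (hat_closure U) tau * m n omega.
  move=> off; rewrite !mE !bweightE.
  have -> : \prod_(n <= c < q * n + 2) y c ^+ vspin phi omega (parent c) =
      \prod_(n <= c < q * n + 2) y c ^+ vspin phi tau (parent c).
    apply: eq_big_nat => c /andP[nc _]; rewrite /vspin off //.
    apply/negP => /(fsubsetP (hk k.+1 (leqnSn k))).
    rewrite vsite_prefix // parent_ltE // ltnNge => /negP; apply.
    exact: leq_trans nc.
  have := wt_exchange C (unicast_weights nu) lam adj_sym bfin (hl _ ln) off.
  by move=> E; rewrite !mulrA [wt (hat_closure U) omega * _]mulrC -E; ring.
rewrite sumU prm; split.
  rewrite -ssumMl norm_wtE mulrC -ssumMl; apply: ssum_ext => omega off.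
  by rewrite mulrC exch.
move=> N0; rewrite /ssum big1 // => u _.
have /eqP := N0; rewrite psumr_eq0 => [/allP/(_ u (mem_index_enum _))/eqP w0|u' _]; last first.
  exact: wt_ge0.
by rewrite mE bweightE (wt_sub0 (hl _ ln) w0) !mul0r.
Qed.

End Existence.

Section TwoCycle.
Variables (R : realType) (q C : nat) (V : choiceType) (adj : rel V) (phi : nat -> V).
Hypotheses (q_gt0 : (0 < q)%N) (C_ge2 : (2 <= C)%N).
Hypotheses (phi_inj : injective phi) (phi_onto : forall x, exists n, phi n = x).
Hypothesis phi_adj : forall i j, adj (phi i) (phi j) = tree_adj q i j.
Variables (nu : R) (lam : 'I_C.+1 -> R).
Hypotheses (nu_gt0 : 0 < nu) (lam_ge0 : forall i, 0 <= lam i) (lam0_gt0 : 0 < lam ord0).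
Hypothesis adj_sym : symmetric adj.
Local Notation A := (Lambda lam C).
Local Notation B := (Lambda lam (C - 1)).
Local Notation D := (Lambda lam (C - 2)).
Local Notation G := (tree_rec A B D nu q).
Local Notation parent := (parent q).
Local Notation prefix := (prefix phi_adj).

Lemma tree_parity : exists f : nat -> bool, forall n, (0 < n)%N -> f n = ~~ f (parent n).
Proof.
have [f fE] := prefix_recursion (fun s => ~~ nth false s (parent (size s))).
exists f => n n0; rewrite fE size_mkseq nth_mkseq //; exact: parent_lt.
Qed.

(** The two measures assign [l] and [u] to the generations in opposite ways. They differ in the
    probability of spin 0 at the root, [1 / (1 + nu v^(q+1))] with [v = u] for one and [v = l] for
    the other. *)
Lemma multiple_Gibbs_of_two_cycle l u : 0 < l -> l < u -> G l = u -> G u = l ->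
  multiple_Gibbs adj C (unicast_weights nu) lam.
Proof.
move=> l0 lu Gl Gu; have u0 : 0 < u by exact: lt_trans lu.
have [f fP] := tree_parity.
pose y b c := if f c == b then l else u.
have y0 b c : 0 < y b c by rewrite /y; case: ifP.
have yp b c : (0 < c)%N -> y b c = if f (parent c) == b then u else l.
  by move=> c0; rewrite /y fP //; case: (f _); case: b.
have yE b n : (0 < n)%N -> y b n = ratio A B D (branch_field q nu (y b) n).
  move=> n0; have -> : branch_field q nu (y b) n = nu * (if f n == b then u else l) ^+ q.
    rewrite /branch_field; congr (_ * _).
    rewrite (eq_big_nat _ _ (F2 := fun=> if f n == b then u else l)) => [|c /andP[c1 c2]].
      by rewrite prodr_const_nat; congr (_ ^+ _); lia.
    rewrite yp ?(leq_trans _ c1) ?addn2 //.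
    have -> : c = (q * n + 2 + (c - (q * n + 2)))%N by lia.
    by rewrite parent_child //; lia.
  by rewrite -[RHS]/(G _) /y; case: ifP; rewrite ?Gl ?Gu.
have root b : \prod_(1 <= c < q + 2) y b c = (if f 0%N == b then u else l) ^+ q.+1.
  rewrite (eq_big_nat _ _ (F2 := fun=> if f 0%N == b then u else l)) => [|c /andP[c1 c2]].
    by rewrite prodr_const_nat; congr (_ ^+ _); lia.
  rewrite yp //; have -> : parent c = 0%N; last by [].
  by apply/eqP; rewrite -leqn0 -ltnS parent_ltE //; lia.
have ex b := Gibbs_of_messages q_gt0 C_ge2 adj_sym phi_inj phi_onto phi_adj
  nu_gt0 lam_ge0 lam0_gt0 (y0 b) (yE b).
have [mu1 [G1 m1]] := ex (f 0%N); have [mu2 [G2 m2]] := ex (~~ f 0%N).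
exists mu1, mu2; split=> //.
pose tau : config adj 1 C := fun=> ord0.
exists (Cyl (prefix 1) tau); first exact: measurable_CylT.
have bw b : bweight phi_adj nu lam 1 (y b) tau = 1.
  by rewrite /bweight big_nat1 /= expr0 mul1r big1 // => c _; rewrite expr0.
apply/eqP.
rewrite m1 m2 !bw !root eqxx.
rewrite (_ : (f 0%N == ~~ f 0%N) = false); last by case: (f 0%N).
move=> [] /mulfI; rewrite oner_eq0 => /(_ isT)/invr_inj/addrI/(mulfI (lt0r_neq0 nu_gt0)) E.
have : l ^+ q.+1 < u ^+ q.+1 by rewrite ltr_pXn2r // nnegrE ltW.
by rewrite E ltxx.
Qed.

End TwoCycle.

(** * Convergence of messages and uniqueness *)

Lemma le_of_le_expr_mul (R : realType) (a b : R) (n : nat) :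
  (forall rho, 1 < rho -> a <= rho ^+ n * b) -> a <= b.
Proof.
move=> h; rewrite leNgt; apply/negP => ba.
have c : {for (1 : R), continuous (fun rho : R => rho ^+ n * b)}.
  by apply: cvgM; [exact: exprn_continuous|exact: cvg_cst].
have : 1 ^+ n * b < a by rewrite expr1n mul1r.
move=> /(cvgr_lt _ c) /nbhs_ballP[e /= e0 he].
have e1 : 1 < 1 + e / 2 by rewrite ltrDl divr_gt0.
have := he (1 + e / 2); rewrite /ball /= opprD addrA subrr sub0r normrN.
rewrite gtr0_norm ?divr_gt0 // ltr_pdivrMr // ltr_pMr // ltr1n => /(_ isT).
by rewrite ltNge h.
Qed.

Section Uniqueness.
Variables (R : realType) (q C : nat) (V : choiceType) (adj : rel V) (phi : nat -> V).
Hypotheses (q_ge2 : (2 <= q)%N) (C_ge2 : (2 <= C)%N).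
Hypotheses (phi_inj : injective phi) (phi_onto : forall x, exists n, phi n = x).
Hypothesis phi_adj : forall i j, adj (phi i) (phi j) = tree_adj q i j.
Variables (nu : R) (lam : 'I_C.+1 -> R).
Hypotheses (nu_gt0 : 0 < nu) (lam_ge0 : forall i, 0 <= lam i) (lam0_gt0 : 0 < lam ord0).
Local Notation A := (Lambda lam C).
Local Notation B := (Lambda lam (C - 1)).
Local Notation D := (Lambda lam (C - 2)).
Local Notation G := (tree_rec A B D nu q).
Local Notation box := (box A B D nu q).
Local Notation parent := (parent q).
Local Notation site := (hatV adj).
Local Notation cfg := (config adj 1 C).
Local Notation wt := (wt C (unicast_weights nu) lam).
Local Notation norm_wt := (norm_wt C (unicast_weights nu) lam).
Local Notation prefix := (prefix phi_adj).
Local Notation bweight := (bweight phi_adj nu lam).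
Local Notation branch_field := (branch_field q nu).
Hypothesis AD_lt : A * D < B ^+ 2.
Implicit Types (tau omega : cfg) (U : {fset site}) (y : nat -> R).

Let D0 : 0 < D. Proof. exact: Lambda_gt0. Qed.
Let DB : D <= B. Proof. by apply: Lambda_le => //; rewrite leq_sub2l. Qed.
Let BA : B <= A. Proof. by apply: Lambda_le => //; rewrite leq_subr. Qed.
Let B0 : 0 < B. Proof. exact: Lambda_gt0. Qed.
Let q_gt0 : (0 < q)%N. Proof. exact: ltnW. Qed.
Let bfin := tree_boundary_finite q_gt0 phi_inj phi_onto phi_adj.
Let nu_ge0 := unicast_weights_ge0 nu_gt0.
Let nu0_gt0 := unicast_weights0_gt0 nu.

Lemma branch_field_ge0 y n : (forall c, 0 <= y c) -> 0 <= branch_field y n.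
Proof. by move=> y0; rewrite mulr_ge0 ?(ltW nu_gt0) // prodr_ge0. Qed.

Lemma eq_branch_field y y' n : (forall c, (n < c)%N -> y c = y' c) ->
  branch_field y n = branch_field y' n.
Proof.
move=> h; congr (_ * _); apply: eq_big_nat => c /andP[c1 _]; apply: h.
by apply: leq_trans c1; nia.
Qed.

(* [y] carries the messages sent towards the root when those of the vertices
   numbered from [N] on are prescribed. *)
Definition messages N y :=
  (forall c, 0 <= y c <= 1) /\ forall c, (c < N)%N -> y c = ratio A B D (branch_field y c).

(** Children have larger numbers, so the messages are computed from [N - 1] down to 0, each new one
    leaving the later fields unchanged. *)
Lemma messages_exist N y0 : (forall c, 0 <= y0 c <= 1) ->
  exists2 y, messages N y & forall c, (N <= c)%N -> y c = y0 c.
Proof.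
move=> y01.
suff H k : (k <= N)%N -> exists y, [/\ forall c, 0 <= y c <= 1,
    forall c, (N <= c)%N -> y c = y0 c &
    forall c, (N - k <= c < N)%N -> y c = ratio A B D (branch_field y c)].
  have [y [h1 h2 h3]] := H N (leqnn N); exists y => //; split=> // c cN.
  by apply: h3; rewrite subnn.
elim: k => [_|k IH kN].
  exists y0; split=> // c; rewrite subn0 => /andP[h1 h2].
  by move: (leq_ltn_trans h1 h2); rewrite ltnn.
have [y [h1 h2 h3]] := IH (ltnW kN); pose n := (N - k.+1)%N.
have nN : (n < N)%N by rewrite /n; lia.
pose y' c := if c == n then ratio A B D (branch_field y n) else y c.
have E c : (n <= c)%N -> branch_field y' c = branch_field y c.
  move=> nc; apply: eq_branch_field => d cd; rewrite /y' gtn_eqF //.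
  exact: leq_ltn_trans cd.
exists y'; split=> c.
- rewrite /y'; case: ifP => // _.
  have b0 : 0 <= branch_field y n by apply: branch_field_ge0 => d; have /andP[] := h1 d.
  by rewrite (ltW (ratio_gt0 _ _ _ b0)) // ratio_le1.
- by move=> Nc; rewrite /y' gtn_eqF ?h2 //; exact: leq_trans Nc.
move=> /andP[nc cN]; rewrite E // /y'; have [->//|cn] := eqVneq c n.
by apply: h3; rewrite cN andbT; move: nc cn; rewrite /n; lia.
Qed.

(** Children of vertices below [k] are numbered below [q * k + 2]. Iterating [r] times leaves room
    below [N] for [r] generations, each of which applies the decreasing recursion once. *)
Lemma messages_box N y r k : messages N y ->
  (iter r (fun k => q * k + 2)%N k <= N)%N ->
  forall c, (c < k)%N -> (box r).1 <= y c <= (box r).2.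
Proof.
move=> [y01 yE]; elim: r k => [|r IH] k kN c ck; first exact: y01.
rewrite iterSr in kN; have {}IH := IH _ kN.
have cN : (c < N)%N.
  apply: leq_trans kN; elim: (r) {IH} => [|s IHs] /=; first by nia.
  by nia.
have [l0 lu _] := box_bounds D0 DB BA AD_lt nu_gt0 q_ge2 r.
have yb d : (q * c + 2 <= d < q * c.+1 + 2)%N -> (box r).1 <= y d <= (box r).2.
  by move=> /andP[_ d2]; apply: IH; apply: leq_trans d2 _; nia.
have cst (a : R) : \prod_(q * c + 2 <= d < q * c.+1 + 2) a = a ^+ q.
  by rewrite prodr_const_nat; congr (_ ^+ _); lia.
have lo : nu * (box r).1 ^+ q <= branch_field y c.
  rewrite ler_pM2l // -cst [leLHS]big_seq [leRHS]big_seq; apply: ler_prod => d.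
  by rewrite mem_index_iota => /yb/andP[-> _]; rewrite l0.
have hi : branch_field y c <= nu * (box r).2 ^+ q.
  rewrite ler_pM2l // -cst [leLHS]big_seq [leRHS]big_seq; apply: ler_prod => d.
  by rewrite mem_index_iota => /yb/andP[h1 ->]; rewrite (le_trans l0 h1).
have anti x z : 0 <= x -> x <= z -> ratio A B D z <= ratio A B D x.
  move=> x0; rewrite le_eqVlt => /predU1P[->//|xz]; exact/ltW/ratio_lt.
have lq : 0 <= nu * (box r).1 ^+ q by rewrite mulr_ge0 ?exprn_ge0 // ltW.
by rewrite yE //= /tree_rec !anti // (le_trans lq).
Qed.

Lemma bweight_marginal N y n : messages N y -> (0 < n)%N -> (n <= N)%N ->
  exists2 K, 0 < K & forall tau, ssum (prefix N `\` prefix n)%fset (bweight N y) tau =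
    K * bweight n y tau.
Proof.
move=> [y01 yE] + nN; have y0 c : 0 <= y c by have /andP[] := y01 c.
rewrite -(subKn nN); move: (N - n)%N (leq_subr n N) => {n nN} k.
elim: k => [_ _|k IH kN k0].
  by exists 1 => // tau; rewrite subn0 fsetDv ssum0 mul1r.
have [K K0 KE] := IH (ltnW kN) (leq_trans k0 (leq_sub2l _ (leqnSn k))).
move: k0 KE; rewrite (_ : (N - k)%N = (N - k.+1).+1); last by lia.
set n := (N - k.+1)%N => k0 KE; have nN : (n < N)%N by rewrite /n; lia.
have b0 := branch_field_ge0 n y0.
have d0 : 0 < A + branch_field y n * B by exact: (ratio_den_gt0 D0 DB BA).
exists (K * (A + branch_field y n * B)) => [|tau]; first exact: mulr_gt0.
have -> : (prefix N `\` prefix n = (prefix n.+1 `\` prefix n) `|` (prefix N `\` prefix n.+1))%fset.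
  apply/fsetP => z; rewrite in_fsetU !in_fsetD.
  have := fsubsetP (prefix_le q_gt0 phi_inj phi_onto phi_adj (leqnSn n)) z.
  have := fsubsetP (prefix_le q_gt0 phi_inj phi_onto phi_adj nN) z.
  case: (z \in prefix n) => /=; case: (z \in prefix n.+1) => /=;
    case: (z \in prefix N) => //= h1 h2;
    first [by have := h1 isT | by have := h2 isT].
rewrite ssumU; last first.
  by apply/fdisjointP => z; rewrite !in_fsetD => /andP[_ ->].
rewrite (ssum_ext (g := fun omega => K * bweight n.+1 y omega)); last by move=> omega _.
rewrite ssumMl (bweight_peel q_gt0 C_ge2 phi_inj phi_onto) ?mulrA ?gt_eqF //.
exact: yE.
Qed.

(** With the outside frozen, an outer vertex and its edge only tell whether its parent may still
    have spin 1. This is a message 0 or 1, and all that does not depend on the inside goes into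
    [K]. *)
Lemma wt_outside N tau : (0 < N)%N -> exists K y, [/\ forall c, 0 <= y c <= 1 &
  forall omega, agree_off (prefix N) omega tau ->
    wt (prefix (q * N + 2)) omega = K * bweight N y omega].
Proof.
move=> N0; have NM : (N <= q * N + 2)%N by nia.
pose load c : nat := (vspin phi tau c + espin phi_adj tau c.-1)%N.
(* If [load c] exceeds [C] then [K = 0] and the value 1 is a default keeping [y c] in [[0, 1]]. *)
pose y c : R := if (load c <= C)%N then (load c < C)%N%:R else 1.
pose K := \prod_(N <= c < q * N + 2)
  (nu ^+ vspin phi tau c * lam (espin phi_adj tau c.-1) * (load c <= C)%N%:R).
exists K, y; split=> [c|omega off].
  by rewrite /y; case: ifP => _; [case: (_ < _)%N|]; rewrite ?lexx ?ler01.
rewrite (wt_prefix q_gt0 C_ge2 phi_inj phi_onto) (big_cat_nat (leq0n N) NM) /=.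
rewrite /bweight mulrCA; congr (_ * _); rewrite -big_split /=.
apply: eq_big_nat => -[|c] /andP[c1 c2]; first by move: c1; rewrite leqNgt N0.
have vE : vspin phi omega c.+1 = vspin phi tau c.+1.
  by rewrite /vspin off // vsite_prefix // -leqNgt.
have eE : espin phi_adj omega c = espin phi_adj tau c.
  by rewrite /espin off // esite_prefix // -leqNgt.
rewrite /factor /edge_ok vE eE /y /load /=.
have := ltn_ord (vspin phi omega (parent c.+1)).
case: (vspin phi omega (parent c.+1) : nat) => [|[|]] // _.
  by rewrite addn0 expr0 mulr1.
rewrite expr1 addn1 addSn; case: ifP => h; first by rewrite mulr1.
by rewrite mulr1 leqNgt ltnS ltnW ?mulr0 // ltnNge h.
Qed.

Variable mu : probability (config_space adj 1 C) R.
Hypothesis mu_Gibbs : is_Gibbs C (unicast_weights nu) lam mu.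

Local Notation outer N := (prefix (q * N + 2) `\` prefix N)%fset.

(** The DLR equation for [prefix N], whose closure is [prefix (q * N + 2)], summed over the sites
    between the two prefixes: given the outer layer, the law on [prefix n] is proportional to a
    boundary weight. Only the messages [y] remember the layer. *)
Lemma Gibbs_messages N n tau : (0 < n)%N -> (n <= N)%N -> exists2 y, messages N y &
  ssum (prefix n) (bweight n y) tau * pr mu (Cyl (outer N `|` prefix n)%fset tau) =
  bweight n y tau * pr mu (Cyl (outer N) tau).
Proof.
move=> n0 nN; have N0 := leq_trans n0 nN; have NM : (N <= q * N + 2)%N by nia.
have [K [y1 [y01 KE]]] := wt_outside tau N0.
have [y my yy] := messages_exist N y01; exists y => //.
have {}KE omega : agree_off (prefix N) omega tau ->
    wt (prefix (q * N + 2)) omega = K * bweight N y omega.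
  move=> /KE ->; congr (_ * (_ * _)); apply: eq_big_nat => c /andP[c1 _].
  by rewrite yy.
have [K' K'0 K'E] := bweight_marginal my n0 nN.
have clo := closure_prefix q_gt0 phi_inj phi_onto phi_adj N0.
have nNs := prefix_le q_gt0 phi_inj phi_onto phi_adj nN.
have nonempty : prefix N != fset0.
  by apply/fset0Pn; exists (vsite adj phi 0); rewrite vsite_prefix.
have split_N : (prefix N = prefix n `|` (prefix N `\` prefix n))%fset.
  apply/fsetP => z; rewrite in_fsetU in_fsetD.
  by have [/(fsubsetP nNs)->|] := boolP (z \in prefix n).
have ssumN f : ssum (prefix N) f tau =
    ssum (prefix n) (ssum (prefix N `\` prefix n)%fset f) tau.
  rewrite -ssumU -?split_N //.
  by apply/fdisjointP => z zn; rewrite in_fsetD zn.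
have norm_eq : norm_wt (prefix N) tau = K * K' * ssum (prefix n) (bweight n y) tau.
  rewrite norm_wtE clo.
  rewrite (ssum_ext (g := fun omega => K * bweight N y omega)); last exact: KE.
  rewrite ssumMl -mulrA ssumN; congr (_ * _).
  by rewrite (ssum_ext (g := fun omega => K' * bweight n y omega)) ?ssumMl.
(* An impossible outer layer has probability zero, and both sides vanish. *)
have [N0'|N0'] := eqVneq (norm_wt (prefix N) tau) 0.
  have p0 : pr mu (Cyl (outer N) tau) = 0.
    apply: (Gibbs_norm_wt0 bfin nu_ge0 lam_ge0 nu0_gt0 lam0_gt0 mu_Gibbs nonempty) N0'.
    by rewrite clo fsubset_refl.
  have -> : pr mu (Cyl (outer N `|` prefix n)%fset tau) = 0.
    apply/eqP; rewrite eq_le pr_ge0 andbT -p0; apply: pr_le; try exact: measurable_CylT.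
    by move=> s h; apply: agree_onS h; exact: fsubsetUl.
  by rewrite p0 !mulr0.
have KK0 : K * K' != 0 by apply: contra_neq N0' => E; rewrite norm_eq E mul0r.
apply: (mulfI KK0); rewrite mulrA -norm_eq.
have dis : [disjoint prefix N `\` prefix n & outer N `|` prefix n]%fset.
  apply/fdisjointP => z; rewrite in_fsetU !in_fsetD => /andP[/negPf-> ->].
  by [].
have full : ((prefix N `\` prefix n) `|` (outer N `|` prefix n) = prefix (q * N + 2))%fset.
  apply/fsetP => z; rewrite !in_fsetU !in_fsetD.
  have h1 := fsubsetP nNs z.
  have h2 := fsubsetP (prefix_le q_gt0 phi_inj phi_onto phi_adj NM) z.
  by move: h1 h2; case: (z \in prefix n) => /=; case: (z \in prefix N) => /=;
    case: (z \in prefix (q * N + 2)) => //= h1 h2;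
    first [by have := h1 isT | by have := h2 isT].
rewrite (pr_Cyl_ssum _ _ dis) full -ssumMl.
rewrite (ssum_ext (g := fun omega => K * pr mu (Cyl (outer N) tau) * bweight N y omega)).
  by rewrite ssumMl K'E; ring.
move=> omega off; have offN : agree_off (prefix N) omega tau.
  by move=> z zN; apply: off; rewrite in_fsetD negb_and zN orbT.
have oN : agree_on (outer N) omega tau.
  by move=> z; rewrite in_fsetD => /andP[/offN].
have cloS : (hat_closure (prefix N) `<=` prefix (q * N + 2))%fset by rewrite clo fsubset_refl.
have <- : norm_wt (prefix N) omega = norm_wt (prefix N) tau.
  by apply: (norm_wt_Cyl _ _ _ bfin cloS); exact: oN.
rewrite (Gibbs_closure bfin nu_ge0 lam_ge0 nu0_gt0 lam0_gt0 omega mu_Gibbs nonempty cloS).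
by rewrite clo KE // (Cyl_eq oN); ring.
Qed.

End Uniqueness.

(** Replacing the messages in the normalisation and in the weight costs a factor [a] each. *)
Lemma two_sided_transfer (R : realDomainType) (a Z Z' b b' P P' : R) :
  0 <= a -> 0 <= P -> 0 <= P' -> Z * P = b * P' ->
  Z <= a * Z' -> Z' <= a * Z -> b <= a * b' -> b' <= a * b ->
  Z' * P <= a * a * (b' * P') /\ b' * P' <= a * a * (Z' * P).
Proof.
move=> a0 P0 P'0 E h1 h2 h3 h4; split.
  apply: (le_trans (ler_wpM2r P0 h2)); rewrite -!mulrA E ler_wpM2l //.
  by rewrite mulrA; exact: ler_wpM2r.
apply: (le_trans (ler_wpM2r P'0 h4)); rewrite -!mulrA -E ler_wpM2l //.
by rewrite mulrA; exact: ler_wpM2r.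
Qed.

Section UniqueMarginal.
Variables (R : realType) (q C : nat) (V : choiceType) (adj : rel V) (phi : nat -> V).
Hypotheses (q_ge2 : (2 <= q)%N) (C_ge2 : (2 <= C)%N).
Hypotheses (phi_inj : injective phi) (phi_onto : forall x, exists n, phi n = x).
Hypothesis phi_adj : forall i j, adj (phi i) (phi j) = tree_adj q i j.
Variables (nu : R) (lam : 'I_C.+1 -> R).
Hypotheses (nu_gt0 : 0 < nu) (lam_ge0 : forall i, 0 <= lam i) (lam0_gt0 : 0 < lam ord0).
Local Notation A := (Lambda lam C).
Local Notation B := (Lambda lam (C - 1)).
Local Notation D := (Lambda lam (C - 2)).
Local Notation G := (tree_rec A B D nu q).
Local Notation box := (box A B D nu q).
Local Notation site := (hatV adj).
Local Notation cfg := (config adj 1 C).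
Local Notation prefix := (prefix phi_adj).
Local Notation bweight := (bweight phi_adj nu lam).
Hypothesis AD_lt : A * D < B ^+ 2.
Implicit Types (tau omega : cfg) (U : {fset site}) (y : nat -> R).

Let D0 : 0 < D. Proof. exact: Lambda_gt0. Qed.
Let DB : D <= B. Proof. by apply: Lambda_le => //; rewrite leq_sub2l. Qed.
Let BA : B <= A. Proof. by apply: Lambda_le => //; rewrite leq_subr. Qed.
Let q_gt0 : (0 < q)%N. Proof. exact: ltnW. Qed.

Lemma bweight_le n y y' rho tau : 1 <= rho ->
  (forall c, (n <= c < q * n + 2)%N -> 0 <= y c <= rho * y' c) ->
  bweight n y tau <= rho ^+ (q * n + 2 - n) * bweight n y' tau.
Proof.
move=> rho1 h; rewrite /bweight mulrCA ler_wpM2l //.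
  by apply: prodr_ge0 => i _; exact: factor_ge0.
rewrite -prodr_const_nat -big_split /= big_seq [leRHS]big_seq.
apply: ler_prod => c; rewrite mem_index_iota => /h/andP[y0 yy].
rewrite exprn_ge0 //=; have := ltn_ord (vspin phi tau (parent q c)).
by case: (vspin _ _ _ : nat) => [|[|]] // _; rewrite ?expr0 ?mulr1 ?expr1.
Qed.

Variables (ys : R) (ys_gt0 : 0 < ys) (ysE : G ys = ys).
Hypothesis slope_ge0 : 0 <= slope_form A B D q (nu * ys ^+ q).

Variable mu : probability (config_space adj 1 C) R.
Hypothesis mu_Gibbs : is_Gibbs C (unicast_weights nu) lam mu.

(** For every [rho > 1], deep enough messages agree with the fixed point [ys] up to a factor [rho],
    whatever the outer layer. Each boundary weight then changes by at most [rho^E], with [E] the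
    number of boundary vertices of [prefix n]; summing over the layer and letting [rho] tend to 1
    gives equality. *)
Lemma Gibbs_marginal n tau : (0 < n)%N ->
  ssum (prefix n) (bweight n (fun=> ys)) tau * pr mu (Cyl (prefix n) tau) =
  bweight n (fun=> ys) tau.
Proof.
move=> n0; pose E := (q * n + 2 - n)%N; pose bs := bweight n (fun=> ys).
pose Zs := ssum (prefix n) bs tau; pose p := pr mu (Cyl (prefix n) tau).
have bw0 y (y0 : forall c, 0 <= y c) omega : 0 <= bweight n y omega.
  exact: bweight_ge0.
have key rho : 1 < rho -> Zs * p <= rho ^+ (E + E) * bs tau /\
    bs tau <= rho ^+ (E + E) * (Zs * p).
  move=> rho1; have [r [l0 lu]] := box_ratio D0 DB BA AD_lt nu_gt0 q_ge2 ys_gt0 ysE slope_ge0 rho1.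
  have rho0 : 0 < rho by exact: lt_trans rho1.
  have rE : 0 <= rho ^+ E by rewrite exprn_ge0 // ltW.
  (* The iteration starts at [q * n + 2] so that the boundary vertices of [prefix n] themselves have
     [r] generations below them. *)
  pose N := iter r (fun k => q * k + 2)%N (q * n + 2)%N.
  have nN : (n <= N)%N.
    by rewrite /N; elim: (r) => [|s IHs] /=; nia.
  pose O := (prefix (q * N + 2) `\` prefix N)%fset.
  have /andP[ls su] := box_fixpoint D0 DB BA AD_lt nu_gt0 q_ge2 r (ltW ys_gt0) ysE.
  have local omega : Zs * pr mu (Cyl (O `|` prefix n)%fset omega) <=
        rho ^+ (E + E) * (bs omega * pr mu (Cyl O omega)) /\
      bs omega * pr mu (Cyl O omega) <=
        rho ^+ (E + E) * (Zs * pr mu (Cyl (O `|` prefix n)%fset omega)).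
    have [y my yE] := Gibbs_messages q_ge2 C_ge2 phi_inj phi_onto phi_adj nu_gt0 lam_ge0 lam0_gt0 AD_lt
      mu_Gibbs omega n0 nN.
    have y0 c : 0 <= y c by have [/(_ c)/andP[]] := my.
    have yb := messages_box q_ge2 C_ge2 nu_gt0 lam_ge0 lam0_gt0 AD_lt my (leqnn N).
    have b1 t : bweight n y t <= rho ^+ E * bs t.
      apply: bweight_le; first exact: ltW.
      move=> c /andP[_ /yb/andP[h1 h2]]; rewrite y0 (le_trans h2) // (le_trans lu) //.
      by rewrite ler_pM2l.
    have b2 t : bs t <= rho ^+ E * bweight n y t.
      apply: bweight_le; first exact: ltW.
      move=> c /andP[_ /yb/andP[h1 h2]]; rewrite (ltW ys_gt0) (le_trans su) // (le_trans lu) //.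
      by rewrite ler_pM2l.
    pose Zy := ssum (prefix n) (bweight n y) omega.
    have ZsE : Zs = ssum (prefix n) bs omega.
      rewrite /Zs /ssum; apply: eq_bigr => u _; apply: bweight_depends => //.
      exact: glue_agree.
    have Z1 : Zy <= rho ^+ E * Zs by rewrite ZsE -ssumMl; apply: ssum_le => t _.
    have Z2 : Zs <= rho ^+ E * Zy by rewrite ZsE -ssumMl; apply: ssum_le => t _.
    move: yE; rewrite -/Zy -/O; set P := pr mu _; set P' := pr mu _ => yE.
    have P0 : 0 <= P by exact: pr_ge0.
    have P'0 : 0 <= P' by exact: pr_ge0.
    by rewrite exprD; apply: (two_sided_transfer rE P0 P'0 yE).
  have dis : [disjoint O & prefix n]%fset.
    apply/fdisjointP => z; rewrite in_fsetD => /andP[zN _].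
    by apply: contra zN; exact: (fsubsetP (prefix_le q_gt0 phi_inj phi_onto phi_adj nN)).
  have pE : p = ssum O (fun omega => pr mu (Cyl (O `|` prefix n)%fset omega)) tau.
    by rewrite /p (pr_Cyl_ssum _ _ dis).
  have bE : bs tau = ssum O (fun omega => bs omega * pr mu (Cyl O omega)) tau.
    rewrite (ssum_ext (g := fun omega => bs tau * pr mu (Cyl O omega))) => [|omega off].
      rewrite ssumMl.
      have := @pr_Cyl_ssum _ _ _ _ _ mu O fset0 tau (fdisjointX0 _).
      rewrite fsetU0 => <-; rewrite (_ : Cyl fset0 tau = setT).
        by rewrite /pr probability_setT mulr1.
      by apply/seteqP; split=> // t _ z; rewrite in_fset0.
    congr (_ * _); apply: bweight_depends => // z zn; apply: off.
    by apply/negP => zO; move/fdisjointP: dis => /(_ z zO); rewrite zn.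
  split.
    by rewrite pE bE -!ssumMl; apply: ssum_le => omega _; have [] := local omega.
  by rewrite pE [X in X <= _]bE -!ssumMl; apply: ssum_le => omega _; have [] := local omega.
apply/eqP; rewrite eq_le; apply/andP; split.
  by apply: (le_of_le_expr_mul (n := E + E)) => rho /key[].
by apply: (le_of_le_expr_mul (n := E + E)) => rho /key[].
Qed.

End UniqueMarginal.

(** * Measures determined by their cylinders, and the equivalence *)

Lemma cylinders_determine (R : realType) (V : choiceType) (adj : rel V) (CV CE : nat)
    (P : nat -> {fset hatV adj}) (mu1 mu2 : probability (config_space adj CV CE) R) :
  (forall U, \forall n \near \oo, (U `<=` P n)%fset) ->
  (forall n tau, (0 < n)%N -> pr mu1 (Cyl (P n) tau) = pr mu2 (Cyl (P n) tau)) ->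
  forall X : set (config_space adj CV CE), measurable X -> mu1 X = mu2 X.
Proof.
move=> Pcover E X mX.
pose Q := [set X : set (config_space adj CV CE) | mu1 X = mu2 X].
pose Gen := [set X : set (config_space adj CV CE) |
  exists2 W : {fset hatV adj}, [set` W] `<=` setT & depends_on W X].
suff : Q X by [].
apply: (@dynkin_induction _ (config_space adj CV CE) Gen Q) => //.
- exact: space_generated.
- exact: space_setI_closed.
- by rewrite /Q /= !probability_setT.
- move=> Y [W _ dY] /=; have [n _ /(_ n.+1 (leqnSn n)) Wn] := Pcover W.
  have [F [tF -> FX]] := depends_bigcup (depends_onS Wn dY).
  have mF k : measurable (F k : set (config_space adj CV CE)).
    by have [->|[t _ ->]] := FX k; [exact: measurable0|exact: measurable_CylT].
  rewrite /Q /= !measure_semi_bigcup //; try exact: bigcup_measurable.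
  apply: eq_eseriesr => k _; have [->|[t _ ->]] := FX k; first by rewrite !measure0.
  have mC := measurable_CylT (P n.+1) t.
  transitivity ((pr mu1 (Cyl (P n.+1) t))%:E); first by rewrite prE.
  by rewrite E // prE.
- by move=> S mS QS; rewrite /Q /= !probability_setC // QS.
- move=> F mF tF QF; rewrite /Q /= !measure_semi_bigcup //; try exact: bigcup_measurable.
  by apply: eq_eseriesr => k _; exact: QF.
by rewrite -space_generated.
Qed.

Lemma ssum_bweight_neq0 (R : realType) (q C : nat) (V : choiceType) (adj : rel V)
    (phi : nat -> V) (q_gt0 : (0 < q)%N) (phi_inj : injective phi)
    (phi_onto : forall x, exists n, phi n = x)
    (phi_adj : forall i j, adj (phi i) (phi j) = tree_adj q i j)
    (nu : R) (lam : 'I_C.+1 -> R) (nu_gt0 : 0 < nu) (lam_ge0 : forall i, 0 <= lam i)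
    (lam0_gt0 : 0 < lam ord0) (y : R) (y_gt0 : 0 < y) (tau : config adj 1 C) (n : nat) :
  (0 < n)%N ->
  ssum (prefix phi_adj n) (bweight phi_adj nu lam n (fun=> y)) tau != 0.
Proof.
move=> n0; pose tau0 : config adj 1 C := fun=> ord0.
have -> : ssum (prefix phi_adj n) (bweight phi_adj nu lam n (fun=> y)) tau =
    ssum (prefix phi_adj n) (bweight phi_adj nu lam n (fun=> y)) tau0.
  by apply: eq_bigr => u _; apply: bweight_depends => //; exact: glue_agree.
apply/eqP => /ssum_eq0 E.
have : 0 < bweight phi_adj nu lam n (fun=> y) tau0.
  apply: mulr_gt0; apply: prodr_gt0 => i _; last by rewrite expr0.
  by case: i => [|i]; rewrite /= ?expr0 ?mul1r ?mulr1 // /edge_ok /= mulr1.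
by rewrite E ?ltxx // => omega; apply: bweight_ge0 => // _; exact: ltW.
Qed.

Theorem theorem1p2 (R : realType) (q C : nat) (hq : (2 <= q)%N) (hC : (2 <= C)%N)
    (V : choiceType) (adj : rel V) (htree : is_regular_tree adj q.+1)
    (nu : R) (hnu : 0 < nu)
    (lam : 'I_C.+1 -> R) (hlam : forall i, 0 <= lam i) (hlam0 : 0 < lam ord0)
    (hLambda : 0 < Lambda lam (C - 1) ^+ 2 - Lambda lam C * Lambda lam (C - 2)) :
  multiple_Gibbs adj C (unicast_weights nu) lam <->
  in_calA q lam /\
  exists alpha_m alpha_p : R,
    [/\ 0 < alpha_m, alpha_m < alpha_p,
        root (Q q lam) alpha_m, root (Q q lam) alpha_p &
        J q lam alpha_m < nu < J q lam alpha_p].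
Proof.
have q0 : (0 < q)%N by exact: ltnW.
have AD : Lambda lam C * Lambda lam (C - 2) < Lambda lam (C - 1) ^+ 2 by rewrite -subr_gt0.
have D0 : 0 < Lambda lam (C - 2) by exact: Lambda_gt0.
have DB : Lambda lam (C - 2) <= Lambda lam (C - 1) by apply: Lambda_le; rewrite ?leq_sub2l.
have BA : Lambda lam (C - 1) <= Lambda lam C by apply: Lambda_le; rewrite ?leq_subr.
have [phi [phi_inj phi_onto phi_adj]] := tree_numbering q0 htree.
have [y y0 Gy] := tree_rec_fixpoint q D0 DB BA hnu.
rewrite -(slope_form_threshold hq hC hnu hlam hlam0 AD y0 Gy); split; last first.
  move=> /(two_cycle_exists D0 DB BA AD hnu hq y0 Gy)[l [u [l0 lu Gl Gu]]].
  exact: (multiple_Gibbs_of_two_cycle q0 hC phi_inj phi_onto phi_adj hnu hlam hlam0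
    (tree_symmetric htree) l0 lu Gl Gu).
move=> [mu1 [mu2 [G1 G2 [X mX]]]]; apply: contraNT; rewrite -leNgt => slope.
apply/eqP; apply: (@cylinders_determine _ _ _ _ _ (prefix phi_adj)) mX.
  exact: prefix_sup.
move=> n tau n0.
have mE mu (G : is_Gibbs C (unicast_weights nu) lam mu) :=
  Gibbs_marginal hq hC phi_inj phi_onto phi_adj hnu hlam hlam0 AD y0 Gy slope G tau n0.
(* Both marginals solve the same linear equation, whose coefficient is nonzero. *)
apply: (mulfI (ssum_bweight_neq0 q0 phi_inj phi_onto phi_adj hnu hlam hlam0 y0 tau n0)).
by rewrite !mE.
Qed.
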